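(* Let $A \subseteq \mathbb{N}_{\geq 2}$ be a non-empty set of integers. Then the set of finite presentations of $A$-torsion-free groups is $\Pi^{0}_{2}$-hard. Moreover, if $A$ is recursively enumerable, then this set of finite presentations is $\Pi^{0}_{2}$-complete.
   Context: For a group $G$ and set of integers $A$, $G$ is $A$-torsion-free if there is no $g \neq e$ in $G$ with $g^{n} = e$ for some $n \in A$. $\Pi^{0}_{2}$ refers to the corresponding level of Kleene's arithmetic hierarchy; hardness and completeness are with respect to many-one reductions, with finite presentations coded as natural numbers in a standard way. *)

(* Defs.v *)
From Stdlib Require Import Arith List Lia.
Import ListNotations.

Inductive rf : Type :=
| RZero : rf
| RSucc : rf
| RProj : nat -> rf
| RComp : rf -> list rf -> rf
| RPrec : rf -> rf -> rf
| RMu   : rf -> rf.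

(* big-step semantics; projections out of range return 0 *)
Inductive reval : rf -> list nat -> nat -> Prop :=
| ev_zero v : reval RZero v 0
| ev_succ v : reval RSucc v (S (hd 0 v))
| ev_proj i v : reval (RProj i) v (nth i v 0)
| ev_comp f gs v ys y :
    Forall2 (fun g yi => reval g v yi) gs ys -> reval f ys y -> reval (RComp f gs) v y
| ev_prec0 f g v y : reval f v y -> reval (RPrec f g) (0 :: v) y
| ev_precS f g n v z y :
    reval (RPrec f g) (n :: v) z -> reval g (n :: z :: v) y ->
    reval (RPrec f g) (S n :: v) y
| ev_mu f v n :
    reval f (n :: v) 0 ->
    (forall m, m < n -> exists k, reval f (m :: v) (S k)) ->
    reval (RMu f) v n.

Definition computable (f : nat -> nat) : Prop :=
  exists c, forall n, reval c [n] (f n).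

Definition decidable2 (R : nat -> nat -> Prop) : Prop :=
  exists c, forall a b, exists y, reval c [a; b] y /\ (R a b <-> y = 0).

Definition decidable3 (R : nat -> nat -> nat -> Prop) : Prop :=
  exists c, forall a b d, exists y, reval c [a; b; d] y /\ (R a b d <-> y = 0).

Definition RE (S : nat -> Prop) : Prop :=
  exists R, decidable2 R /\ forall n, S n <-> exists y, R n y.

Definition Pi02 (S : nat -> Prop) : Prop :=
  exists R, decidable3 R /\ forall n, S n <-> forall x, exists y, R n x y.

Definition m_reducible (S T : nat -> Prop) : Prop :=
  exists f, computable f /\ forall n, S n <-> T (f n).

Definition Pi02_hard (T : nat -> Prop) : Prop :=
  forall S, Pi02 S -> m_reducible S T.

Definition Pi02_complete (T : nat -> Prop) : Prop :=
  Pi02 T /\ Pi02_hard T.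

(* letters: 2i codes x_i, 2i+1 codes x_i^{-1} *)
Definition letter_inv (a : nat) : nat := if Nat.even a then S a else pred a.

(* The congruence on words defining the group <x_0..x_{k-1} | rels>:
   generated by free cancellation and deletion of relators. *)
Inductive word_step (rels : list (list nat)) : list nat -> list nat -> Prop :=
| ws_cancel u v a : word_step rels (u ++ a :: letter_inv a :: v) (u ++ v)
| ws_rel u v r : In r rels -> word_step rels (u ++ r ++ v) (u ++ v).

Inductive word_eq (rels : list (list nat)) : list nat -> list nat -> Prop :=
| we_refl w : word_eq rels w w
| we_step w1 w2 : word_step rels w1 w2 -> word_eq rels w1 w2
| we_sym w1 w2 : word_eq rels w1 w2 -> word_eq rels w2 w1
| we_trans w1 w2 w3 : word_eq rels w1 w2 -> word_eq rels w2 w3 -> word_eq rels w1 w3.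

Definition valid_word (k : nat) (w : list nat) : Prop := Forall (fun a => a < 2 * k) w.

Fixpoint word_pow (w : list nat) (n : nat) : list nat :=
  match n with 0 => [] | S m => w ++ word_pow w m end.

Definition pres_A_torsion_free (A : nat -> Prop) (k : nat) (rels : list (list nat)) : Prop :=
  forall w n, valid_word k w -> A n -> word_eq rels (word_pow w n) [] -> word_eq rels w [].

Definition cpair (x y : nat) : nat := (x + y) * S (x + y) / 2 + y.

Fixpoint code_list (l : list nat) : nat :=
  match l with [] => 0 | x :: l' => S (cpair x (code_list l')) end.

Definition code_pres (k : nat) (rels : list (list nat)) : nat :=
  cpair k (code_list (map code_list rels)).

Definition TF_presentations (A : nat -> Prop) (n : nat) : Prop :=
  exists k rels, n = code_pres k rels /\ Forall (valid_word k) rels /\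
    pres_A_torsion_free A k rels.

(* Main.v *)
(** A Pi02 set is the set of n such that a register machine started on (n, x) halts for every x. Coding
    registers as valuations, machine and input n become finitely many rules "m u + j ~ m' u + j'" on the
    integers, where n enters only in one coefficient 3^n Q: n lies in the set iff every Q x is equivalent
    to one of finitely many targets.

    Fix a in A. In F3 = <b, d, g> the commutators u_i = [b^i d b^-i, g] are free. Adjoin z with
    z u_i z^-1 = u_(i+1); one stable letter per rule with r z^m r^-1 = z^m', r u_j r^-1 = u_j', so that
    r u_(m v + j) r^-1 = u_(m' v + j'); and one commuting with z^Q and conjugating u_0^a to u_Q^a. By
    Britton's lemma the subgroup L generated by the stable letters, the targets u_t and u_0^a meets F3
    exactly in the subgroup generated by u_i for i equivalent to a target and u_i^a for i equivalent to
    some Q x. Higman's rope trick then imposes these relations on a second copy of F3: let y centralize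
    L, let the copy commute with z, y, F3 and the stable letters, and let s fix y f y^-1 and conjugate
    f to f f', where f' is the copy of f. Hence u'_i = 1 for i equivalent to a target, and
    (u'_i)^a = 1 for i equivalent to some Q x.

    If every Q x is equivalent to a target, the copy collapses to an HNN extension of a free group by a letter
    g' commuting with some of the b'^i d' b'^-i, and the whole group is an iterated HNN extension of
    torsion-free groups, hence torsion-free. Otherwise some u'_i of exponent a is nontrivial: the same
    tower can be built over a permutation group in which u_i acts as an a-cycle.

    For the upper bound, w^k = 1 with k in A and w = 1 both have decidable certificates. *)

Require Import Defs.
From Stdlib Require Import Arith List.
From Stdlib Require Import ZArith Znumtheory Lia Bool ssreflect Relations.
From Stdlib Require Import ClassicalEpsilon FunctionalExtensionality PropExtensionality ProofIrrelevance.
Import ListNotations.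

Set Implicit Arguments.
Unset Strict Implicit.
Set Bullet Behavior "None".
Open Scope general_if_scope.
Open Scope nat_scope.
Arguments Z.mul : simpl never.
Arguments Z.add : simpl never.
Arguments Z.of_nat : simpl never.

(** * Affine rules on the integers *)

(** Group relations can be read backwards, so the rules generate an equivalence and not a
    reachability relation. The machine is therefore deterministic, and non-halting rests on a
    property invariant under steps in both directions. A class can be tested against finitely many
    targets only, so a halted machine destroys its remaining value by halving. The constant 3 is the
    base of register 1, where n is loaded.

    The quantifier over x costs one stable letter: it carries u_0^a to every u_(Qx)^a inside L but
    leaves u_0 itself out. So each u'_(Qx) has a-th power 1 in any case; it is torsion unless it is
    trivial, and halting is what makes it trivial.

    The presented group P is never identified. If all starts halt, a torsion-free group G that
    satisfies the relations and maps to P compatibly with the generators is enough: a torsion word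
    of P dies in G, hence in P. Otherwise any model in which some u'_(Qx) survives is enough. Both
    come from one construction, whose parameter is a homomorphism [psi] on F3 that kills L ∩ F3. *)

Notation dec := excluded_middle_informative.

(* The rule (m, j, m', j') identifies m u + j with m' u + j' for every u. *)
Definition rule := (Z * Z * Z * Z)%type.
Definition wf_rule (r : rule) := let '(m, j, m', j') := r in (0 < m /\ 0 < m')%Z.
Definition rule_rel (r : rule) (i i' : Z) :=
  let '(m, j, m', j') := r in exists u, (i = m * u + j /\ i' = m' * u + j')%Z.
Definition eqv_of (rl : nat -> rule) : Z -> Z -> Prop :=
  clos_refl_sym_trans _ (fun i i' => exists k, rule_rel (rl k) i i').
Definition halts_of (rl : nat -> rule) (tg : list Z) i := exists t, In t tg /\ eqv_of rl i t.

(** * Register machines *)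

Definition store := nat -> nat.
Definition upd (s : store) (r v : nat) : store := fun x => if x =? r then v else s x.

(** A loop decrements its register before each pass. Merging test and decrement fits the affine
    rules: divisibility by the base of a register is tested by the very rule that divides by it. *)
Inductive cmd : Type :=
| Skip : cmd
| Inc : nat -> cmd
| Seq : cmd -> cmd -> cmd
| Loop : nat -> cmd -> cmd.

Inductive exec : cmd -> store -> store -> Prop :=
| ex_skip s : exec Skip s s
| ex_inc r s : exec (Inc r) s (upd s r (S (s r)))
| ex_seq c d s s1 s2 : exec c s s1 -> exec d s1 s2 -> exec (Seq c d) s s2
| ex_loop0 r c s : s r = 0 -> exec (Loop r c) s s
| ex_loopS r c s v s1 s2 : s r = S v -> exec c (upd s r v) s1 -> exec (Loop r c) s1 s2 -> exec (Loop r c) s s2.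

Ltac store_eq := apply: functional_extensionality => ?; rewrite /upd;
  repeat match goal with |- context [?x =? ?y] => case: (Nat.eqb_spec x y) => ?; try subst end; try lia; try congruence.

Lemma upd_same s r v : upd s r v r = v.
Proof. by rewrite /upd Nat.eqb_refl. Qed.
Lemma upd_other s r v x : x <> r -> upd s r v x = s x.
Proof. by rewrite /upd => /Nat.eqb_neq ->. Qed.
Lemma upd_upd s r v w : upd (upd s r v) r w = upd s r w.
Proof. store_eq. Qed.
Lemma upd_id s r : upd s r (s r) = s.
Proof. store_eq. Qed.

Lemma exec_clear a s : exec (Loop a Skip) s (upd s a 0).
Proof.
move e : (s a) => n; elim: n s e => [|n IH] s e.
  have -> : upd s a 0 = s by rewrite -{2}(upd_id s a) e.
  exact: ex_loop0.
apply: (ex_loopS e (ex_skip _)).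
have -> : upd s a 0 = upd (upd s a n) a 0 by rewrite upd_upd.
by apply: IH; rewrite upd_same.
Qed.
Lemma exec_move a b s : a <> b -> exec (Loop a (Inc b)) s (upd (upd s b (s b + s a)) a 0).
Proof.
move=> ab; move e : (s a) => n; elim: n s e => [|n IH] s e.
  have -> : upd (upd s b (s b + 0)) a 0 = s by store_eq.
  exact: ex_loop0.
apply: (ex_loopS e (ex_inc _ _)).
set s1 := upd _ _ _; have -> : upd (upd s b (s b + S n)) a 0 = upd (upd s1 b (s1 b + n)) a 0.
  by rewrite /s1 /upd Nat.eqb_refl; case: (Nat.eqb_spec b a) => [|_]; [congruence|store_eq].
by apply: IH; rewrite /s1 upd_other // upd_same.
Qed.
(** A move empties its source, so the value travels through the empty register [t], which then
    refills [a] while it is added to [b]. *)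
Definition copy a b t := Seq (Loop a (Inc t)) (Loop t (Seq (Inc a) (Inc b))).
Lemma exec_copy a b t s : a <> b -> a <> t -> b <> t -> s t = 0 -> exec (copy a b t) s (upd s b (s b + s a)).
Proof.
move=> ab at_ bt t0; apply: ex_seq; first exact: exec_move.
rewrite t0 Nat.add_0_l.
have h : forall n s, s t = n -> exec (Loop t (Seq (Inc a) (Inc b))) s (upd (upd (upd s a (s a + n)) b (s b + n)) t 0).
  elim=> [|n IH] s' e.
    have -> : upd (upd (upd s' a (s' a + 0)) b (s' b + 0)) t 0 = s' by store_eq.
    exact: ex_loop0.
  apply: (ex_loopS e (ex_seq (ex_inc _ _) (ex_inc _ _))).
  set s1 := upd _ b _.
  have -> : upd (upd (upd s' a (s' a + S n)) b (s' b + S n)) t 0 = upd (upd (upd s1 a (s1 a + n)) b (s1 b + n)) t 0.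
    have -> : s1 a = S (s' a) by rewrite /s1 upd_other // upd_same upd_other //; lia.
    have -> : s1 b = S (s' b) by rewrite /s1 upd_same !upd_other //; lia.
    by rewrite /s1; store_eq.
  apply: IH; rewrite /s1 upd_other; first by lia.
  rewrite upd_other; first by lia.
  exact: upd_same.
set s1 := upd _ _ _; have e : s1 t = s a by rewrite /s1 upd_other ?upd_same //; lia.
have -> : upd s b (s b + s a) = upd (upd (upd s1 a (s1 a + s a)) b (s1 b + s a)) t 0; last exact: h.
by rewrite /s1; store_eq.
Qed.

Fixpoint seqs (l : list cmd) : cmd := match l with [] => Skip | c :: l' => Seq c (seqs l') end.

(* cg c args out F computes c on the registers args into the register out, which must be 0;
   the registers from F on are scratch space, 0 before and after. *)
Fixpoint cg (c : rf) (args : list nat) (out F : nat) {struct c} : cmd :=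
  match c with
  | RZero => Skip
  | RSucc => Seq (match args with [] => Skip | a :: _ => copy a out F end) (Inc out)
  | RProj i => match nth_error args i with Some a => copy a out F | None => Skip end
  | RComp f gs =>
      let k := length gs in
      Seq ((fix cgs (gs : list rf) (j : nat) : cmd :=
             match gs with [] => Skip | g :: gs' => Seq (cg g args j (F + k)) (cgs gs' (S j)) end) gs F)
        (Seq (cg f (seq F k) out (F + k)) (seqs (map (fun r => Loop r Skip) (seq F k))))
  | RPrec f g =>
      match args with
      | [] => Skip
      | a :: rest =>
          Seq (copy a (F + 2) (F + 3))
          (Seq (cg f rest (F + 1) (F + 4))
          (Seq (Loop (F + 2)
                 (Seq (cg g (F :: (F + 1) :: rest) (F + 3) (F + 4))
                 (Seq (Loop (F + 1) Skip) (Seq (Loop (F + 3) (Inc (F + 1))) (Inc F)))))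
          (Seq (Loop (F + 1) (Inc out)) (Loop F Skip))))
      end
  | RMu f =>
      Seq (cg f (F :: args) (F + 1) (F + 2))
      (Seq (Loop (F + 1) (Seq (Loop (F + 1) Skip) (Seq (Inc F) (cg f (F :: args) (F + 1) (F + 2)))))
      (Loop F (Inc out)))
  end.

(** The generated induction principle gives no hypothesis for the functions in the list of
    [RComp]. *)
Fixpoint rf_ind' (P : rf -> Prop) (h0 : P RZero) (h1 : P RSucc) (h2 : forall i, P (RProj i))
  (h3 : forall f gs, P f -> Forall P gs -> P (RComp f gs))
  (h4 : forall f g, P f -> P g -> P (RPrec f g)) (h5 : forall f, P f -> P (RMu f)) (c : rf) : P c :=
  match c with
  | RZero => h0 | RSucc => h1 | RProj i => h2 i
  | RComp f gs => h3 f gs (rf_ind' h0 h1 h2 h3 h4 h5 f)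
      ((fix go gs : Forall P gs := match gs with [] => Forall_nil _ | g :: gs' =>
         Forall_cons _ (rf_ind' h0 h1 h2 h3 h4 h5 g) (go gs') end) gs)
  | RPrec f g => h4 f g (rf_ind' h0 h1 h2 h3 h4 h5 f) (rf_ind' h0 h1 h2 h3 h4 h5 g)
  | RMu f => h5 f (rf_ind' h0 h1 h2 h3 h4 h5 f)
  end.

Definition cg_pre (s : store) (v args : list nat) (out F : nat) :=
  map s args = v /\ (forall a, In a args -> a < F) /\ out < F /\ s out = 0 /\ (forall r, F <= r -> s r = 0) /\ ~ In out args.

Lemma exec_clears s F k : exec (seqs (map (fun r => Loop r Skip) (seq F k))) s (fun r => if (F <=? r) && (r <? F + k) then 0 else s r).
Proof.
elim: k F s => [|k IH] F s /=.
  set t := (X in exec _ _ X); have -> : t = s; last exact: ex_skip.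
  apply: functional_extensionality => r; rewrite /t.
  by case: (Nat.leb_spec F r); case: (Nat.ltb_spec r (F + 0)) => //=; lia.
apply: ex_seq; first exact: exec_clear.
set t := (X in exec _ _ X); have -> : t = (fun r => if (S F <=? r) && (r <? S F + k) then 0 else upd s F 0 r); last exact: IH.
apply: functional_extensionality => r; rewrite /t /upd.
case: (Nat.leb_spec F r); case: (Nat.ltb_spec r (F + S k)); case: (Nat.leb_spec (S F) r);
  case: (Nat.ltb_spec r (S F + k)); case: (Nat.eqb_spec r F) => //=; lia.
Qed.

Lemma cg_correct c : forall v y, reval c v y -> forall s args out F, cg_pre s v args out F ->
  exec (cg c args out F) s (upd s out y).
Proof.
elim/rf_ind': c.
- move=> v y h s args out F [e [ha [ho [so [sF ni]]]]]; inversion h; subst.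
  have -> : upd s out 0 = s by rewrite -{2}(upd_id s out) so.
  exact: ex_skip.
- move=> v y h s args out F [e [ha [ho [so [sF ni]]]]]; inversion h; subst => /=.
  apply: (@ex_seq _ _ _ (upd s out (hd 0 (map s args)))).
    case: args ha ni {h} => [|a args] ha ni /=.
      have -> : upd s out 0 = s by rewrite -{2}(upd_id s out) so.
      exact: ex_skip.
    have := @exec_copy a out F s; rewrite so Nat.add_0_l; apply.
    + by move=> e; apply: ni; left.
    + have := ha a (or_introl eq_refl); lia.
    + lia.
    + exact: sF.
  set t := upd s out (hd 0 (map s args)).
  have -> : upd s out (S (hd 0 (map s args))) = upd t out (S (t out)); last exact: ex_inc.
  by rewrite /t upd_same upd_upd.
- move=> i v y h s args out F [e [ha [ho [so [sF ni]]]]]; inversion h; subst => /=.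
  case en : (nth_error args i) => [a|].
    have hin := nth_error_In _ _ en.
    have -> : nth i (map s args) 0 = s a.
      by apply: nth_error_nth; rewrite nth_error_map en.
    have := @exec_copy a out F s; rewrite so Nat.add_0_l; apply.
    + by move=> e; subst.
    + have := ha a hin; lia.
    + lia.
    + exact: sF.
  have -> : nth i (map s args) 0 = 0.
    by apply: nth_overflow; rewrite length_map; apply/nth_error_None.
  have -> : upd s out 0 = s by rewrite -{2}(upd_id s out) so.
  exact: ex_skip.
- move=> f gs IHf IHgs v y h s args out F [e [ha [ho [so [sF ni]]]]].
  inversion h as [| | |? ? ? ys ? hgs hf| | |]; subst; rewrite /=.
  set k := length gs.
  have lk : length ys = k by symmetry; exact: Forall2_length hgs.
  (* The store in the middle of a composition: the results found so far fill the registers from [F]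
     up to [j], and everything else is as in [s]. *)
  pose st j (zs : list nat) : store := fun r => if (F <=? r) && (r <? j) then nth (r - F) zs 0 else s r.
  have hst : forall gs' ys' ys0, Forall2 (fun g yi => reval g (map s args) yi) gs' ys' ->
     Forall (fun c => forall v y, reval c v y -> forall s args out F, cg_pre s v args out F -> exec (cg c args out F) s (upd s out y)) gs' ->
     length ys0 + length ys' = k ->
     exec ((fix cgs (gs : list rf) (j : nat) : cmd :=
             match gs with [] => Skip | g :: gs' => Seq (cg g args j (F + k)) (cgs gs' (S j)) end) gs' (F + length ys0))
       (st (F + length ys0) ys0) (st (F + k) (ys0 ++ ys')).
    move=> gs' ys' ys0 h2; elim: h2 ys0 {h hgs IHgs hf lk} => [|g y' gs'' ys'' hg _ IH] ys0 IHs el.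
      rewrite app_nil_r; have <- : length ys0 = k by rewrite /= in el; lia.
      exact: ex_skip.
    inversion IHs as [|? ? IHg IHs']; subst.
    apply: (@ex_seq _ _ _ (st (F + length (ys0 ++ [y'])) (ys0 ++ [y']))).
      have -> : st (F + length (ys0 ++ [y'])) (ys0 ++ [y']) = upd (st (F + length ys0) ys0) (F + length ys0) y'.
        apply: functional_extensionality => r; rewrite /st /upd length_app /=.
        case: (Nat.eqb_spec r (F + length ys0)) => [->|ne].
          case: (Nat.leb_spec F (F + length ys0)); case: (Nat.ltb_spec (F + length ys0) (F + (length ys0 + 1))) => //=; try lia.
          by move=> _ _; rewrite Nat.add_comm Nat.add_sub nth_middle.
        case: (Nat.leb_spec F r); case: (Nat.ltb_spec r (F + (length ys0 + 1))); case: (Nat.ltb_spec r (F + length ys0)) => //=; try lia.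
        by move=> *; rewrite app_nth1 //; lia.
      rewrite /= in el; apply: (IHg _ _ hg); split.
        apply: map_ext_in => r hr; rewrite /st; case: (Nat.leb_spec F r) => //= hF.
        by have := ha r hr; lia.
      split; first by move=> r hr; have := ha r hr; lia.
      split; first by lia.
      split; first by rewrite /st Nat.ltb_irrefl andb_false_r; apply: sF; lia.
      split; first by move=> r hr; rewrite /st; case: (Nat.ltb_spec r (F + length ys0)); try lia; move=> _; rewrite andb_false_r; apply: sF; lia.
      by move=> hr; have := ha _ hr; lia.
    have := IH (ys0 ++ [y']) IHs'.
    rewrite length_app /= -app_assoc /= => hh.
    have -> : S (F + length ys0) = F + (length ys0 + 1) by lia.
    apply: hh; rewrite /= in el; lia.
  have h1 := hst gs ys [] hgs IHgs lk; rewrite Nat.add_0_r /= in h1.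
  have es : st F [] = s.
    apply: functional_extensionality => r; rewrite /st.
    by case: (Nat.leb_spec F r); case: (Nat.ltb_spec r F) => //=; lia.
  rewrite es in h1; apply: (ex_seq h1).
  apply: (@ex_seq _ _ _ (upd (st (F + k) ys) out y)).
    apply: (IHf _ _ hf); split.
      apply: (nth_ext _ _ 0 0); first by rewrite length_map length_seq.
      move=> i; rewrite length_map length_seq => hi.
      rewrite (nth_indep _ 0 (st (F + k) ys 0)) ?length_map ?length_seq // map_nth seq_nth //.
      rewrite /st; case: (Nat.leb_spec F (F + i)); case: (Nat.ltb_spec (F + i) (F + k)) => //=; try lia.
      by move=> _ _; congr nth; lia.
    split; first by move=> r /in_seq; lia.
    split; first by lia.
    split; first by rewrite /st; case: (Nat.leb_spec F out) => //=; lia.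
    split.
      move=> r hr; rewrite /st; case: (Nat.ltb_spec r (F + k)); try lia.
      by move=> _; rewrite andb_false_r; apply: sF; lia.
    by move/in_seq; lia.
  have h2 := @exec_clears (upd (st (F + k) ys) out y) F k.
  suff <- : (fun r => if (F <=? r) && (r <? F + k) then 0 else upd (st (F + k) ys) out y r) = upd s out y by [].
  apply: functional_extensionality => r; rewrite /upd /st.
  case: (Nat.leb_spec F r); case: (Nat.ltb_spec r (F + k)); case: (Nat.eqb_spec r out) => //=; try lia.
  by move=> *; rewrite sF.
- move=> f g IHf IHg v y h s args out F [e [ha [ho [so [sF ni]]]]].
  case: args e ha ni => [|a rest] e ha ni; first by subst; inversion h.
  subst v; rewrite /= in h *.
  move en : (s a) h => n h.
  (* [F] holds the recursion index, [F + 1] the value at that index, [F + 2] the number of passes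
     left. *)
  pose st (i z k : nat) := upd (upd (upd s F i) (F + 1) z) (F + 2) k.
  have lta := ha a (or_introl eq_refl).
  have ltr : forall r, In r rest -> r < F by move=> r hr; apply: ha; right.
  have st0 : st 0 0 n = upd s (F + 2) n.
    rewrite /st; have -> : upd s F 0 = s by rewrite -{2}(upd_id s F) sF //; lia.
    by have -> : upd s (F + 1) 0 = s by rewrite -{2}(upd_id s (F + 1)) sF //; lia.
  have stF : forall i z k r, F + 3 <= r -> st i z k r = 0.
    by move=> i z k r hr; rewrite /st !upd_other; try lia; apply: sF; lia.
  have strest : forall i z k, map (st i z k) rest = map s rest.
    by move=> i z k; apply: map_ext_in => r hr; have := ltr r hr => ?; rewrite /st !upd_other //; lia.
  set body := Seq (cg g _ _ _) _.
  have hbody : forall i z z' k, reval g (i :: z :: map s rest) z' -> exec body (st i z k) (st (S i) z' k).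
    move=> i z z' k hg; rewrite /body.
    apply: (@ex_seq _ _ _ (upd (st i z k) (F + 3) z')).
      apply: (IHg _ _ hg); split.
        rewrite /= strest; congr (_ :: _ :: _); rewrite /st /upd;
        repeat (case: (Nat.eqb_spec _ _) => ?; try lia); by [].
      split; first by move=> r /= [<-|[<-|hr]]; [lia|lia|have := ltr r hr; lia].
      split; first by lia.
      split; first by apply: stF.
      split; first by move=> r hr; apply: stF; lia.
      by move=> /= [?|[?|hr]]; [lia|lia|have := ltr _ hr; lia].
    apply: ex_seq; first exact: exec_clear.
    apply: ex_seq; first by apply: exec_move; lia.
    set t := upd _ _ _; have -> : st (S i) z' k = upd t F (S (t F)); last exact: ex_inc.
    have -> : t F = i by rewrite /t /st /upd; repeat (case: (Nat.eqb_spec _ _) => ?; try lia).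
    rewrite /t !upd_same (@upd_other _ (F + 1)) ?upd_same; try lia.
    apply: functional_extensionality => r; rewrite /st /upd.
    repeat (case: (Nat.eqb_spec _ _) => ?; try lia); by apply: sF; lia.
  (* The evaluation unwinds from its last step while the loop starts at index 0. The claim therefore
     prepends passes to an arbitrary remaining run of the loop. *)
  have chain : forall n y, reval (RPrec f g) (n :: map s rest) y -> exists z0, reval f (map s rest) z0 /\
      forall k sf, exec (Loop (F + 2) body) (st n y k) sf -> exec (Loop (F + 2) body) (st 0 z0 (n + k)) sf.
    elim=> [|m IH] y' h'.
      by inversion h'; subst; exists y'.
    inversion h' as [| | | | |? ? ? ? z ? hz hg|]; subst.
    have [z0 [hz0 hk]] := IH _ hz.
    exists z0; split=> // k sf hsf.
    have -> : S m + k = m + S k by lia.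
    apply: hk; apply: (@ex_loopS _ _ _ k); first by rewrite /st upd_same.
      rewrite /st upd_upd; exact: (hbody m z y' k hg).
    exact: hsf.
  have [z0 [hz0 hk]] := chain n y h.
  apply: (@ex_seq _ _ _ (st 0 0 n)).
    rewrite st0 -en; have {1}-> : s a = s (F + 2) + s a by rewrite (sF (F + 2)) //; lia.
    by apply: exec_copy; [lia|lia|lia|apply: sF; lia].
  apply: (@ex_seq _ _ _ (st 0 z0 n)).
    have -> : st 0 z0 n = upd (st 0 0 n) (F + 1) z0 by rewrite /st; store_eq.
    apply: (IHf _ _ hz0); split; first exact: strest.
    split; first by move=> r hr; have := ltr r hr; lia.
    split; first by lia.
    split; first by rewrite /st /upd; repeat (case: (Nat.eqb_spec _ _) => ?; try lia).
    split; first by move=> r hr; apply: stF; lia.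
    by move=> hr; have := ltr _ hr; lia.
  apply: (@ex_seq _ _ _ (st n y 0)).
    by rewrite -{1}(Nat.add_0_r n); apply: hk; apply: ex_loop0; rewrite /st upd_same.
  apply: ex_seq; first by apply: exec_move; lia.
  set t := upd _ _ _; have -> : upd s out y = upd t F 0; last exact: exec_clear.
  apply: functional_extensionality => r; rewrite /t /st /upd.
  repeat (case: (Nat.eqb_spec _ _) => ?; subst; try lia); by apply: sF; lia.
- move=> f IHf v y h s args out F [e [ha [ho [so [sF ni]]]]].
  inversion h as [| | | | | |? ? n hn hm]; subst; rewrite /=.
  pose st (i t : nat) := upd (upd s F i) (F + 1) t.
  have stF : forall i t r, F + 2 <= r -> st i t r = 0.
    by move=> i t r hr; rewrite /st !upd_other; try lia; apply: sF; lia.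
  have st00 : st 0 0 = s.
    rewrite /st; have -> : upd s F 0 = s by rewrite -{2}(upd_id s F) sF //; lia.
    by rewrite -{2}(upd_id s (F + 1)) sF //; lia.
  have stargs : forall i t, map (st i t) args = map s args.
    by move=> i t; apply: map_ext_in => r hr; have := ha r hr => ?; rewrite /st !upd_other //; lia.
  have call : forall i t, reval f (i :: map s args) t -> exec (cg f (F :: args) (F + 1) (F + 2)) (st i 0) (st i t).
    move=> i t hf; have -> : st i t = upd (st i 0) (F + 1) t by rewrite /st upd_upd.
    apply: (IHf _ _ hf); split.
      by rewrite /= stargs; congr (_ :: _); rewrite /st upd_other ?upd_same //; lia.
    split; first by move=> r /= [<-|hr]; [lia|have := ha r hr; lia].
    split; first by lia.
    split; first by rewrite /st upd_same.
    split; first by move=> r hr; apply: stF; lia.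
    by move=> /= [?|hr]; [lia|have := ha _ hr; lia].
  set body := Seq (Loop (F + 1) Skip) _.
  have loop : forall d m t, m + d = y -> reval f (m :: map s args) t -> (m < y -> t <> 0) -> (m = y -> t = 0) ->
      exec (Loop (F + 1) body) (st m t) (st y 0).
    elim=> [|d IH] m t el hf h1 h2.
      have em : m = y by lia.
      rewrite (h2 em) em; apply: ex_loop0; by rewrite /st upd_same.
    have lm : m < y by lia.
    case: t hf h1 h2 => [|t] hf h1 h2; first by case: (h1 lm).
    have [t' [ht' [h1' h2']]] : exists t', reval f (S m :: map s args) t' /\ (S m < y -> t' <> 0) /\ (S m = y -> t' = 0).
      case: (Nat.eq_dec (S m) y) => es; first by exists 0; rewrite es; split=> //; split=> //; lia.
      have [|k hk] := hm (S m); first by lia.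
      by exists (S k); split=> //; split=> //; lia.
    apply: (@ex_loopS _ _ _ t (st (S m) t')); first by rewrite /st upd_same.
      apply: ex_seq; first exact: exec_clear.
      have -> : upd (upd (st m (S t)) (F + 1) t) (F + 1) 0 = st m 0 by rewrite /st !upd_upd.
      apply: (@ex_seq _ _ _ (st (S m) 0)); last exact: call.
      have -> : st (S m) 0 = upd (st m 0) F (S (st m 0 F)); last exact: ex_inc.
      have -> : st m 0 F = m by rewrite /st upd_other ?upd_same //; lia.
      by rewrite /st; store_eq.
    by apply: IH => //; lia.
  have [t0 [ht0 [h1 h2]]] : exists t', reval f (0 :: map s args) t' /\ (0 < y -> t' <> 0) /\ (0 = y -> t' = 0).
    case: (Nat.eq_dec 0 y) => es; first by exists 0; split; [move: hn; rewrite -es|split; lia].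
    have [|k hk] := hm 0; first by lia.
    by exists (S k); split=> //; split=> //; lia.
  apply: (@ex_seq _ _ _ (st 0 t0)); first by rewrite -{1}st00; exact: call.
  apply: (@ex_seq _ _ _ (st y 0)); first by apply: (loop y).
  set t := st y 0; have -> : upd s out y = upd (upd t out (t out + t F)) F 0; last by apply: exec_move; lia.
  have -> : t F = y by rewrite /t /st upd_other ?upd_same //; lia.
  have -> : t out = 0 by rewrite /t /st !upd_other //; lia.
  apply: functional_extensionality => r; rewrite /t /st /upd.
  case: (Nat.eqb_spec r out) => e1; case: (Nat.eqb_spec r F) => e2;
    case: (Nat.eqb_spec r (F + 1)) => e3; try lia; apply: sF; lia.
Qed.

(** * Simulating register machines by affine rules *)

(* Pairwise coprime integers: the Sylvester sequence 2, 3, 7, 43, ... *)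
Fixpoint sylp (r : nat) : Z := match r with O => 1%Z | S r' => (sylp r' * (sylp r' + 1))%Z end.
Definition syl (r : nat) : Z := (sylp r + 1)%Z.
Lemma sylp_pos r : (1 <= sylp r)%Z.
Proof. elim: r => [|r IH] /=; nia. Qed.
Arguments sylp_pos : clear implicits.
Lemma syl_ge2 r : (2 <= syl r)%Z.
Proof. rewrite /syl; have := sylp_pos r; lia. Qed.
Arguments syl_ge2 : clear implicits.
(** [sylp r'] is the product of all [syl s] with s < r', and [syl r'] exceeds it by one; this is
    what makes distinct terms coprime. *)
Lemma syl_dvd r r' : r < r' -> (syl r | sylp r')%Z.
Proof.
elim: r' => [|r' IH] lt /=; first by lia.
case: (Nat.eq_dec r r') => [->|ne]; first by exists (sylp r').
by apply: Z.divide_mul_l; apply: IH; lia.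
Qed.
Lemma syl_coprime r r' : r <> r' -> rel_prime (syl r) (syl r').
Proof.
have h : forall r r', r < r' -> rel_prime (syl r) (syl r').
  move=> s s' /syl_dvd [k e]; apply: bezout_rel_prime.
  by apply: (@Bezout_intro _ _ _ (- k) 1); rewrite /syl in e *; lia.
move=> ne; case: (Nat.lt_ge_cases r r') => lt; first exact: h.
by apply: rel_prime_sym; apply: h; lia.
Qed.
Fixpoint pw (b : Z) (k : nat) : Z := match k with O => 1%Z | S k => (b * pw b k)%Z end.
Lemma pw_pos b k : (0 < b -> 0 < pw b k)%Z.
Proof. move=> h; elim: k => [|k IH] /=; nia. Qed.
Lemma pw_coprime r r' k : r <> r' -> rel_prime (pw (syl r') k) (syl r).
Proof.
move=> ne; apply: rel_prime_sym; elim: k => [|k IH] /=; first exact: rel_prime_1 || (apply: rel_prime_sym; exact: rel_prime_1).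
apply: rel_prime_mult => //; exact: syl_coprime.
Qed.
(** The base need not be prime: the term after 43 is 1807 = 13 * 139. Hence the lemmas treat
    multiplication only by the base itself and by other terms of the sequence, which are coprime to
    it. *)
Definition val (r : nat) (u : Z) (k : nat) := (pw (syl r) k | u)%Z /\ ~ (pw (syl r) (S k) | u)%Z.
Lemma val_inc r u k : val r (syl r * u) (S k) <-> val r u k.
Proof.
have h : forall j, (pw (syl r) (S j) | syl r * u)%Z <-> (pw (syl r) j | u)%Z.
  move=> j; split=> [] [w e]; exists w; rewrite /= in e *; have := syl_ge2 r; nia.
by rewrite /val !h.
Qed.
Lemma val_other r r' u k : r <> r' -> (val r' (syl r * u) k <-> val r' u k).
Proof.
move=> ne; have h : forall j, (pw (syl r') j | syl r * u)%Z <-> (pw (syl r') j | u)%Z.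
  move=> j; split; last exact: Z.divide_mul_r.
  by move=> d; apply: Gauss d _; exact: pw_coprime.
by rewrite /val !h.
Qed.
Lemma pw_dvd b j k : j <= k -> (pw b j | pw b k)%Z.
Proof.
move=> le; have -> : k = (k - j) + j by lia.
elim: (k - j) => [|m IH] /=; first exact: Z.divide_refl.
exact: Z.divide_mul_r.
Qed.
Lemma val_uniq r u j k : val r u j -> val r u k -> j = k.
Proof.
have h : forall j k, val r u j -> val r u k -> j <= k.
  move=> a b [h1 h2] [h3 h4]; case: (Nat.le_gt_cases a b) => // lt; case: h4.
  exact: Z.divide_trans (pw_dvd _ lt) h1.
move=> a b; have := h _ _ a b; have := h _ _ b a; lia.
Qed.
Lemma val_ex r u : u <> 0%Z -> exists k, val r u k.
Proof.
move e : (Z.abs_nat u) => n; move: n u e.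
apply: (well_founded_induction Nat.lt_wf_0) => n IH u e nz.
case: (dec (syl r | u)%Z) => [[w ew]|nd].
  have [||k hk] := IH (Z.abs_nat w) _ w eq_refl.
  - have := syl_ge2 r; nia.
  - by nia.
  exists (S k); rewrite ew Z.mul_comm; exact/val_inc.
exists 0; split; first exact: Z.divide_1_l.
by rewrite /= Z.mul_1_r.
Qed.
Lemma val0 r u : val r u 0 -> ~ (syl r | u)%Z.
Proof. by case=> _; rewrite /= Z.mul_1_r. Qed.

Section Sim.
Variable R : nat.
(* The register r is the valuation of u at syl r. *)
Definition Rel (u : Z) (s : store) := u <> 0%Z /\ (forall r, r < R -> val r u (s r)) /\ (forall r, R <= r -> s r = 0).
(** Start values range over all integers, so a run may begin with arbitrary register contents. Only
    0 represents no store, since it has no valuations. *)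
Lemma Rel_ex u : u <> 0%Z -> exists s, Rel u s.
Proof.
move=> nz; exists (fun r => if r <? R then epsilon (inhabits 0) (val r u) else 0); split=> //; split.
- move=> r h; rewrite (proj2 (Nat.ltb_lt _ _) h); apply: epsilon_spec; exact: val_ex.
- by move=> r h; case: (Nat.ltb_spec r R) => //; lia.
Qed.
Lemma Rel_inc u s r : r < R -> Rel u s -> Rel (syl r * u) (upd s r (S (s r))).
Proof.
move=> hr [nz [h1 h2]]; split; first by have := syl_ge2 r; nia.
split=> x hx.
- case: (Nat.eq_dec x r) => [->|ne]; first by rewrite upd_same; apply/val_inc; exact: h1.
  by rewrite upd_other //; apply/val_other; [lia|exact: h1].
- by rewrite upd_other; [lia|exact: h2].
Qed.
Lemma Rel_dec u s r v : r < R -> s r = S v -> Rel u s -> exists w, u = (syl r * w)%Z /\ Rel w (upd s r v).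
Proof.
move=> hr e [nz [h1 h2]].
have [w ew] : (syl r | u)%Z.
  have [d _] := h1 r hr; apply: Z.divide_trans d; rewrite e /=; exact: Z.divide_factor_l.
have eu : u = (syl r * w)%Z by rewrite ew Z.mul_comm.
exists w; split=> //; split; first by nia.
split=> x hx.
- have := h1 x hx; rewrite eu; case: (Nat.eq_dec x r) => [->|ne].
    by rewrite upd_same e => /val_inc.
  by rewrite upd_other // => /val_other; apply; lia.
- by rewrite upd_other; [lia|exact: h2].
Qed.

Record urule := UR { uq : nat; um : Z; us : Z; uq' : nat; um' : Z; us' : Z }.
Definition cfg := (nat * Z)%type.
Definition ustep (prog : list urule) (c c' : cfg) := exists r w, In r prog /\
  fst c = uq r /\ snd c = (um r * w + us r)%Z /\ fst c' = uq' r /\ snd c' = (um' r * w + us' r)%Z.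
Fixpoint reach prog (k : nat) (c c' : cfg) : Prop :=
  match k with O => c = c' | S k => exists c1, ustep prog c c1 /\ reach prog k c1 c' end.
Lemma reach_trans prog k l c c' c'' : reach prog k c c' -> reach prog l c' c'' -> reach prog (k + l) c c''.
Proof.
elim: k c => [|k IH] c /=; first by move=> ->.
by move=> [c1 [h1 h2]] h3; exists c1; split=> //; exact: IH.
Qed.

Fixpoint csize (c : cmd) : nat :=
  match c with Skip => 0 | Inc _ => 1 | Seq c d => csize c + csize d | Loop _ c => csize c + 2 end.
(** An affine rule can express one residue class but not non-divisibility. Residue 0 means a
    positive register, and the value is divided by [b]; each other residue has its own rule, which
    leaves the value unchanged and exits. *)
Definition test_rules (b : Z) (pc pc1 pc2 : nat) : list urule :=
  UR pc b 0 pc1 1 0 :: map (fun t => UR pc b (Z.of_nat t) pc2 b (Z.of_nat t)) (seq 1 (Z.to_nat b - 1)).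
Arguments test_rules : simpl never.
Fixpoint comp (c : cmd) (pc : nat) : list urule :=
  match c with
  | Skip => []
  | Inc r => [UR pc 1 0 (pc + 1) (syl r) 0]
  | Seq c d => comp c pc ++ comp d (pc + csize c)
  | Loop r c => (test_rules (syl r) pc (pc + 1) (pc + csize c + 2) ++ comp c (pc + 1))
                 ++ [UR (pc + 1 + csize c) 1 0 pc 1 0]
  end.
Fixpoint regs_lt (c : cmd) : Prop :=
  match c with Skip => True | Inc r => r < R | Seq c d => regs_lt c /\ regs_lt d | Loop r c => r < R /\ regs_lt c end.

Lemma step_in prog r w c c' : In r prog -> c = (uq r, (um r * w + us r)%Z) -> c' = (uq' r, (um' r * w + us' r)%Z) -> ustep prog c c'.
Proof. by move=> h -> ->; exists r, w. Qed.
Lemma test_ok b pc pc1 pc2 : In (UR pc b 0 pc1 1 0) (test_rules b pc pc1 pc2).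
Proof. by left. Qed.
Lemma test_fail b pc pc1 pc2 t : (0 < t < b)%Z -> In (UR pc b t pc2 b t) (test_rules b pc pc1 pc2).
Proof.
move=> h; right; apply/in_map_iff; exists (Z.to_nat t).
rewrite Z2Nat.id; first by lia.
split=> //; apply/in_seq; lia.
Qed.
Lemma loop_test r c pc : incl (test_rules (syl r) pc (pc + 1) (pc + csize c + 2)) (comp (Loop r c) pc).
Proof. by do 2 apply: incl_appl; exact: incl_refl. Qed.
Lemma loop_body r c pc : incl (comp c (pc + 1)) (comp (Loop r c) pc).
Proof. by apply: incl_appl; apply: incl_appr; exact: incl_refl. Qed.
Lemma loop_back r c pc : In (UR (pc + 1 + csize c) 1 0 pc 1 0) (comp (Loop r c) pc).
Proof. by apply: in_or_app; right; left. Qed.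

Lemma sim c s s' : exec c s s' -> regs_lt c -> forall prog pc u, incl (comp c pc) prog -> Rel u s ->
  exists k u', reach prog k (pc, u) (pc + csize c, u') /\ Rel u' s'.
Proof.
elim=> {c s s'} [s|r s|c d s s1 s2 _ IH1 _ IH2|r c s e|r c s v s1 s2 e _ IH1 _ IH2] hr prog pc u inc rel.
- by exists 0, u; rewrite Nat.add_0_r.
- exists 1, (syl r * u)%Z; split; last exact: Rel_inc.
  exists (pc + 1, (syl r * u)%Z); split; last by [].
  apply: (@step_in _ (UR pc 1 0 (pc + 1) (syl r) 0) u); first by apply: inc; left.
  - by rewrite /= Z.mul_1_l Z.add_0_r.
  - by rewrite /= Z.add_0_r.
- have [hr1 hr2] := hr.
  have [load_state [u1 [h1 rel1]]] := IH1 hr1 prog pc u (fun x hx => inc x (in_or_app _ _ _ (or_introl hx))) rel.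
  have [k2 [u2 [h2 rel2]]] := IH2 hr2 prog _ u1 (fun x hx => inc x (in_or_app _ _ _ (or_intror hx))) rel1.
  exists (load_state + k2), u2; split=> //; apply: reach_trans h1 _; by rewrite /= Nat.add_assoc.
- have [hr1 _] := hr; have [nz [h1 _]] := rel.
  have := h1 r hr1; rewrite e => /val0 nd.
  have g2 := syl_ge2 r.
  have hm := Z.mod_pos_bound u (syl r); have dm := Z.div_mod u (syl r).
  have hm0 : (u mod syl r <> 0)%Z by move=> h; apply: nd; apply/Z.mod_divide => //; lia.
  exists 1, u; split=> //; exists (pc + csize (Loop r c), u); split; last by [].
  apply: (@step_in _ (UR pc (syl r) (u mod syl r) (pc + csize c + 2) (syl r) (u mod syl r)) (u / syl r)).
  + by apply: inc; apply: loop_test; apply: test_fail; lia.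
  + by rewrite /=; congr (_, _); lia.
  + by rewrite /=; congr (_, _); lia.
- have [hr1 hr2] := hr; have [w [eu relw]] := Rel_dec hr1 e rel.
  have inc1 : incl (comp c (pc + 1)) prog by apply: incl_tran inc; exact: loop_body.
  have [load_state [u1 [h1 rel1]]] := IH1 hr2 prog (pc + 1) w inc1 relw.
  have [k2 [u2 [h2 rel2]]] := IH2 hr prog pc u1 inc rel1.
  exists (S (load_state + S k2)), u2; split=> //.
  exists (pc + 1, w); split.
    apply: (@step_in _ (UR pc (syl r) 0 (pc + 1) 1 0) w); first by apply: inc; apply: loop_test; exact: test_ok.
    + by rewrite eu /=; congr (_, _); lia.
    + by rewrite /=; congr (_, _); lia.
  apply: reach_trans h1 _; exists (pc, u1); split=> //.
  apply: (@step_in _ (UR (pc + 1 + csize c) 1 0 pc 1 0) u1); first by apply: inc; exact: loop_back.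
  + by rewrite /=; congr (_, _); lia.
  + by rewrite /=; congr (_, _); lia.
Qed.

(** A value 0 forces w = 0 and [us r = 0] by the range of [us r]; the last clause then makes the new
    value 0 too. A run from value 0 thus never becomes a genuine computation. *)
Definition grule (r : urule) := (0 < um r /\ 0 < um' r /\ 0 <= us r < um r /\ 0 <= us' r /\ (us r = 0 -> us' r = 0))%Z.
(** Needed because the equivalence also runs steps backwards: a configuration with two successors
    could link a non-halting run to a halting one. *)
Definition det (l : list urule) := forall r1 r2, In r1 l -> In r2 l -> uq r1 = uq r2 -> forall w1 w2,
  (um r1 * w1 + us r1 = um r2 * w2 + us r2 -> uq' r1 = uq' r2 /\ um' r1 * w1 + us' r1 = um' r2 * w2 + us' r2)%Z.
Lemma det_app l l' : det l -> det l' -> (forall r r', In r l -> In r' l' -> uq r <> uq r') -> det (l ++ l').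
Proof.
move=> d d' ne r1 r2 /in_app_iff [h1|h1] /in_app_iff [h2|h2] e; [exact: d|by case: (ne _ _ h1 h2)|by case: (ne _ _ h2 h1)|exact: d'].
Qed.
Lemma det1 r : (0 < um r)%Z -> det [r].
Proof.
move=> h r1 r2 [<-|[]] [<-|[]] _ w1 w2 e; split=> //.
have -> : w1 = w2 by nia.
by [].
Qed.
Lemma in_loop r x c pc : In r (comp (Loop x c) pc) ->
  In r (test_rules (syl x) pc (pc + 1) (pc + csize c + 2)) \/ In r (comp c (pc + 1)) \/ r = UR (pc + 1 + csize c) 1 0 pc 1 0.
Proof.
move=> h; have [h1|h1] := in_app_or _ _ _ h; last by case: h1 => [<-|[]]; right; right.
by have [h2|h2] := in_app_or _ _ _ h1; [left|right; left].
Qed.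
Lemma test_in b pc pc1 pc2 r : In r (test_rules b pc pc1 pc2) ->
  r = UR pc b 0 pc1 1 0 \/ exists t, (0 < t < b)%Z /\ r = UR pc b t pc2 b t.
Proof.
case=> [<-|]; first by left.
by move=> /in_map_iff [t [<- /in_seq ht]]; right; exists (Z.of_nat t); split=> //; lia.
Qed.
Lemma test_uq b pc pc1 pc2 r : In r (test_rules b pc pc1 pc2) -> uq r = pc.
Proof. by case=> [<-|] // /in_map_iff [t [<- _]]. Qed.
Lemma test_det b pc pc1 pc2 : (2 <= b)%Z -> det (test_rules b pc pc1 pc2).
Proof.
move=> hb.
have h : forall r, In r (test_rules b pc pc1 pc2) -> um r = b /\ ((us r = 0 /\ uq' r = pc1 /\ um' r = 1 /\ us' r = 0) \/ (0 < us r < b /\ uq' r = pc2 /\ um' r = b /\ us' r = us r))%Z.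
  move=> r /test_in [->|[t [ht ->]]] /=; split=> //; [by left|by right].
move=> r1 r2 /h [e1 h1] /h [e2 h2] _ w1 w2; rewrite e1 e2 => e.
have [ew es] : w1 = w2 /\ us r1 = us r2.
  have b1 : (0 <= us r1 < b)%Z by case: h1; lia.
  have b2 : (0 <= us r2 < b)%Z by case: h2; lia.
  have ew : w1 = w2 by nia.
  split=> //; subst; lia.
subst w2; case: h1 => [[a1 [-> [-> ->]]]|[a1 [-> [-> ->]]]]; case: h2 => [[a2 [-> [-> ->]]]|[a2 [-> [-> ->]]]]; split=> //; lia.
Qed.
Lemma comp_uq c pc r : In r (comp c pc) -> pc <= uq r < pc + csize c /\ uq' r <= pc + csize c.
Proof.
elim: c pc => [|x|c IHc d IHd|x c IHc] pc; first by [].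
- by move=> [<-|[]] /=; lia.
- by move=> /in_app_iff [/IHc|/IHd] /=; lia.
- case/in_loop => [/test_in h|[/IHc /= h|->]] /=; try lia.
  by case: h => [->|[t [_ ->]]] /=; lia.
Qed.
Lemma comp_grule c pc r : In r (comp c pc) -> grule r.
Proof.
elim: c pc => [|x|c IHc d IHd|x c IHc] pc; first by [].
- by move=> [<-|[]]; rewrite /grule /=; have := syl_ge2 x; lia.
- by move=> /in_app_iff [/IHc|/IHd].
- have g := syl_ge2 x.
  case/in_loop => [/test_in h|[/IHc //|->]]; last by rewrite /grule /=; lia.
  by case: h => [->|[t [ht ->]]]; rewrite /grule /=; lia.
Qed.
Lemma comp_det c pc : det (comp c pc).
Proof.
elim: c pc => [|x|c IHc d IHd|x c IHc] pc; first by move=> r1 r2 [].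
- by apply: det1.
- apply: det_app => // r r' /comp_uq h /comp_uq h'; lia.
- apply: det_app; last first.
  + move=> r r' /in_app_iff h [<-|[]] /=; case: h => [/test_uq ->|/comp_uq]; lia.
  + exact: det1.
  + apply: det_app => //; first by apply: test_det; exact: syl_ge2.
    by move=> r r' /test_uq -> /comp_uq; lia.
Qed.
Lemma det_step prog c c1 c2 : det prog -> ustep prog c c1 -> ustep prog c c2 -> c1 = c2.
Proof.
move=> d [r1 [w1 [h1 [e1 [e2 [e3 e4]]]]]] [r2 [w2 [h1' [e1' [e2' [e3' e4']]]]]].
have [a b] := d r1 r2 h1 h1' (eq_trans (eq_sym e1) e1') w1 w2 (eq_trans (eq_sym e2) e2').
case: c1 c2 e3 e4 e3' e4' => a1 b1 [a2 b2] /= -> -> -> ->.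
by rewrite a b.
Qed.
End Sim.

Lemma reach1 prog c c' : ustep prog c c' -> reach prog 1 c c'.
Proof. by move=> h; exists c'. Qed.
(** The step count is visibly positive, so that the first step of a pass can be compared with any
    given step by determinism. *)
Lemma loop_once R r c s v s1 prog pc u : exec c (upd s r v) s1 -> s r = S v -> r < R -> regs_lt R c ->
  incl (comp (Loop r c) pc) prog -> Rel R u s -> exists k u', reach prog (S k) (pc, u) (pc, u') /\ Rel R u' s1.
Proof.
move=> ex e hr hc inc rel; have [w [eu relw]] := Rel_dec hr e rel.
have inc1 : incl (comp c (pc + 1)) prog by apply: incl_tran inc; exact: loop_body.
have [load_state [u1 [h1 rel1]]] := sim ex hc inc1 relw.
exists (load_state + 1), u1; split=> //; exists (pc + 1, w); split.
  apply: (@step_in _ (UR pc (syl r) 0 (pc + 1) 1 0) w); first by apply: inc; apply: loop_test; exact: test_ok.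
  + by rewrite eu /=; congr (_, _); lia.
  + by rewrite /=; congr (_, _); lia.
apply: reach_trans h1 _; apply: reach1.
apply: (@step_in _ (UR (pc + 1 + csize c) 1 0 pc 1 0) u1); first by apply: inc; exact: loop_back.
+ by rewrite /=; congr (_, _); lia.
+ by rewrite /=; congr (_, _); lia.
Qed.

Lemma regs_bound c : exists R0, forall R, R0 <= R -> regs_lt R c.
Proof.
elim: c => [|r|c [R1 h1] d [R2 h2]|r c [R1 h1]].
- by exists 0.
- exists (S r) => R h /=; lia.
- exists (R1 + R2) => R h; split; [apply: h1; lia|apply: h2; lia].
- exists (S r + R1) => R h; split; [lia|apply: h1; lia].
Qed.
Lemma regs_clears R l : (forall r, In r l -> r < R) -> regs_lt R (seqs (map (fun r => Loop r Skip) l)).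
Proof.
elim: l => [|r l IH] h //=; split; first by split=> //; apply: h; left.
by apply: IH => x hx; apply: h; right.
Qed.
Lemma Rel_pow R n u s : 1 < R -> Rel R u s -> Rel R (pw (syl 1) n * u) (upd s 1 (s 1 + n)).
Proof.
move=> hR rel; elim: n => [|n IH].
  by rewrite Nat.add_0_r upd_id /= Z.mul_1_l.
have := Rel_inc hR IH; rewrite upd_same upd_upd Nat.add_succ_r.
by rewrite /= Z.mul_assoc.
Qed.

Arguments comp : simpl never.
Arguments syl : simpl never.

(** * The rule system that searches for a zero of F n x *)

Section Search.
Variables (c : rf) (F : nat -> nat -> nat -> nat).
Hypothesis hF : forall n x y, reval c [n; x; y] (F n x y).

Definition regs4 (x n y t : nat) : store := fun r => match r with 0 => x | 1 => n | 2 => y | 3 => t | _ => 0 end.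
Definition search_call : cmd := cg c [1; 0; 2] 3 4.
Definition search_body : cmd := Seq (Loop 3 Skip) (Seq (Inc 2) search_call).
Definition search : cmd := Seq search_call (Loop 3 search_body).
Lemma exec_call x n y : exec search_call (regs4 x n y 0) (regs4 x n y (F n x y)).
Proof.
have -> : regs4 x n y (F n x y) = upd (regs4 x n y 0) 3 (F n x y).
  by apply: functional_extensionality => -[|[|[|[|r]]]].
apply: (cg_correct (hF n x y)); split=> //.
split; first by move=> a /= [<-|[<-|[<-|[]]]]; lia.
split; first by lia.
split=> //; split; last by move=> /= [|[|[|[]]]].
by move=> [|[|[|[|r]]]] //=; lia.
Qed.
Lemma exec_body x n y t : exec search_body (regs4 x n y t) (regs4 x n (S y) (F n x (S y))).
Proof.
apply: ex_seq; first exact: exec_clear.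
have -> : upd (regs4 x n y t) 3 0 = regs4 x n y 0 by apply: functional_extensionality => -[|[|[|[|r]]]].
apply: (@ex_seq _ _ _ (regs4 x n (S y) 0)); last exact: exec_call.
have -> : regs4 x n (S y) 0 = upd (regs4 x n y 0) 2 (S (regs4 x n y 0 2)); last exact: ex_inc.
by apply: functional_extensionality => -[|[|[|[|r]]]].
Qed.
Lemma exec_loop x n y0 d y : F n x y0 = 0 -> y + d = y0 ->
  exists s, exec (Loop 3 search_body) (regs4 x n y (F n x y)) s.
Proof.
move=> h; elim: d y => [|d IH] y e.
  by exists (regs4 x n y (F n x y)); apply: ex_loop0 => /=; rewrite -h; congr F; lia.
case ef : (F n x y) => [|t]; first by exists (regs4 x n y 0); apply: ex_loop0.
have [|s halt_state] := IH (S y); first by lia.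
exists s; apply: (@ex_loopS _ _ _ t _ _ _ _ halt_state) => //.
have -> : upd (regs4 x n y (S t)) 3 t = regs4 x n y t by apply: functional_extensionality => -[|[|[|[|r]]]].
exact: exec_body.
Qed.

Variable R : nat.
Hypothesis R4 : 4 <= R.
Hypothesis regs : regs_lt R search.
(** The start value is an arbitrary nonzero integer. Emptying all registers but register 0, which
    holds x, makes the run depend on its 2-adic valuation alone. *)
Definition clear_cmd : cmd := seqs (map (fun r => Loop r Skip) (seq 1 (R - 1))).
Definition load_state := csize clear_cmd.
Definition halt_state := load_state + 1 + csize search.
(** After halting, the value still carries the registers and a factor that no register sees. Halving
    with rounding down sends every integer to 0 or -1, so finitely many targets suffice. *)
Definition halve_rules : list urule := [UR halt_state 2 0 halt_state 1 0; UR halt_state 2 1 halt_state 1 0].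
Definition fixed_rules : list urule := comp clear_cmd 0 ++ comp search (load_state + 1) ++ halve_rules.
(** Multiplication by 3^n sets the emptied register 1 to n. It is the only rule that depends on
    [n]. *)
Definition load_rule (n : nat) : urule := UR load_state 1 0 (load_state + 1) (pw (syl 1) n) 0.
Definition prog (n : nat) : list urule := load_rule n :: fixed_rules.
(** One residue class for each of the states 0, ..., [halt_state]; state 0 is the start, so the
    multiples of [modulus] encode the start configurations. *)
Definition modulus : Z := Z.of_nat (halt_state + 1).
Lemma load_lt_halt : load_state < halt_state.
Proof. rewrite /halt_state; lia. Qed.
Lemma halve_rules_in r : In r halve_rules -> uq r = halt_state /\ uq' r = halt_state /\ grule r.
Proof. by move=> [<-|[<-|[]]]; rewrite /grule /=; lia. Qed.
Lemma fixed_rules_in r : In r fixed_rules -> (uq r < halt_state /\ uq r <> load_state \/ In r halve_rules) /\ uq' r <= halt_state /\ grule r.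
Proof.
rewrite /fixed_rules; move=> /in_app_iff [h|/in_app_iff [h|h]].
- have := comp_uq h; have := comp_grule h; have := load_lt_halt; rewrite -/load_state /= => a b [d e]; split; first by left; lia.
  split=> //; lia.
- have := comp_uq h; have := comp_grule h; rewrite -/halt_state => b [d e]; split; first by left; lia.
  by [].
- have [e1 [e2 e3]] := halve_rules_in h; split; first by right.
  split=> //; lia.
Qed.
Lemma program_in n r : In r (prog n) -> uq r <= halt_state /\ uq' r <= halt_state /\ grule r.
Proof.
case=> [<-|/fixed_rules_in [[[h _]|/halve_rules_in [h [_ _]]] [h' g]]].
- have := load_lt_halt; rewrite /grule /= /halt_state; have := @pw_pos (syl 1) n; have := syl_ge2 1; lia.
- by split=> //; lia.
- by split=> //; lia.
Qed.
Lemma prog_det n : det (prog n).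
Proof.
rewrite /prog -[_ :: fixed_rules]/([load_rule n] ++ fixed_rules); apply: det_app; first exact: det1.
- apply: det_app; first exact: comp_det.
  + apply: det_app; first exact: comp_det.
    * move=> r1 r2 [<-|[<-|[]]] [<-|[<-|[]]] /= _ w1 w2; lia.
    * by move=> r r' /comp_uq; rewrite -/halt_state => h /halve_rules_in [e _]; lia.
  + move=> r r' /comp_uq; rewrite -/load_state /= => h h' e; have lt := load_lt_halt.
    case: (in_app_or _ _ _ h') => [h2|h2]; [have := comp_uq h2|have := halve_rules_in h2]; lia.
- move=> r r' [<-|[]] /fixed_rules_in [h _] /=; case: h => [[_ h]|/halve_rules_in [e _]]; first by lia.
  by have := load_lt_halt; lia.
Qed.
Lemma incl_clear n : incl (comp clear_cmd 0) (prog n).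
Proof. by move=> r h; right; apply/in_app_iff; left. Qed.
Lemma incl_search n : incl (comp search (load_state + 1)) (prog n).
Proof. by move=> r h; right; apply/in_app_iff; right; apply/in_app_iff; left. Qed.
Lemma incl_halve n : incl halve_rules (prog n).
Proof. by move=> r h; right; apply/in_app_iff; right; apply/in_app_iff; right. Qed.

Lemma start_run n u s : Rel R u s -> exists k u', reach (prog n) k (0, u) (load_state + 1, u') /\ Rel R u' (regs4 (s 0) n 0 0).
Proof.
move=> rel.
have hc : regs_lt R clear_cmd by apply: regs_clears => r /in_seq; lia.
have [k [u1 [h1 rel1]]] := sim (exec_clears s 1 (R - 1)) hc (@incl_clear n) rel.
exists (k + 1), (pw (syl 1) n * u1)%Z; split.
  apply: reach_trans h1 _; apply: reach1.
  apply: (@step_in _ (load_rule n) u1); first by left.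
  - by rewrite /= -/load_state; congr (_, _); lia.
  - by rewrite /=; congr (_, _); lia.
have hR : 1 < R by lia.
have := Rel_pow n hR rel1; set s1 := upd _ _ _.
suff -> : s1 = regs4 (s 0) n 0 0 by [].
apply: functional_extensionality => r; rewrite /s1 /upd; have [_ [_ z]] := rel.
case: r => [|[|[|[|r]]]] /=.
- by case: (Nat.leb_spec 1 0) => //; lia.
- by case: (Nat.ltb_spec 1 (1 + (R - 1))) => //=; lia.
- by case: (Nat.ltb_spec 2 (1 + (R - 1))) => //=; lia.
- by case: (Nat.ltb_spec 3 (1 + (R - 1))) => //=; lia.
- by case: (Nat.ltb_spec _ (1 + (R - 1))) => //= h; apply: z; lia.
Qed.
Lemma halve_run n u : exists k v, (v = 0 \/ v = -1)%Z /\ reach (prog n) k (halt_state, u) (halt_state, v).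
Proof.
move e : (Z.abs_nat u) => N; move: N u e.
apply: (well_founded_induction Nat.lt_wf_0) => N IH u e.
case: (Z.eq_dec u 0) => [->|n0]; first by exists 0, 0%Z; split=> //; left.
case: (Z.eq_dec u (-1)) => [->|n1]; first by exists 0, (-1)%Z; split=> //; right.
have st : ustep (prog n) (halt_state, u) (halt_state, (u / 2)%Z).
  have d := Z.div_mod u 2; have m := Z.mod_pos_bound u 2.
  case: (Z.eq_dec (u mod 2) 0) => em.
    apply: (@step_in _ (UR halt_state 2 0 halt_state 1 0) (u / 2)); first by apply: incl_halve; left.
    + by rewrite /=; congr (_, _); lia.
    + by rewrite /=; congr (_, _); lia.
  apply: (@step_in _ (UR halt_state 2 1 halt_state 1 0) (u / 2)); first by apply: incl_halve; right; left.
  + by rewrite /=; congr (_, _); lia.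
  + by rewrite /=; congr (_, _); lia.
have [|k [v [hv h]]] := IH (Z.abs_nat (u / 2)) _ (u / 2)%Z eq_refl.
  have d := Z.div_mod u 2; have m := Z.mod_pos_bound u 2; lia.
by exists (S k), v; split=> //; exists (halt_state, (u / 2)%Z).
Qed.

Definition encode (x : cfg) : Z := (snd x * modulus + Z.of_nat (fst x))%Z.
Definition rule_of (r : urule) : rule :=
  (um r * modulus, us r * modulus + Z.of_nat (uq r), um' r * modulus, us' r * modulus + Z.of_nat (uq' r))%Z.
Definition machine_rules (n k : nat) : rule := nth k (map rule_of (prog n)) (1, 0, 1, 0)%Z.
(** The third target is the start configuration with value 0. It represents no store and performs no
    search, and so it is declared halting. *)
Definition halt_codes : list Z := [encode (halt_state, 0%Z); encode (halt_state, (-1)%Z); encode (0, 0%Z)].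
Lemma modulus_pos : (0 < modulus)%Z.
Proof. rewrite /modulus; lia. Qed.
Lemma encode_inj x y : fst x <= halt_state -> fst y <= halt_state -> encode x = encode y -> x = y.
Proof.
case: x y => q u [q' u'] /= h h'; rewrite /encode /modulus /= => e.
have eu : u = u' by nia.
subst; congr (_, _); lia.
Qed.
Lemma step_eqv n x y : ustep (prog n) x y -> eqv_of (machine_rules n) (encode x) (encode y).
Proof.
move=> [r [w [h [e1 [e2 [e3 e4]]]]]]; apply: rst_step.
have [k [hk ek]] := In_nth _ _ (1, 0, 1, 0)%Z (in_map rule_of _ _ h).
exists k; rewrite /machine_rules ek; exists w; rewrite /encode e1 e2 e3 e4; lia.
Qed.
Lemma reach_eqv n k x y : reach (prog n) k x y -> eqv_of (machine_rules n) (encode x) (encode y).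
Proof.
elim: k x => [|k IH] x /=; first by move=> ->; exact: rst_refl.
move=> [x1 [h1 h2]]; apply: rst_trans (IH _ h2); exact: step_eqv.
Qed.
(** The first alternative comes from indices beyond the program: the default (1, 0, 1, 0) relates
    every integer to itself only. *)
Lemma rule_step n k i i' : rule_rel (machine_rules n k) i i' -> i = i' \/ exists x x',
  fst x <= halt_state /\ fst x' <= halt_state /\ i = encode x /\ i' = encode x' /\ ustep (prog n) x x'.
Proof.
rewrite /machine_rules; case: (Nat.lt_ge_cases k (length (map rule_of (prog n)))) => hk; last first.
  by rewrite nth_overflow // => -[u [-> ->]]; left; lia.
have := nth_In _ (1, 0, 1, 0)%Z hk => /in_map_iff [r [<- hr]] [w [-> ->]].
have [h1 [h2 _]] := program_in hr.
right; exists (uq r, (um r * w + us r)%Z), (uq' r, (um' r * w + us' r)%Z).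
do 2 split=> //; split; first by rewrite /encode /=; lia.
split; first by rewrite /encode /=; lia.
by exists r, w.
Qed.
Lemma machine_rules_wf n k : wf_rule (machine_rules n k).
Proof.
rewrite /machine_rules; case: (Nat.lt_ge_cases k (length (map rule_of (prog n)))) => hk; last by rewrite nth_overflow.
have := nth_In _ (1, 0, 1, 0)%Z hk => /in_map_iff [r [<- hr]].
have [_ [_ [g1 [g2 _]]]] := program_in hr; have := modulus_pos; rewrite /wf_rule /=; nia.
Qed.

Lemma halting n : (forall x, exists y, F n x y = 0) -> forall x : Z, halts_of (machine_rules n) halt_codes (modulus * x + 0).
Proof.
move=> h x; have -> : (modulus * x + 0 = encode (0%nat, x))%Z by rewrite /encode /=; lia.
case: (Z.eq_dec x 0) => [->|nz].
  by exists (encode (0, 0%Z)); split; [right; right; left|exact: rst_refl].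
have [s rel] := Rel_ex R nz.
have [k1' [u1 [h1 rel1]]] := start_run n rel.
have [y0 hy] := h (s 0).
have [s2 h2] := @exec_loop (s 0) n y0 y0 0 hy eq_refl.
have [k2 [u2 [h3 _]]] := sim (ex_seq (exec_call (s 0) n 0) h2) regs (@incl_search n) rel1.
have [k3 [v [hv h4]]] := halve_run n u2.
exists (encode (halt_state, v)); split; first by case: hv => ->; [left|right; left].
exact: reach_eqv (reach_trans h1 (reach_trans h3 h4)).
Qed.

(** * Inputs on which the search never ends *)

Section NonHalting.
Variables (n x0 : nat).
Hypothesis never : forall y, F n x0 y <> 0.
Definition loop_state := load_state + 1 + csize search_call.
Lemma loop_lt_halt : loop_state < halt_state.
Proof. rewrite /loop_state /halt_state /search /=; lia. Qed.
Lemma incl_call : incl (comp search_call (load_state + 1)) (prog n).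
Proof. by apply: incl_tran (@incl_search n); apply: incl_appl; exact: incl_refl. Qed.
Lemma incl_loop : incl (comp (Loop 3 search_body) loop_state) (prog n).
Proof. by apply: incl_tran (@incl_search n); apply: incl_appr; exact: incl_refl. Qed.
Lemma regs_search_call : regs_lt R search_call.
Proof. by case: regs. Qed.
Lemma regs_search_body : regs_lt R search_body.
Proof. by case: regs => _ []. Qed.
(* The configurations from which the machine visits the head of the main loop. *)
Definition loops (x : cfg) := exists k u y, reach (prog n) k x (loop_state, u) /\ Rel R u (regs4 x0 n y (F n x0 y)).
Lemma loops_back x x' : ustep (prog n) x x' -> loops x' -> loops x.
Proof. by move=> h [k [u [y [h1 h2]]]]; exists (S k), u, y; split=> //; exists x'. Qed.
(** Away from the loop head, determinism identifies the step with the first step of the known run.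
    At the head, [F] is nonzero, so a full pass follows and reaches the head again with the next y;
    the step is the first of that pass. *)
Lemma loops_forth x x' : ustep (prog n) x x' -> loops x -> loops x'.
Proof.
move=> h [k [u [y [h1 rel]]]]; case: k h1 => [|k] h1; last first.
  case: h1 => x1 [h2 h3]; have e := det_step (@prog_det n) h h2.
  by exists k, u, y; rewrite e.
rewrite /= in h1; subst x; case ef : (F n x0 y) => [|v]; first by case: (never ef).
have hb : exec search_body (upd (regs4 x0 n y (F n x0 y)) 3 v) (regs4 x0 n (S y) (F n x0 (S y))).
  have -> : upd (regs4 x0 n y (F n x0 y)) 3 v = regs4 x0 n y v by apply: functional_extensionality => -[|[|[|[|r]]]].
  exact: exec_body.
have R3 : 3 < R by lia.
have [k [u' [[x1 [h2 h3]] rel']]] := loop_once hb ef R3 regs_search_body incl_loop rel.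
by have e := det_step (@prog_det n) h h2; exists k, u', (S y); rewrite e.
Qed.
Lemma halt_state_stuck k u x : reach (prog n) k (halt_state, u) x -> fst x = halt_state.
Proof.
elim: k u => [|k IH] u /=; first by move=> <-.
move=> [[q v] [[r [w [hr [/= e1 [_ [e2 _]]]]]] h]].
have e : uq' r = halt_state.
  case: hr => [e|/fixed_rules_in [[[lt _]|/halve_rules_in [_ [-> _]]] _]] //; last by lia.
  by move: e1; rewrite -e /=; have := load_lt_halt; lia.
by move: h; rewrite e2 e; exact: IH.
Qed.
Lemma zero_stuck k q x : reach (prog n) k (q, 0%Z) x -> snd x = 0%Z.
Proof.
elim: k q => [|k IH] q /=; first by move=> <-.
move=> [[q' v] [[r [w [hr [/= e1 [e2 [e3 e4]]]]]] h]].
have [_ [_ [g1 [g2 [g3 [g4 g5]]]]]] := program_in hr.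
have w0 : w = 0%Z by nia.
have u0 : us r = 0%Z by nia.
move: h; rewrite e4 w0 (g5 u0) Z.mul_0_r; exact: IH.
Qed.
(** The value 2^x0 puts x0 into register 0, the base of that register being 2. Visiting the loop
    head is invariant under equivalence, holds from this start and fails for all three targets. *)
Lemma not_halting : ~ halts_of (machine_rules n) halt_codes (modulus * pw (syl 0) x0 + 0).
Proof.
pose Pz i := exists x, fst x <= halt_state /\ i = encode x /\ loops x.
have inv : forall i i', eqv_of (machine_rules n) i i' -> (Pz i <-> Pz i').
  move=> i i'; elim=> {i i'} [i i' [k hk]|i|i i' _ h|i i' i'' _ h _ h']; [|by []|by symmetry|by rewrite h].
  have [->|[x [x' [h1 [h2 [e1 [e2 st]]]]]]] := rule_step hk; first by [].
  split=> [] [z [hz [ez lz]]].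
  - exists x'; split=> //; split=> //; apply: loops_forth st _.
    by have -> : x = z by apply: encode_inj => //; rewrite -e1.
  - exists x; split=> //; split=> //; apply: loops_back st _.
    by have -> : x' = z by apply: encode_inj => //; rewrite -e2.
have nz : pw (syl 0) x0 <> 0%Z by have := @pw_pos (syl 0) x0; have := syl_ge2 0; lia.
have start : Pz (modulus * pw (syl 0) x0 + 0)%Z.
  exists (0, pw (syl 0) x0); split=> /=; first by lia.
  split; first by rewrite /encode /=; lia.
  have [s rel] := Rel_ex R nz.
  have s0 : s 0 = x0.
    have [_ [hv _]] := rel; have R0 : 0 < R by lia.
    apply: val_uniq (hv 0 R0) _; split; first exact: Z.divide_refl.
    move=> [w e]; rewrite /= in e; have g := syl_ge2 0.
    have p0 : (0 < pw (syl 0) x0)%Z by apply: pw_pos; lia.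
    have e1 : ((w * syl 0 - 1) * pw (syl 0) x0 = 0)%Z by rewrite Z.mul_sub_distr_r -Z.mul_assoc -e; lia.
    case/Z.mul_eq_0: e1 => e1; last by lia.
    by move: e1 g; clear; move: (syl 0) => z; case: (Z.le_gt_cases w 0) => ?; nia.
  have [k [u1 [h1 rel1]]] := start_run n rel.
  rewrite s0 in rel1.
  have [k2 [u2 [h2 rel2]]] := sim (exec_call x0 n 0) regs_search_call incl_call rel1.
  exists (k + k2), u2, 0; split=> //; exact: reach_trans h1 h2.
move=> [t [ht e]]; have [x [hx [ex [k [u [y [h rel]]]]]]] := proj1 (inv _ _ e) start.
have lt := loop_lt_halt.
have stuck : forall v, x <> (halt_state, v).
  by move=> v ee; rewrite ee in h; have := halt_state_stuck h; rewrite /=; lia.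
case: ht => [ht|[ht|[ht|[]]]]; rewrite -ht in ex.
- by apply: (stuck 0%Z); symmetry; apply: encode_inj.
- by apply: (stuck (-1)%Z); symmetry; apply: encode_inj.
(* From value 0 only value 0 is reached, whereas [Rel] excludes 0 at the loop head. *)
- have ee : (0, 0%Z) = x by apply: encode_inj => //; rewrite /=; lia.
  rewrite -ee in h; have := zero_stuck h; case: rel => nu _ e0; exact: nu.
Qed.
End NonHalting.
End Search.

(** For varying n the list keeps its shape, and only one coefficient of its head changes; this makes
    the final reduction computable. Integers x with equal 2-adic valuation represent the same input,
    and 2^x reaches every natural input x. *)
Theorem search_rules (c : rf) (F : nat -> nat -> nat -> nat) :
  (forall n x y, reval c [n; x; y] (F n x y)) ->
  exists (modulus : nat) (j j' : nat) (rest : list rule) (tg : list Z),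
    let rl n k := nth k ((Z.of_nat modulus, Z.of_nat j, pw 3 n * Z.of_nat modulus, Z.of_nat j') :: rest)%Z (1, 0, 1, 0)%Z in
    (forall n k, wf_rule (rl n k)) /\
    forall n, (forall x, exists y, F n x y = 0) <-> forall x, halts_of (rl n) tg (Z.of_nat modulus * x + 0)%Z.
Proof.
move=> hF; have [R0 hR] := regs_bound (search c).
pose R := R0 + 4.
have R4 : 4 <= R by rewrite /R; lia.
have regs : regs_lt R (search c) by apply: hR; rewrite /R; lia.
exists (halt_state c R + 1), (load_state R), (load_state R + 1), (map (rule_of c R) (fixed_rules c R)), (halt_codes c R).
have e : forall n k, nth k ((Z.of_nat (halt_state c R + 1), Z.of_nat (load_state R), pw 3 n * Z.of_nat (halt_state c R + 1), Z.of_nat (load_state R + 1)) :: map (rule_of c R) (fixed_rules c R))%Z (1, 0, 1, 0)%Z = machine_rules c R n k.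
  move=> n k; rewrite /machine_rules /prog /= -/(modulus c R).
  congr (nth k (_ :: _) _); rewrite /rule_of /= /modulus.
  by congr (_, _, _, _); lia.
move=> rl; split; first by move=> n k; rewrite /rl e; exact: machine_rules_wf.
move=> n; have -> : rl n = machine_rules c R n by apply: functional_extensionality => k; exact: e.
split; first exact: (halting hF R4 regs).
move=> h x; case: (dec (exists y, F n x y = 0)) => // ne.
case: (@not_halting c F hF R R4 regs n x _ (h _)).
by move=> y e0; apply: ne; exists y.
Qed.

(** * Computable functions *)

(* Computability of unary functions; several arguments are packed with cpair. *)
Lemma computable_ext f g : (forall x, f x = g x) -> computable f -> computable g.
Proof. by move=> e [c h]; exists c => x; rewrite -e. Qed.
Lemma computable_id : computable (fun x => x).
Proof. exists (RProj 0) => x; exact: (ev_proj 0 [x]). Qed.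
Lemma reval_comp1 c g v y z : reval g v y -> reval c [y] z -> reval (RComp c [g]) v z.
Proof. by move=> h1 h2; apply: ev_comp h2; constructor. Qed.
Lemma reval_comp2 c g g' v y y' z : reval g v y -> reval g' v y' -> reval c [y; y'] z -> reval (RComp c [g; g']) v z.
Proof. by move=> h1 h2 h3; apply: ev_comp h3; constructor => //; constructor. Qed.
Lemma computable_comp f g : computable f -> computable g -> computable (fun x => f (g x)).
Proof. move=> [c h] [d k]; exists (RComp c [d]) => x; exact: reval_comp1 (k x) (h _). Qed.
Lemma reval_succ g v y : reval g v y -> reval (RComp RSucc [g]) v (S y).
Proof. by move=> h; apply: reval_comp1 h _; exact: (ev_succ [y]). Qed.
Lemma computable_S f : computable f -> computable (fun x => S (f x)).
Proof. by move=> [c h]; exists (RComp RSucc [c]) => x; apply: reval_succ. Qed.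
Lemma computable_const n : computable (fun _ => n).
Proof. by elim: n => [|n]; [exists RZero => x; constructor|exact: computable_S]. Qed.
Definition prec (y0 : nat) (G : nat -> nat -> nat) (n : nat) : nat := nat_rect (fun _ => nat) y0 G n.
Lemma reval_prec f g v y0 G n : reval f v y0 -> (forall n z, reval g (n :: z :: v) (G n z)) ->
  reval (RPrec f g) (n :: v) (prec y0 G n).
Proof. by move=> h1 h2; elim: n => [|n IH]; [exact: ev_prec0|apply: ev_precS IH _]. Qed.

Definition computable2 (f : nat -> nat -> nat) := exists c, forall x y, reval c [x; y] (f x y).
Lemma computable2_app f a b : computable2 f -> computable a -> computable b -> computable (fun x => f (a x) (b x)).
Proof. move=> [c h] [d k] [e l]; exists (RComp c [d; e]) => x; exact: reval_comp2 (k x) (l x) (h _ _). Qed.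
Lemma reval_proj i v y : nth i v 0 = y -> reval (RProj i) v y.
Proof. by move=> <-; constructor. Qed.
Lemma computable2_add : computable2 Nat.add.
Proof.
exists (RPrec (RProj 0) (RComp RSucc [RProj 1])) => x y.
have -> : x + y = prec y (fun _ z => S z) x by elim: x => //= x ->.
by apply: reval_prec => [|n z]; [exact: reval_proj|apply: reval_succ; exact: reval_proj].
Qed.
Lemma computable2_mul : computable2 Nat.mul.
Proof.
have [ca ha] := computable2_add.
exists (RPrec RZero (RComp ca [RProj 2; RProj 1])) => x y.
have -> : x * y = prec 0 (fun _ z => y + z) x by elim: x => //= x ->.
by apply: reval_prec => [|n z]; [exact: ev_zero|apply: reval_comp2 (ha _ _); exact: reval_proj].
Qed.
Lemma computable2_sub : computable2 Nat.sub.
Proof.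
pose cp := RPrec RZero (RProj 0).
have hp : forall x, reval cp [x] (pred x).
  move=> x; have -> : pred x = prec 0 (fun n _ => n) x by case: x.
  by apply: reval_prec => [|n z]; [exact: ev_zero|exact: reval_proj].
exists (RComp (RPrec (RProj 0) (RComp cp [RProj 1])) [RProj 1; RProj 0]) => x y.
apply: (@reval_comp2 _ _ _ _ y x); [exact: reval_proj|exact: reval_proj|].
have -> : x - y = prec x (fun _ z => pred z) y.
  elim: y => [|y IH] /=; [lia|rewrite -IH; lia].
by apply: reval_prec => [|n z]; [exact: reval_proj|apply: reval_comp1 (hp _); exact: reval_proj].
Qed.
Lemma computable_add a b : computable a -> computable b -> computable (fun x => a x + b x).
Proof. exact: computable2_app computable2_add. Qed.
Lemma computable_mul a b : computable a -> computable b -> computable (fun x => a x * b x).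
Proof. exact: computable2_app computable2_mul. Qed.
Lemma computable_sub a b : computable a -> computable b -> computable (fun x => a x - b x).
Proof. exact: computable2_app computable2_sub. Qed.
Lemma computable_iter F n a : computable F -> computable n -> computable a -> computable (fun x => Nat.iter (n x) F (a x)).
Proof.
move=> [c h] hn ha; apply: (@computable2_app (fun m y => Nat.iter m F y)) => //.
exists (RPrec (RProj 0) (RComp c [RProj 1])) => m y.
have -> : Nat.iter m F y = prec y (fun _ z => F z) m by elim: m => //= m ->.
by apply: reval_prec => [|k z]; [exact: reval_proj|apply: reval_comp1 (h _); exact: reval_proj].
Qed.
Lemma computable_if a b c : computable a -> computable b -> computable c -> computable (fun x => if a x =? 0 then b x else c x).
Proof.
move=> ha hb hc; apply: (@computable_ext (fun x => b x * (1 - a x) + c x * (1 - (1 - a x)))).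
  move=> x; case: (a x) => [|n] /=; lia.
have h1 : computable (fun x => 1 - a x) by apply: computable_sub ha; exact: computable_const.
apply: computable_add; first exact: computable_mul.
by apply: computable_mul => //; apply: computable_sub => //; exact: computable_const.
Qed.

Fixpoint tri (n : nat) : nat := match n with 0 => 0 | S n => S n + tri n end.
Lemma tri_eq n : tri n = n * S n / 2.
Proof.
apply: (Nat.div_unique _ _ _ 0); first by lia.
by elim: n => [|n IH] /=; nia.
Qed.
Lemma cpairE x y : cpair x y = tri (x + y) + y.
Proof. by rewrite /cpair tri_eq. Qed.
Lemma computable_tri a : computable a -> computable (fun x => tri (a x)).
Proof.
apply: computable_comp; have [ca ha] := computable2_add.
exists (RPrec RZero (RComp ca [RComp RSucc [RProj 0]; RProj 1])) => x.
have -> : tri x = prec 0 (fun n z => S n + z) x by elim: x => //= x ->.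
apply: reval_prec => [|n z]; first exact: ev_zero.
by apply: reval_comp2 (ha _ _); [apply: reval_succ; exact: reval_proj|exact: reval_proj].
Qed.
Lemma computable_pair a b : computable a -> computable b -> computable (fun x => cpair (a x) (b x)).
Proof.
move=> ha hb; apply: (@computable_ext (fun x => tri (a x + b x) + b x)).
  by move=> x; rewrite cpairE.
by apply: computable_add => //; apply: computable_tri; exact: computable_add.
Qed.
(** The largest s with [tri s <= z]: the truncated differences contribute 1 exactly when the next
    triangular number has been reached. *)
Fixpoint troot (z : nat) : nat :=
  match z with 0 => 0 | S z => troot z + (1 - (tri (S (troot z)) - S z)) end.
Lemma tri_mono m n : m <= n -> tri m <= tri n.
Proof. by elim: n => [|n IH] h; [case: m h; lia|case: (Nat.eq_dec m (S n)) => [->//|?] /=; have := IH ltac:(lia); lia]. Qed.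
Lemma troot_spec z : tri (troot z) <= z < tri (S (troot z)).
Proof.
elim: z => [|z IH]; first by rewrite /=; lia.
have -> : troot (S z) = troot z + (1 - (tri (S (troot z)) - S z)) by [].
case: (Nat.le_gt_cases (tri (S (troot z))) (S z)) => h.
  have -> : tri (S (troot z)) - S z = 0 by lia.
  have -> : troot z + (1 - 0) = S (troot z) by lia.
  by move: IH h => /=; lia.
have -> : 1 - (tri (S (troot z)) - S z) = 0 by lia.
rewrite Nat.add_0_r; lia.
Qed.
Lemma troot_uniq z s : tri s <= z < tri (S s) -> troot z = s.
Proof.
have := troot_spec z => h1 h2.
case: (Nat.lt_trichotomy (troot z) s) => [lt|[//|lt]].
- have := tri_mono lt; lia.
- have := tri_mono lt; lia.
Qed.
Lemma computable_troot a : computable a -> computable (fun x => troot (a x)).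
Proof.
apply: computable_comp; have [ca ha] := computable2_add; have [cs hs] := computable2_sub; have [ct ht] := computable_tri computable_id.
exists (RPrec RZero (RComp ca [RProj 1; RComp cs [RComp RSucc [RZero]; RComp cs [RComp ct [RComp RSucc [RProj 1]]; RComp RSucc [RProj 0]]]])) => x.
have -> : troot x = prec 0 (fun n z => z + (1 - (tri (S z) - S n))) x by elim: x => // x IH; rewrite /= -IH.
apply: reval_prec => [|n z]; first exact: ev_zero.
apply: reval_comp2 (ha _ _); first exact: reval_proj.
apply: reval_comp2 (hs _ _); first by apply: reval_succ; exact: ev_zero.
apply: reval_comp2 (hs _ _); last by apply: reval_succ; exact: reval_proj.
by apply: reval_comp1 (ht _); apply: reval_succ; exact: reval_proj.
Qed.
Definition csnd (z : nat) := z - tri (troot z).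
Definition cfst (z : nat) := troot z - csnd z.
Lemma cpair_troot x y : troot (cpair x y) = x + y.
Proof. apply: troot_uniq; rewrite cpairE /=; lia. Qed.
Lemma csnd_cpair x y : csnd (cpair x y) = y.
Proof. rewrite /csnd cpair_troot cpairE; lia. Qed.
Lemma cfst_cpair x y : cfst (cpair x y) = x.
Proof. rewrite /cfst csnd_cpair cpair_troot; lia. Qed.
Lemma cpair_cfst_csnd z : cpair (cfst z) (csnd z) = z.
Proof.
have h := troot_spec z; rewrite /= in h.
have h2 : csnd z <= troot z by rewrite /csnd; lia.
rewrite cpairE /cfst; have -> : troot z - csnd z + csnd z = troot z by lia.
rewrite /csnd; lia.
Qed.
Lemma computable_csnd a : computable a -> computable (fun x => csnd (a x)).
Proof. by move=> h; apply: computable_sub => //; apply: computable_tri; exact: computable_troot. Qed.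
Lemma computable_cfst a : computable a -> computable (fun x => cfst (a x)).
Proof. by move=> h; apply: computable_sub; [exact: computable_troot|exact: computable_csnd]. Qed.
Lemma cpair_inj x y x' y' : cpair x y = cpair x' y' -> x = x' /\ y = y'.
Proof. by move=> e; rewrite -(cfst_cpair x y) -{2}(csnd_cpair x y) e cfst_cpair csnd_cpair. Qed.
Lemma csnd_le z : csnd z <= z.
Proof. rewrite /csnd; lia. Qed.

Definition hdc (l : nat) := cfst (l - 1).
Definition tlc (l : nat) := csnd (l - 1).
Definition consc (x l : nat) := S (cpair x l).
Lemma hdc_cons x l : hdc (consc x l) = x.
Proof. by rewrite /hdc /consc Nat.sub_succ Nat.sub_0_r cfst_cpair. Qed.
Lemma tlc_cons x l : tlc (consc x l) = l.
Proof. by rewrite /tlc /consc Nat.sub_succ Nat.sub_0_r csnd_cpair. Qed.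
Lemma computable_hdc a : computable a -> computable (fun x => hdc (a x)).
Proof. by move=> h; apply: computable_cfst; apply: computable_sub => //; exact: computable_const. Qed.
Lemma computable_tlc a : computable a -> computable (fun x => tlc (a x)).
Proof. by move=> h; apply: computable_csnd; apply: computable_sub => //; exact: computable_const. Qed.
Lemma computable_consc a b : computable a -> computable b -> computable (fun x => consc (a x) (b x)).
Proof. by move=> h k; apply: computable_S; exact: computable_pair. Qed.
Lemma code_list_surj n : exists l, code_list l = n.
Proof.
move: n; apply: (well_founded_induction Nat.lt_wf_0) => -[|n] IH; first by exists [].
have [|l e] := IH (csnd n); first by have := csnd_le n; lia.
by exists (cfst n :: l); rewrite /= e cpair_cfst_csnd.
Qed.
Lemma code_list_inj l l' : code_list l = code_list l' -> l = l'.
Proof.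
elim: l l' => [|x l IH] [|x' l'] //= [/cpair_inj [-> /IH ->]] //.
Qed.
Lemma code_list_length l : length l <= code_list l.
Proof.
elim: l => //= x l IH; have := csnd_le (cpair x (code_list l)); rewrite csnd_cpair; lia.
Qed.

Section Fold.
Variable G : nat -> nat -> nat -> nat.
Definition fold_step (st : nat) : nat :=
  let p := cfst (cfst st) in let l := csnd (cfst st) in
  if l =? 0 then st else cpair (cpair p (tlc l)) (G p (hdc l) (csnd st)).
(** The code [l] itself is the number of iterations: it bounds the length of the list, and surplus
    steps are idle on the empty list. The parameter [p] is kept in the state so that the iterated
    function stays unary. *)
Definition foldc (p l acc : nat) : nat := csnd (Nat.iter l fold_step (cpair (cpair p l) acc)).
Lemma iter_fix (A : Type) (f : A -> A) x n : f x = x -> Nat.iter n f x = x.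
Proof. by move=> e; elim: n => //= n ->. Qed.
Lemma foldc_spec p l acc : foldc p (code_list l) acc = fold_left (fun a x => G p x a) l acc.
Proof.
rewrite /foldc.
suff h : forall n, length l <= n -> Nat.iter n fold_step (cpair (cpair p (code_list l)) acc) =
    cpair (cpair p 0) (fold_left (fun a x => G p x a) l acc).
  by rewrite h ?csnd_cpair //; exact: code_list_length.
elim: l acc => [|x l IH] acc n.
  by move=> _; apply: iter_fix; rewrite /fold_step cfst_cpair csnd_cpair.
case: n => [|n] /= h; first by lia.
rewrite -Nat.iter_succ Nat.iter_succ_r {2}/fold_step !cfst_cpair !csnd_cpair.
rewrite -[S (cpair x _)]/(consc x (code_list l)) tlc_cons hdc_cons /=.
by apply: IH; lia.
Qed.
Lemma computable_fold p l a : computable (fun t => G (cfst t) (cfst (csnd t)) (csnd (csnd t))) -> computable p -> computable l -> computable a ->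
  computable (fun x => foldc (p x) (l x) (a x)).
Proof.
move=> hG hp hl ha; apply: computable_csnd; apply: computable_iter => //; last by do 2 apply: computable_pair => //.
have c1 : computable (fun st => cfst (cfst st)) by do 2 apply: computable_cfst; exact: computable_id.
have c2 : computable (fun st => csnd (cfst st)) by apply: computable_csnd; apply: computable_cfst; exact: computable_id.
have c3 : computable (fun st => csnd st) by apply: computable_csnd; exact: computable_id.
apply: computable_if => //; first exact: computable_id.
apply: computable_pair; first by apply: computable_pair => //; exact: computable_tlc.
apply: (@computable_ext (fun st => let t := cpair (cfst (cfst st)) (cpair (hdc (csnd (cfst st))) (csnd st)) in G (cfst t) (cfst (csnd t)) (csnd (csnd t)))).
  by move=> st /=; rewrite !csnd_cpair !cfst_cpair.
by apply: computable_comp hG _; apply: computable_pair => //; apply: computable_pair => //; exact: computable_hdc.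
Qed.
End Fold.

Definition parity (a : nat) := Nat.iter a (fun z => 1 - z) 0.
Lemma parity_even a : (parity a =? 0) = Nat.even a.
Proof.
have h : parity a <= 1 /\ (parity a =? 0) = Nat.even a.
  elim: a => [|a [h1 h2]]; first by split; [rewrite /parity /=; lia|].
  have -> : parity (S a) = 1 - parity a by [].
  rewrite Nat.even_succ -Nat.negb_even -h2.
  by case: (parity a) h1 => [|[|n]] //=; lia.
by case: h.
Qed.
Lemma letter_invE a : letter_inv a = if parity a =? 0 then S a else a - 1.
Proof. by rewrite parity_even /letter_inv Nat.sub_1_r. Qed.
Lemma computable_letter_inv a : computable a -> computable (fun x => letter_inv (a x)).
Proof.
apply: computable_comp; apply: (@computable_ext (fun a => if parity a =? 0 then S a else a - 1)).
  by move=> x; rewrite letter_invE.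
apply: computable_if; last by apply: computable_sub; [exact: computable_id|exact: computable_const].
  by apply: computable_iter; [apply: computable_sub; [exact: computable_const|exact: computable_id]|exact: computable_id|exact: computable_const].
by apply: computable_S; exact: computable_id.
Qed.
Lemma letter_invK a : letter_inv (letter_inv a) = a.
Proof.
rewrite {2}/letter_inv; case e : (Nat.even a).
  by rewrite /letter_inv Nat.even_succ -Nat.negb_even e.
case: a e => [|a] //; rewrite Nat.even_succ -Nat.negb_even /= => e.
by rewrite /letter_inv; case: (Nat.even a) e.
Qed.
Lemma letter_inv_lt k a : a < 2 * k -> letter_inv a < 2 * k.
Proof.
rewrite /letter_inv; case e : (Nat.even a) => h; last by lia.
have [m em] := proj1 (Nat.even_spec a) e; lia.
Qed.

(** * Certificates for trivial words *)

Definition winv (w : list nat) := rev (map letter_inv w).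

Section Zipper.
Variable rels : list (list nat).
Notation weq := (word_eq rels).

Lemma weq_trans w1 w2 w3 : weq w1 w2 -> weq w2 w3 -> weq w1 w3.
Proof. exact: we_trans. Qed.
Lemma weq_ctx u v w w' : weq w w' -> weq (u ++ w ++ v) (u ++ w' ++ v).
Proof.
elim=> {w w'} [w|w w' h|w w' _ h|w1 w2 w3 _ h _ h'].
- apply: we_refl.
- apply: we_step; case: h => [x y a|x y r hr].
  + have := @ws_cancel rels (u ++ x) (y ++ v) a; by rewrite -!app_assoc.
  + have := @ws_rel rels (u ++ x) (y ++ v) r hr; by rewrite -!app_assoc.
- exact: we_sym.
- exact: weq_trans h h'.
Qed.
Lemma weq_cat u u' v v' : weq u u' -> weq v v' -> weq (u ++ v) (u' ++ v').
Proof.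
move=> h1 h2; apply: (weq_trans (w2 := u' ++ v)).
  by have := weq_ctx [] v h1.
by have := weq_ctx u' [] h2; rewrite !app_nil_r.
Qed.
Lemma weq_invl w : weq (winv w ++ w) [].
Proof.
elim: w => [|a w IH]; first apply: we_refl.
rewrite /winv /= -app_assoc; apply: weq_trans IH; apply: we_step.
have := @ws_cancel rels (winv w) w (letter_inv a); by rewrite letter_invK.
Qed.
Lemma weq_invr w : weq (w ++ winv w) [].
Proof.
elim: w => [|a w IH]; first apply: we_refl.
rewrite /winv /= app_assoc; apply: weq_trans (weq_ctx [a] [letter_inv a] IH) _.
apply: we_step; exact: (@ws_cancel rels [] [] a).
Qed.
Lemma weq_rel r : In r rels -> weq r [].
Proof. by move=> h; apply: we_step; have := @ws_rel rels [] [] r h; rewrite app_nil_r. Qed.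
Lemma weq_winv w w' : weq w w' -> weq (winv w) (winv w').
Proof.
move=> h; apply: (weq_trans (w2 := winv w ++ w' ++ winv w')).
  by apply: we_sym; have := weq_cat (we_refl rels (winv w)) (weq_invr w'); rewrite app_nil_r.
apply: (weq_trans (w2 := winv w ++ w ++ winv w')).
  by apply: weq_ctx; apply: we_sym.
by rewrite app_assoc; exact: (weq_cat (weq_invl w) (we_refl rels _)).
Qed.

(* A zipper (L, R) stands for the word rev L ++ R; an instruction moves the cursor or changes the word
   at the cursor by a pair of inverse letters, by a relator or by the inverse of a relator. *)
Definition zip := (list nat * list nat)%type.
Definition zw (z : zip) := rev (fst z) ++ snd z.
Definition zstep (i : nat) (z : zip) : zip :=
  let '(L, R) := z in
  match cfst i with
  | 0 => match R with x :: R' => (x :: L, R') | [] => z end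
  | 1 => match L with x :: L' => (L', x :: R) | [] => z end
  | 2 => (csnd i :: L, letter_inv (csnd i) :: R)
  | 3 => match L, R with x :: L', y :: R' => if y =? letter_inv x then (L', R') else z | _, _ => z end
  | 4 => (rev (nth (csnd i) rels []) ++ L, R)
  | _ => (L, winv (nth (csnd i) rels []) ++ R)
  end.
Lemma nth_weq i : weq (nth i rels []) [].
Proof. by have [h|->] := nth_in_or_default i rels []; [exact: weq_rel|apply: we_refl]. Qed.
Lemma zstep_weq i z : weq (zw z) (zw (zstep i z)).
Proof.
case: z => L R; rewrite /zw /zstep.
case: (cfst i) => [|[|[|[|[|k]]]]] /=.
- by case: R => [|x R] /=; rewrite -?app_assoc; apply: we_refl.
- by case: L => [|x L] /=; rewrite -?app_assoc; apply: we_refl.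
- apply: we_sym; apply: we_step; rewrite -app_assoc; exact: ws_cancel.
- case: L R => [|x L] [|y R] /=; try apply: we_refl.
  case: (Nat.eqb_spec y (letter_inv x)) => [->|_] /=; last apply: we_refl.
  rewrite -app_assoc; apply: we_step; exact: ws_cancel.
- rewrite rev_app_distr rev_involutive -app_assoc; apply: we_sym.
  exact: (weq_ctx (rev L) R (nth_weq (csnd i))).
- apply: we_sym; exact: (weq_ctx (rev L) R (weq_winv (nth_weq (csnd i)))).
Qed.
Definition zreach (z z' : zip) := exists cert, fold_left (fun z i => zstep i z) cert z = z'.
Lemma zreach_refl z : zreach z z.
Proof. by exists []. Qed.
Lemma zreach_trans z1 z2 z3 : zreach z1 z2 -> zreach z2 z3 -> zreach z1 z3.
Proof. by move=> [c e] [c' e']; exists (c ++ c'); rewrite fold_left_app e. Qed.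
Lemma zreach1 k a z z' : zstep (cpair k a) z = z' -> zreach z z'.
Proof. by move=> e; exists [cpair k a]. Qed.
Lemma zreach_left u v : zreach (rev (u ++ v), []) (rev u, v).
Proof.
rewrite -{2}[v]app_nil_r; move: [] => R.
elim/rev_ind: v R => [|x v IH] R; first by rewrite app_nil_r; exact: zreach_refl.
apply: (zreach_trans (z2 := (rev (u ++ v), x :: R))).
  apply: (@zreach1 1 0); rewrite /zstep cfst_cpair app_assoc rev_app_distr /=.
  by [].
by rewrite -app_assoc; exact: IH.
Qed.
Lemma zreach_home u v : zreach (rev u, v) (rev (u ++ v), []).
Proof.
elim: v u => [|x v IH] u; first by rewrite app_nil_r; exact: zreach_refl.
apply: (zreach_trans (z2 := (rev (u ++ [x]), v))).
  by apply: (@zreach1 0 0); rewrite /zstep cfst_cpair rev_app_distr.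
by have := IH (u ++ [x]); rewrite -app_assoc.
Qed.
Lemma zreach_cancel q L R : zreach (q ++ L, map letter_inv q ++ R) (L, R).
Proof.
elim: q => [|x q IH]; first exact: zreach_refl.
apply: zreach_trans IH; apply: (@zreach1 3 0).
by rewrite /zstep cfst_cpair /= Nat.eqb_refl.
Qed.
Lemma zreach_step w w' : word_step rels w w' -> zreach (rev w, []) (rev w', []) /\ zreach (rev w', []) (rev w, []).
Proof.
case=> [u v a|u v r hr]; split.
- apply: (zreach_trans (z2 := (rev (u ++ [a]), letter_inv a :: v))).
    by have := zreach_left (u ++ [a]) (letter_inv a :: v); rewrite -app_assoc.
  apply: zreach_trans (zreach_home u v); rewrite rev_app_distr.
  exact: (zreach_cancel [a]).
- apply: zreach_trans (zreach_left u v) _.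
  apply: (zreach_trans (z2 := (rev (u ++ [a]), letter_inv a :: v))).
    by apply: (@zreach1 2 a); rewrite /zstep cfst_cpair csnd_cpair rev_app_distr.
  by have := zreach_home (u ++ [a]) (letter_inv a :: v); rewrite -app_assoc.
- have [i [hi ei]] := In_nth _ _ [] hr.
  apply: (zreach_trans (z2 := (rev (u ++ r), v))).
    by rewrite app_assoc; exact: zreach_left.
  apply: zreach_trans (zreach_home u v).
  (* A relator is deleted by inserting its inverse right after it and cancelling letter by
     letter. *)
  apply: (zreach_trans (z2 := (rev (u ++ r), winv r ++ v))).
    by apply: (@zreach1 5 i); rewrite /zstep cfst_cpair csnd_cpair ei.
  rewrite rev_app_distr /winv -map_rev; exact: zreach_cancel.
- have [i [hi ei]] := In_nth _ _ [] hr.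
  apply: zreach_trans (zreach_left u v) _.
  apply: (zreach_trans (z2 := (rev (u ++ r), v))).
    by apply: (@zreach1 4 i); rewrite /zstep cfst_cpair csnd_cpair ei rev_app_distr.
  by rewrite app_assoc; exact: zreach_home.
Qed.
(** Runs have a direction while [word_eq] is symmetric, so the induction carries runs both ways. *)
Lemma zreach_weq w w' : weq w w' -> zreach (rev w, []) (rev w', []) /\ zreach (rev w', []) (rev w, []).
Proof.
elim=> {w w'} [w|w w' h|w w' _ [h h']|w1 w2 w3 _ [h1 h2] _ [h3 h4]].
- split; exact: zreach_refl.
- exact: zreach_step.
- by [].
- split; [exact: zreach_trans h1 h3|exact: zreach_trans h4 h2].
Qed.
Lemma zreach_trivial w : weq w [] <-> zreach (rev w, []) ([], []).
Proof.
split; first by move=> /zreach_weq [].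
move=> [cert e].
have h : forall z, weq (zw z) (zw (fold_left (fun z i => zstep i z) cert z)).
  elim: cert {e} => [|i cert IH] z /=; first apply: we_refl.
  exact: weq_trans (zstep_weq i z) (IH _).
by have := h (rev w, []); rewrite e /zw /= rev_involutive app_nil_r.
Qed.
End Zipper.

Definition czip (z : zip) : nat := cpair (code_list (fst z)) (code_list (snd z)).
Definition pushc (l acc : nat) := foldc (fun _ x a => consc x a) 0 l acc.
Definition pushinvc (l acc : nat) := foldc (fun _ x a => consc (letter_inv x) a) 0 l acc.
Lemma pushcE l L : pushc (code_list l) (code_list L) = code_list (rev l ++ L).
Proof.
rewrite /pushc foldc_spec; elim: l L => [|x l IH] L //=.
by rewrite -[consc x _]/(code_list (x :: L)) IH -app_assoc.
Qed.
Lemma pushinvcE l L : pushinvc (code_list l) (code_list L) = code_list (winv l ++ L).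
Proof.
rewrite /pushinvc foldc_spec; elim: l L => [|x l IH] L //=.
by rewrite -[consc _ _]/(code_list (letter_inv x :: L)) IH /winv /= -app_assoc.
Qed.
Lemma hdc_code l : hdc (code_list l) = hd 0 l.
Proof. by case: l => // x l; exact: hdc_cons. Qed.
Lemma tlc_code l : tlc (code_list l) = code_list (tl l).
Proof. by case: l => // x l; exact: tlc_cons. Qed.
Definition nthc (i l : nat) := hdc (Nat.iter i tlc l).
Lemma nthcE i l : nthc i (code_list l) = nth i l 0.
Proof.
rewrite /nthc; elim: i l => [|i IH] l; first by rewrite hdc_code; case: l.
by rewrite Nat.iter_succ_r tlc_code IH; case: l => //=; case: i {IH}.
Qed.
(** Truncated subtraction suffices for the case distinction: [cfst i - k =? 0] means [cfst i = k]
    once the smaller values have been excluded. The sum of the two differences tests equality of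
    letters. *)
Definition zstepc (rels i z : nat) : nat :=
  if cfst i =? 0 then (if csnd z =? 0 then z else cpair (consc (hdc (csnd z)) (cfst z)) (tlc (csnd z))) else
  if cfst i - 1 =? 0 then (if cfst z =? 0 then z else cpair (tlc (cfst z)) (consc (hdc (cfst z)) (csnd z))) else
  if cfst i - 2 =? 0 then cpair (consc (csnd i) (cfst z)) (consc (letter_inv (csnd i)) (csnd z)) else
  if cfst i - 3 =? 0 then
    (if cfst z =? 0 then z else if csnd z =? 0 then z else
     if (hdc (csnd z) - letter_inv (hdc (cfst z))) + (letter_inv (hdc (cfst z)) - hdc (csnd z)) =? 0
     then cpair (tlc (cfst z)) (tlc (csnd z)) else z) else
  if cfst i - 4 =? 0 then cpair (pushc (nthc (csnd i) rels) (cfst z)) (csnd z) else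
  cpair (cfst z) (pushinvc (nthc (csnd i) rels) (csnd z)).
Lemma zstepcE rels i z : zstepc (code_list (map code_list rels)) i (czip z) = czip (zstep rels i z).
Proof.
case: z => L R; rewrite /zstepc /zstep /czip /= cfst_cpair csnd_cpair !hdc_code !tlc_code.
have -> : nthc (csnd i) (code_list (map code_list rels)) = code_list (nth (csnd i) rels []).
  by rewrite nthcE -[0]/(code_list []) map_nth.
case: (cfst i) => [|[|[|[|[|k]]]]] /=.
- by case: R.
- by case: L.
- by [].
- case: L R => [|x L] [|y R] //=.
  case: (Nat.eqb_spec y (letter_inv x)) => [->|ne]; first by rewrite Nat.sub_diag.
  by case: (Nat.eqb_spec (y - letter_inv x + (letter_inv x - y)) 0) => //; lia.
- by rewrite pushcE.
- by rewrite pushinvcE.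
Qed.
Definition runc (rels cert z : nat) := foldc zstepc rels cert z.
Lemma runcE rels cert z : runc (code_list (map code_list rels)) (code_list cert) (czip z) = czip (fold_left (fun z i => zstep rels i z) cert z).
Proof. by rewrite /runc foldc_spec; elim: cert z => [|i cert IH] z //=; rewrite zstepcE IH. Qed.
Lemma czip0 z : czip z = 0 <-> z = ([], []).
Proof.
split; last by move=> ->.
case: z => L R; rewrite /czip -[0]/(cpair 0 0) /= => /cpair_inj [].
by case: L => //; case: R.
Qed.
Lemma runc_trivial rels w : word_eq rels w [] <-> exists cert, runc (code_list (map code_list rels)) cert (cpair (code_list (rev w)) 0) = 0.
Proof.
rewrite zreach_trivial; split.
- by move=> [cert e]; exists (code_list cert); rewrite -[cpair _ _]/(czip (rev w, [])) runcE e.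
- move=> [n]; have [cert <-] := code_list_surj n.
  by rewrite -[cpair _ _]/(czip (rev w, [])) runcE => /czip0 e; exists cert.
Qed.
Definition powc (w m : nat) : nat := csnd (Nat.iter m (fun st => cpair (cfst st) (pushc (cfst st) (csnd st))) (cpair w 0)).
Lemma word_pow_comm w m : word_pow w m ++ w = w ++ word_pow w m.
Proof. by elim: m => [|m IH] /=; rewrite ?app_nil_r // -app_assoc IH. Qed.
Lemma powcE w m : powc (code_list w) m = code_list (rev (word_pow w m)).
Proof.
rewrite /powc; have -> : Nat.iter m (fun st => cpair (cfst st) (pushc (cfst st) (csnd st))) (cpair (code_list w) 0) =
    cpair (code_list w) (code_list (rev (word_pow w m))); last by rewrite csnd_cpair.
elim: m => [|m IH] //; rewrite Nat.iter_succ IH cfst_cpair csnd_cpair pushcE -rev_app_distr word_pow_comm.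
by [].
Qed.
(** The summand [S x - 2 * p] vanishes exactly for the letters x < 2p, so the sum is 0 exactly for
    valid words. *)
Definition badword (k w : nat) : nat := foldc (fun p x a => a + (S x - 2 * p)) k w 0.
Lemma fold_sum (f : nat -> nat) l a : fold_left (fun a x => a + f x) l a = 0 <-> a = 0 /\ Forall (fun x => f x = 0) l.
Proof.
elim: l a => [|x l IH] a /=; first by split=> [->|[]].
rewrite IH; split.
- by move=> [h1 h2]; split; [lia|constructor => //; lia].
- by move=> [h1 h2]; inversion h2; subst; split=> //; lia.
Qed.
Lemma badwordE k w : badword k (code_list w) = 0 <-> valid_word k w.
Proof.
rewrite /badword foldc_spec (fold_sum (fun x => S x - 2 * k)) /valid_word !Forall_forall.
split=> [[_ h] x hx|h]; first by have := h x hx; lia.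
by split=> // x hx; have := h x hx; lia.
Qed.
Definition badrels (k rels : nat) : nat := foldc (fun p r a => a + badword p r) k rels 0.
Lemma badrelsE k rels : badrels k (code_list (map code_list rels)) = 0 <-> Forall (valid_word k) rels.
Proof.
rewrite /badrels foldc_spec (fold_sum (badword k)) Forall_map !Forall_forall.
split=> [[_ h] x hx|h]; first by apply/badwordE; exact: h.
by split=> // x hx; apply/badwordE; exact: h.
Qed.

Ltac Cauto := repeat first
  [ exact: computable_id | exact: computable_const | assumption | apply: computable_if | apply: computable_pair | apply: computable_cfst | apply: computable_csnd
  | apply: computable_hdc | apply: computable_tlc | apply: computable_consc | apply: computable_letter_inv
  | apply: computable_add | apply: computable_sub | apply: computable_mul | apply: computable_S ].
Lemma computable_pushc a b : computable a -> computable b -> computable (fun x => pushc (a x) (b x)).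
Proof. by move=> ha hb; apply: computable_fold => //; Cauto. Qed.
Lemma computable_pushinvc a b : computable a -> computable b -> computable (fun x => pushinvc (a x) (b x)).
Proof. by move=> ha hb; apply: computable_fold => //; Cauto. Qed.
Lemma computable_nthc a b : computable a -> computable b -> computable (fun x => nthc (a x) (b x)).
Proof. by move=> ha hb; apply: computable_hdc; apply: computable_iter => //; Cauto. Qed.
Lemma computable_runc a b c : computable a -> computable b -> computable c -> computable (fun x => runc (a x) (b x) (c x)).
Proof.
move=> ha hb hc; apply: computable_fold => //; rewrite /zstepc.
have h1 : computable (fun t => cfst t) by Cauto.
have h2 : computable (fun t => cfst (csnd t)) by Cauto.
have h3 : computable (fun t => csnd (csnd t)) by Cauto.
have h4 : computable (fun t => nthc (csnd (cfst (csnd t))) (cfst t)) by apply: computable_nthc => //; Cauto.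
have h5 : computable (fun t => pushc (nthc (csnd (cfst (csnd t))) (cfst t)) (cfst (csnd (csnd t)))) by apply: computable_pushc => //; Cauto.
have h6 : computable (fun t => pushinvc (nthc (csnd (cfst (csnd t))) (cfst t)) (csnd (csnd (csnd t)))) by apply: computable_pushinvc => //; Cauto.
by Cauto.
Qed.
Lemma computable_powc a b : computable a -> computable b -> computable (fun x => powc (a x) (b x)).
Proof.
move=> ha hb; apply: computable_csnd; apply: computable_iter => //; last by Cauto.
apply: computable_pair; first by Cauto.
by apply: computable_pushc; Cauto.
Qed.
Lemma computable_badword a b : computable a -> computable b -> computable (fun x => badword (a x) (b x)).
Proof. by move=> ha hb; apply: computable_fold => //; Cauto. Qed.
Lemma computable_badrels a b : computable a -> computable b -> computable (fun x => badrels (a x) (b x)).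
Proof.
move=> ha hb; apply: computable_fold => //; last by Cauto.
by apply: computable_add; [Cauto|apply: computable_badword; Cauto].
Qed.

(** The universal number x codes a word w, an exponent m, a witness for m in A and a certificate for
    w^m = 1; the existential number y is a certificate for w = 1. *)
Theorem TF_Pi02 (A : nat -> Prop) : RE A -> Pi02 (TF_presentations A).
Proof.
move=> [RA [[ca hca] hA]].
pose g m y := epsilon (inhabits 0) (fun z => reval ca [m; y] z /\ (RA m y <-> z = 0)).
have hg m y : reval ca [m; y] (g m y) /\ (RA m y <-> g m y = 0).
  by apply: (epsilon_spec (inhabits 0) (fun z => reval ca [m; y] z /\ (RA m y <-> z = 0))); exact: hca.
have Cg : computable2 g by exists ca => m y; case: (hg m y).
pose val n x y :=
  let k := cfst n in let rels := csnd n in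
  let w := cfst x in let m := cfst (csnd x) in let ya := cfst (csnd (csnd x)) in let cert := csnd (csnd (csnd x)) in
  (* A malformed presentation gives 1 for all x and y and is thereby rejected. An x whose premises
     fail gives 0, so it imposes no condition. *)
  if badrels k rels =? 0 then
    (if badword k w + g m ya + runc rels cert (cpair (powc w m) 0) =? 0
     then runc rels y (cpair (pushc w 0) 0) else 0)
  else 1.
have Cval : computable (fun t => val (cfst t) (cfst (csnd t)) (csnd (csnd t))).
  rewrite /val; apply: computable_if; [|apply: computable_if|exact: computable_const].
  - by apply: computable_badrels; Cauto.
  - apply: computable_add; last by apply: computable_runc; [Cauto|Cauto|apply: computable_pair; [apply: computable_powc; Cauto|exact: computable_const]].
    by apply: computable_add; [apply: computable_badword; Cauto|apply: (computable2_app Cg); Cauto].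
  - by apply: computable_runc; [Cauto|Cauto|apply: computable_pair; [apply: computable_pushc; Cauto|exact: computable_const]].
  - exact: computable_const.
exists (fun n x y => val n x y = 0); split.
  have [cv hv] := Cval; have [cp hp] : computable2 cpair.
    have [c hc] := computable2_add; have [ct ht] := computable_tri computable_id.
    exists (RComp c [RComp ct [c]; RProj 1]) => x y; rewrite cpairE.
    apply: reval_comp2 (hc _ _); last exact: reval_proj.
    apply: (@reval_comp1 ct c _ (x + y)); [exact: hc|exact: ht].
  exists (RComp cv [RComp cp [RProj 0; RComp cp [RProj 1; RProj 2]]]) => n x y.
  exists (val n x y); split=> //.
  apply: (@reval_comp1 _ _ _ (cpair n (cpair x y))).
    apply: reval_comp2 (hp _ _); first exact: reval_proj.
    by apply: reval_comp2 (hp _ _); exact: reval_proj.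
  by have := hv (cpair n (cpair x y)); rewrite !csnd_cpair !cfst_cpair.
move=> n.
have [lr er] := code_list_surj (csnd n).
have [rels erels] : exists rels, map code_list rels = lr.
  elim: (lr) => [|x l [rs e]]; first by exists [].
  by have [r hr] := code_list_surj x; exists (r :: rs); rewrite /= hr e.
set k := cfst n.
have en : n = code_pres k rels by rewrite /code_pres erels er cpair_cfst_csnd.
have hT : TF_presentations A n <-> Forall (valid_word k) rels /\ pres_A_torsion_free A k rels.
  split; last by move=> [h1 h2]; exists k, rels.
  move=> [k' [rels' [e [h1 h2]]]]; move: e; rewrite en => /cpair_inj [ek /code_list_inj er'].
  have -> : rels = rels'.
    move: er'; elim: (rels) (rels') => [|r l IH] [|r' l'] //= [/code_list_inj -> /IH ->] //.
  by rewrite ek.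
rewrite hT /val -/k -er -erels.
case: (Nat.eqb_spec (badrels k (code_list (map code_list rels))) 0) => hb; last first.
  split; last by move=> h; have [y] := h 0.
  by move=> [hv _]; case: hb; apply/badrelsE.
have hv := proj1 (badrelsE k rels) hb.
split.
- move=> [_ htf] x; have [w ew] := code_list_surj (cfst x); rewrite -ew.
  case: (Nat.eqb_spec (_ + _ + _) 0) => hs; last by exists 0.
  have hw : word_eq rels w [].
    apply: (htf w (cfst (csnd x))).
    + by apply/badwordE; lia.
    + apply/hA; exists (cfst (csnd (csnd x))); apply/(proj2 (hg _ _)); lia.
    + apply/runc_trivial; exists (csnd (csnd (csnd x))); rewrite -powcE; lia.
  have [cert hc] := proj1 (runc_trivial rels w) hw.
  by exists cert; have := pushcE w []; rewrite app_nil_r /= => ->.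
- move=> h; split=> // w m hw /hA [ya hya] hp.
  have [cert hc] := proj1 (runc_trivial rels _) hp.
  have [y] := h (cpair (code_list w) (cpair m (cpair ya cert))).
  rewrite !csnd_cpair !cfst_cpair.
  have -> : badword k (code_list w) = 0 by apply/badwordE.
  have -> : g m ya = 0 by apply/(proj2 (hg _ _)).
  rewrite powcE hc /=; have := pushcE w []; rewrite app_nil_r /= => -> e.
  by apply/runc_trivial; exists y.
Qed.

(** * Groups and HNN extensions *)

Record grp : Type := Grp {
  car :> Type;
  mul : car -> car -> car;
  one : car;
  inv : car -> car;
  mulA : forall x y z, mul x (mul y z) = mul (mul x y) z;
  mul1g : forall x, mul one x = x;
  mulVg : forall x, mul (inv x) x = one }.
Arguments one {g}.
Arguments mul {g}.
Arguments inv {g}.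
Declare Scope grp_scope.
Delimit Scope grp_scope with g.
Infix "*" := mul : grp_scope.
Notation "1" := one : grp_scope.
Notation "x ^-1" := (inv x) (at level 3, left associativity, format "x ^-1") : grp_scope.
Open Scope grp_scope.

Section GroupFacts.
Variable G : grp.
Implicit Types x y z : G.

Lemma mulgV x : x * x^-1 = 1.
Proof.
rewrite -[x * x^-1]mul1g -{1}(mulVg (x^-1)) -mulA [x^-1 * (x * _)]mulA mulVg mul1g.
exact: mulVg.
Qed.
Lemma mulg1 x : x * 1 = x.
Proof. by rewrite -(mulVg x) mulA mulgV mul1g. Qed.
Lemma mulKg x y : x^-1 * (x * y) = y.
Proof. by rewrite mulA mulVg mul1g. Qed.
Lemma mulKVg x y : x * (x^-1 * y) = y.
Proof. by rewrite mulA mulgV mul1g. Qed.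
Lemma mulgI x y z : x * y = x * z -> y = z.
Proof. by move=> e; rewrite -(mulKg x y) e mulKg. Qed.
Lemma mulIg x y z : y * x = z * x -> y = z.
Proof. by move=> e; rewrite -(mulg1 y) -(mulgV x) mulA e -mulA mulgV mulg1. Qed.
Lemma invg1 : (1 : G)^-1 = 1.
Proof. by rewrite -(mulg1 1^-1) mulVg. Qed.
Lemma invgK x : x^-1^-1 = x.
Proof. by apply: (@mulgI x^-1); rewrite mulgV mulVg. Qed.
Lemma invMg x y : (x * y)^-1 = y^-1 * x^-1.
Proof. by apply: (@mulgI (x * y)); rewrite mulgV -mulA mulKVg mulgV. Qed.
Lemma mulAr x y z : (x * y) * z = x * (y * z).
Proof. by rewrite mulA. Qed.
Lemma eq_invg_mul x y : x * y = 1 -> y = x^-1.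
Proof. by move=> e; apply: (@mulgI x); rewrite e mulgV. Qed.
Lemma eqg_div x y : x * y^-1 = 1 -> x = y.
Proof. by move=> e; apply: (@mulIg y^-1); rewrite e mulgV. Qed.

Fixpoint npow x (n : nat) : G := match n with O => 1 | S m => x * npow x m end.

Lemma npowD x m n : npow x (m + n) = npow x m * npow x n.
Proof. by elim: m => [|m IH] /=; rewrite ?mul1g // IH mulA. Qed.
Lemma npowS x n : npow x (S n) = npow x n * x.
Proof. by rewrite -Nat.add_1_r npowD /= mulg1. Qed.
Lemma npow1 n : npow 1 n = 1.
Proof. by elim: n => //= n ->; rewrite mul1g. Qed.
Lemma npow_conj x y n : npow (x * y * x^-1) n = x * npow y n * x^-1.
Proof.
elim: n => [|n IH] /=; first by rewrite mulg1 mulgV.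
by rewrite IH !mulAr mulKg.
Qed.

Definition torsion_free := forall x n, 1 <= n -> npow x n = 1 -> x = 1.
End GroupFacts.

Hint Rewrite mulAr mulg1 mul1g mulgV mulVg mulKg mulKVg invMg invgK invg1 : grp.
Ltac grp := autorewrite with grp.

Definition comm (G : grp) (x y : G) := x * y = y * x.

Section Commute.
Variable G : grp.
Implicit Types x y z : G.
Lemma comm_sym x y : comm x y -> comm y x.
Proof. by rewrite /comm. Qed.
Lemma comm1 x : comm x 1.
Proof. by rewrite /comm; grp. Qed.
Lemma commM x y z : comm x y -> comm x z -> comm x (y * z).
Proof. by rewrite /comm => e f; rewrite mulA e -mulA f mulA. Qed.
Lemma commV x y : comm x y -> comm x y^-1.
Proof.
rewrite /comm => e; apply: (@mulgI _ y); rewrite mulA -e; grp. by [].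
Qed.
Lemma comm_conj x y : comm x y -> x * y * x^-1 = y.
Proof. by move=> e; rewrite e; grp. Qed.
Lemma conj_comm x y : x * y * x^-1 = y -> comm x y.
Proof. by move=> e; rewrite /comm -{2}e; grp. Qed.
End Commute.

Definition is_hom (G H : grp) (f : G -> H) := forall x y, f (x * y) = f x * f y.

Section Hom.
Variables (G H : grp) (f : G -> H).
Hypothesis fh : is_hom f.
Lemma hom1 : f 1 = 1.
Proof. by apply: (@mulgI _ (f 1)); rewrite -fh; grp. Qed.
Lemma homV x : f x^-1 = (f x)^-1.
Proof. by apply: eq_invg_mul; rewrite -fh mulgV hom1. Qed.
Lemma homX x n : f (npow x n) = npow (f x) n.
Proof. by elim: n => [|n IH] /=; rewrite ?hom1 // fh IH. Qed.
End Hom.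
Lemma hom_comp (G H M : grp) (f : G -> H) (g : H -> M) :
  is_hom f -> is_hom g -> is_hom (fun x => g (f x)).
Proof. by move=> a b x y; rewrite a b. Qed.
Lemma hom_id (G : grp) : is_hom (fun x : G => x).
Proof. by []. Qed.
Lemma hom_conj (G H : grp) (f : G -> H) t : is_hom f -> is_hom (fun x => t * f x * t^-1).
Proof. by move=> a x y; rewrite a; grp. Qed.

Section Generated.
Variable G : grp.
Inductive gen (S : G -> Prop) : G -> Prop :=
| gen_in x : S x -> gen S x
| gen1 : gen S 1
| genM x y : gen S x -> gen S y -> gen S (x * y)
| genV x : gen S x -> gen S x^-1.

Record subgroup (S : G -> Prop) : Prop := Subgroup {
  sg1 : S 1; sgM : forall x y, S x -> S y -> S (x * y); sgV : forall x, S x -> S x^-1 }.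

Lemma gen_sg S : subgroup (gen S).
Proof. by split; [exact: gen1|exact: genM|exact: genV]. Qed.
Lemma gen_min (S M : G -> Prop) : subgroup M -> (forall x, S x -> M x) -> forall x, gen S x -> M x.
Proof.
move=> sgm inc x; elim=> {x} [x /inc//||x y _ h1 _ h2|x _ h]; first exact: (sg1 sgm).
- exact: (sgM sgm).
- exact: (sgV sgm).
Qed.
Lemma npow_sg (S : G -> Prop) x n : subgroup S -> S x -> S (npow x n).
Proof. by move=> s h; elim: n => [|n IH] /=; [exact: (sg1 s)|exact: (sgM s)]. Qed.

End Generated.

Section SubgroupExamples.
Variable G : grp.
Lemma sub_sg_cent (y : G) : subgroup (fun x => comm y x).
Proof. by split; [exact: comm1|exact: commM|exact: commV]. Qed.
Lemma sub_sg_eq (H : grp) (f g : G -> H) : is_hom f -> is_hom g -> subgroup (fun x => f x = g x).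
Proof.
move=> fh gh; split; first by rewrite !hom1.
- by move=> x y a b; rewrite fh gh a b.
- by move=> x a; rewrite !homV // a.
Qed.
Lemma sub_sg_pre (H : grp) (f : G -> H) (S : H -> Prop) :
  is_hom f -> subgroup S -> subgroup (fun x => S (f x)).
Proof.
move=> fh s; split; first by rewrite hom1 //; exact: (sg1 s).
- by move=> x y a b; rewrite fh; exact: (sgM s).
- by move=> x a; rewrite homV //; exact: (sgV s).
Qed.
Lemma sub_sg_ker (H : grp) (f : G -> H) : is_hom f -> subgroup (fun x => f x = 1).
Proof.
move=> fh; split; first exact: hom1.
- by move=> x y a b; rewrite fh a b mul1g.
- by move=> x a; rewrite homV // a invg1.
Qed.
End SubgroupExamples.

Section SubGrp.
Variables (G : grp) (S : G -> Prop).
Hypothesis Ssg : subgroup S.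
Definition sub_car := {x : G | S x}.
Lemma sub_eq (x y : sub_car) : proj1_sig x = proj1_sig y -> x = y.
Proof. by case: x y => x p [y q] /= e; subst y; rewrite (proof_irrelevance _ p q). Qed.
Definition sub_grp : grp.
refine (@Grp sub_car
  (fun x y => exist _ (proj1_sig x * proj1_sig y) (sgM Ssg (proj2_sig x) (proj2_sig y)))
  (exist _ 1 (sg1 Ssg))
  (fun x => exist _ (proj1_sig x)^-1 (sgV Ssg (proj2_sig x))) _ _ _).
- by move=> x y z; apply: sub_eq => /=; rewrite mulA.
- by move=> x; apply: sub_eq => /=; rewrite mul1g.
- by move=> x; apply: sub_eq => /=; rewrite mulVg.
Defined.
End SubGrp.

Section Perm.
Variable T : Type.
Record perm := Perm { pf : T -> T; pb : T -> T;
  pfK : forall x, pb (pf x) = x; pbK : forall x, pf (pb x) = x }.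
Lemma perm_eq (p q : perm) : (forall x, pf p x = pf q x) -> p = q.
Proof.
case: p => f g h k; case: q => f' g' h' k' /= e.
have ef : f = f' by apply: functional_extensionality.
subst f'.
have eg : g = g'.
  by apply: functional_extensionality => x; rewrite -{1}(k' x) h.
subst g'; by rewrite (proof_irrelevance _ h h') (proof_irrelevance _ k k').
Qed.
Definition perm_mul (p q : perm) : perm.
refine (@Perm (fun x => pf p (pf q x)) (fun x => pb q (pb p x)) _ _).
- by move=> x; rewrite !pfK.
- by move=> x; rewrite !pbK.
Defined.
Definition sym_grp : grp.
refine (@Grp perm perm_mul (@Perm (fun x => x) (fun x => x) (fun _ => eq_refl) (fun _ => eq_refl))
   (fun p => Perm (@pbK p) (@pfK p)) _ _ _).
- by move=> x y z; apply: perm_eq.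
- by move=> x; apply: perm_eq.
- by move=> x; apply: perm_eq => y /=; rewrite pfK.
Defined.
End Perm.

(** A partial isomorphism between subgroups, given by its graph: the domain stays implicit and the
    inverse only swaps arguments. [rel_l] makes it single-valued and [rel_r] injective. *)
Record piso (G : grp) := Piso {
  rel :> G -> G -> Prop;
  rel1 : rel 1 1;
  relM : forall g h g' h', rel g h -> rel g' h' -> rel (g * g') (h * h');
  relV : forall g h, rel g h -> rel g^-1 h^-1;
  rel_l : forall h, rel 1 h -> h = 1;
  rel_r : forall g, rel g 1 -> g = 1 }.

Definition piso_sym (G : grp) (R : piso G) : piso G :=
  @Piso G (fun g h => R h g) (rel1 R) (fun g h g' h' a b => relM a b)
   (fun g h a => relV a) (rel_r (p := R)) (rel_l (p := R)).

Lemma rel_fun (G : grp) (R : piso G) g h h' : R g h -> R g h' -> h = h'.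
Proof.
move=> a b; apply: eqg_div; apply: (rel_l (p := R)).
rewrite -(mulgV g); exact: relM a (relV b).
Qed.

(** * HNN extensions with any number of stable letters, acting on normal forms *)

Section HNN.
Variables (G : grp) (I : Type) (R : I -> piso G).
Definition letter := (I * bool)%type.
Definition neg (l : letter) : letter := (fst l, negb (snd l)).
Lemma negK l : neg (neg l) = l.
Proof. by case: l => i b; rewrite /neg /= negb_involutive. Qed.
Lemma neg_neq l : neg l <> l.
Proof. by case: l => i [] []. Qed.

(* lrel l g h means l g = h l in the extension. *)
Definition lrel (l : letter) : piso G := if snd l then R (fst l) else piso_sym (R (fst l)).
Lemma lrel_neg l g h : lrel (neg l) g h <-> lrel l h g.
Proof. by case: l => i []. Qed.
Definition src l g := exists h, lrel l g h.
Lemma src_sg l : subgroup (src l).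
Proof.
split; first by exists 1; exact: rel1.
- by move=> x y [h a] [k b]; exists (h * k); exact: relM.
- by move=> x [h a]; exists h^-1; exact: relV.
Qed.
(** The choice is made from the predicate that describes the whole coset, so extensionality gives
    equal cosets equal representatives. The coset of the domain itself gets 1, the value that
    signals a possible cancellation. *)
Definition coset_rep l (g : G) : G :=
  if dec (src l g) then 1 else epsilon (inhabits 1) (fun x => src l (g * x^-1)).
Lemma coset_rep_src l g : src l g -> coset_rep l g = 1.
Proof. by rewrite /coset_rep; case: (dec _). Qed.
Lemma coset_rep_spec l g : src l (g * (coset_rep l g)^-1).
Proof.
rewrite /coset_rep; case: (dec _) => [h|h]; first by grp.
apply: (epsilon_spec (inhabits 1) (fun x => src l (g * x^-1))).
by exists g; rewrite mulgV; exact: (sg1 (src_sg l)).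
Qed.
Lemma src_coset_rep l g : coset_rep l g = 1 -> src l g.
Proof. by move=> e; move: (coset_rep_spec l g); rewrite e; grp. Qed.
Lemma coset_rep_mul l c g : src l c -> coset_rep l (c * g) = coset_rep l g.
Proof.
move=> hc; have sg := src_sg l.
have e : forall x, src l (c * g * x) <-> src l (g * x).
  move=> x; split=> h; last by rewrite -mulA; exact: (sgM sg).
  have := sgM sg (sgV sg hc) h; by grp.
have e1 := e 1; move: e1; rewrite !mulg1 => e1.
rewrite /coset_rep; case: (dec _) => h1; case: (dec _) => h2 //; try tauto.
f_equal; apply: functional_extensionality => x.
apply: propositional_extensionality; exact: e.
Qed.
Lemma coset_rep_idem l g : coset_rep l (coset_rep l g) = coset_rep l g.
Proof.
rewrite -{1}(mulKg g (coset_rep l g)).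
have -> : g^-1 * (g * coset_rep l g) = (g * (coset_rep l g)^-1)^-1 * g by grp.
apply: coset_rep_mul; exact: (sgV (src_sg l) (coset_rep_spec l g)).
Qed.
Definition rel_img l g : G := epsilon (inhabits 1) (fun h => lrel l g h).
Lemma rel_img_spec l g : src l g -> lrel l g (rel_img l g).
Proof. by move=> h; apply: (epsilon_spec (inhabits 1) (fun h => lrel l g h)). Qed.
Lemma rel_img_eq l g h : lrel l g h -> rel_img l g = h.
Proof. by move=> a; apply: (rel_fun (R := lrel l) (g := g)) => //; apply: rel_img_spec; exists h. Qed.

Fixpoint nf_ok (t : list (letter * G)) : Prop :=
  match t with
  | [] => True
  | (l, r) :: t' => coset_rep l r = r /\ nf_ok t' /\
      match t' with (l', _) :: _ => l' = neg l -> r <> 1 | _ => True end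
  end.
(* (g, [(l1,r1);(l2,r2);...]) is the normal form g l1 r1 l2 r2 ... *)
Definition nf := {x : G * list (letter * G) | nf_ok (snd x)}.
Lemma nf_eq (x y : nf) : proj1_sig x = proj1_sig y -> x = y.
Proof. by case: x y => x p [y q] /= e; subst y; rewrite (proof_irrelevance _ p q). Qed.

(** Write g = c r with c in the domain of l and r the representative; then l g = h l r, where h is
    the image of c. If r = 1 and the next letter is the inverse of l, the two letters cancel. *)
Definition act_raw l (x : G * list (letter * G)) : G * list (letter * G) :=
  let r := coset_rep l (fst x) in
  let h := rel_img l (fst x * r^-1) in
  match snd x with
  | (l', r') :: t' => if dec (l' = neg l /\ r = 1) then (h * r', t') else (h, (l, r) :: snd x)
  | [] => (h, [(l, r)])
  end.
Lemma act_ok l x : nf_ok (snd x) -> nf_ok (snd (act_raw l x)).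
Proof.
case: x => g [|[l' r'] t'] /=; rewrite /act_raw /=; first by rewrite coset_rep_idem.
case=> a [b c]; case: (dec _) => //= h.
split; first exact: coset_rep_idem.
by split=> // e e'; apply: h.
Qed.
Definition pushes l g (t : list (letter * G)) :=
  match t with (l', _) :: _ => l' = neg l -> coset_rep l g <> 1 | _ => True end.
Lemma pushes_or_pops l g t : pushes l g t \/ exists r t', t = (neg l, r) :: t' /\ src l g.
Proof.
case: t => [|[l' r] t'] /=; first by left.
case: (dec (l' = neg l)) => [->|n]; last by left=> /n.
case: (dec (coset_rep l g = 1)) => [e|n]; last by left.
by right; exists r, t'; split=> //; exact: src_coset_rep.
Qed.
Lemma act_push l g t : pushes l g t ->
  act_raw l (g, t) = (rel_img l (g * (coset_rep l g)^-1), (l, coset_rep l g) :: t).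
Proof.
rewrite /act_raw /pushes /=; case: t => [|[l' r'] t'] // h.
case: (dec _) => // [[e f]]; case: (h e f).
Qed.
Lemma act_pop l g r t : src l g -> act_raw l (g, (neg l, r) :: t) = (rel_img l g * r, t).
Proof.
move=> s; rewrite /act_raw /= (coset_rep_src s).
by case: (dec _) => [_|[]] //; grp.
Qed.
(** Pushes and pops undo each other. After a push by l the head lies in the domain of the inverse
    letter, which forces a pop; after a pop, the condition on adjacent inverse letters in a normal
    form forces a push. *)
Lemma actK l x : nf_ok (snd x) -> act_raw (neg l) (act_raw l x) = x.
Proof.
case: x => g t /= hok.
have sp := coset_rep_spec l g; have im := rel_img_spec sp.
case: (pushes_or_pops l g t) => [h|[r' [t' [et s]]]].
  rewrite (act_push h).
  have := @act_pop (neg l) (rel_img l (g * (coset_rep l g)^-1)) (coset_rep l g) t; rewrite negK => ->.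
    by exists (g * (coset_rep l g)^-1); apply/lrel_neg.
  by rewrite (@rel_img_eq (neg l) _ (g * (coset_rep l g)^-1)); [apply/lrel_neg|grp].
subst t.
have im' := rel_img_spec s.
rewrite act_pop //; case: hok => a [b c].
have s' : src (neg l) (rel_img l g) by exists g; apply/lrel_neg.
rewrite act_push /pushes coset_rep_mul // a; first by rewrite negK in c *.
rewrite (rel_img_eq (h := g)) //; apply/lrel_neg.
have -> : rel_img l g * r' * r'^-1 = rel_img l g by grp.
exact: rel_img_spec.
Qed.
Definition act l (x : nf) : nf := exist (fun x => nf_ok (snd x)) _ (act_ok l (proj2_sig x)).
Definition act_perm (l : letter) : sym_grp nf.
refine (@Perm nf (act l) (act (neg l)) _ _).
- by move=> x; apply: nf_eq => /=; rewrite actK //; exact: (proj2_sig x).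
- move=> x; apply: nf_eq => /=; rewrite -{1}(negK l) actK //; exact: (proj2_sig x).
Defined.
Definition lmul (g : G) (x : nf) : nf := exist (fun x => nf_ok (snd x)) (g * fst (proj1_sig x), snd (proj1_sig x)) (proj2_sig x).
Definition lmul_perm (g : G) : sym_grp nf.
refine (@Perm nf (lmul g) (lmul g^-1) _ _).
- by case=> [[h t] k]; apply: nf_eq => /=; grp.
- by case=> [[h t] k]; apply: nf_eq => /=; grp.
Defined.
Lemma lmul_hom : is_hom (lmul_perm : G -> sym_grp nf).
Proof. by move=> x y; apply: perm_eq => -[[h t] k]; apply: nf_eq => /=; grp. Qed.

Definition hnn_gens (p : sym_grp nf) := (exists g, p = lmul_perm g) \/ exists i, p = act_perm (i, true).
(** Van der Waerden's method: the extension is a group of permutations of the normal forms, so the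
    group axioms hold at once, and distinct normal forms of the form (g, []) show that the base
    embeds. *)
Definition hnn : grp := sub_grp (gen_sg hnn_gens).
Definition hin (g : G) : hnn := exist _ (lmul_perm g) (gen_in (or_introl (ex_intro _ g eq_refl))).
Definition hlet (i : I) : hnn :=
  exist _ (act_perm (i, true)) (gen_in (or_intror (ex_intro _ i eq_refl))).
Definition slet (l : letter) : hnn := if snd l then hlet (fst l) else (hlet (fst l))^-1.
Lemma hin_hom : is_hom hin.
Proof. by move=> x y; apply: sub_eq => /=; exact: lmul_hom. Qed.
Lemma slet_neg l : slet (neg l) = (slet l)^-1.
Proof. by case: l => i []; [|exact: (eq_sym (invgK (hlet i)))]. Qed.
Lemma slet_act l x : pf (proj1_sig (slet l)) x = act l x.
Proof. by case: l => i []. Qed.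
Definition nf_base : nf := exist (fun x => nf_ok (snd x)) (1, []) Logic.I.

Lemma hnn_ext (x y : hnn) : (forall z, proj1_sig (pf (proj1_sig x) z) = proj1_sig (pf (proj1_sig y) z)) -> x = y.
Proof. by move=> h; apply: sub_eq; apply: perm_eq => z; apply: nf_eq. Qed.

Lemma slet_rel l g h : lrel l g h -> slet l * hin g = hin h * slet l.
Proof.
move=> r; apply: hnn_ext => -[[k t] o] /=.
rewrite !slet_act /=.
have s : src l g by exists h.
case: (pushes_or_pops l k t) => [c|[r' [t' [et sk]]]].
  rewrite !act_push // /pushes coset_rep_mul //=.
  congr (_, _); apply: rel_img_eq; rewrite -mulA; apply: relM => //.
  exact: rel_img_spec (coset_rep_spec l k).
subst t.
rewrite !act_pop //=; first exact: (sgM (src_sg l)).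
rewrite mulA; congr (_ * _, _); apply: rel_img_eq; apply: relM => //; exact: rel_img_spec.
Qed.

Lemma hnn_rel i g h : R i g h -> hlet i * hin g * (hlet i)^-1 = hin h.
Proof. by move=> r; have e : hlet i * hin g = hin h * hlet i := @slet_rel (i, true) g h r; rewrite e; grp. Qed.

Lemma hnn_mulE (x y : hnn) z : pf (proj1_sig (x * y)) z = pf (proj1_sig x) (pf (proj1_sig y) z).
Proof. by []. Qed.
#[global] Arguments car : simpl never.
#[global] Arguments mul : simpl never.
#[global] Arguments one : simpl never.
#[global] Arguments inv : simpl never.

Lemma hnn_ind (P : hnn -> Prop) : subgroup P -> (forall g, P (hin g)) -> (forall i, P (hlet i)) -> forall x, P x.
Proof.
move=> sg a b [p hp].
suff h : forall q, gen hnn_gens q -> forall hq : gen hnn_gens q, P (exist _ q hq) by exact: h.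
move=> q; elim=> {p hp q} [q [[g e]|[i e]] hq||q q' k IH k' IH' hq|q k IH hq].
- by have -> : exist _ q hq = hin g by apply: sub_eq.
- by have -> : exist _ q hq = hlet i by apply: sub_eq.
- move=> hq; have -> : exist _ _ hq = (1 : hnn) by apply: sub_eq.
  exact: (sg1 sg).
- have -> : exist _ _ hq = ((exist _ _ k : hnn) * (exist _ _ k' : hnn)) by apply: sub_eq.
  exact: (sgM sg).
- have -> : exist _ _ hq = ((exist _ _ k : hnn)^-1) by apply: sub_eq.
  exact: (sgV sg).
Qed.

Lemma hnn_gen_ind (P : hnn -> Prop) : (forall x, gen (fun y => (exists g, y = hin g) \/ (exists i, y = hlet i)) x -> P x) -> forall x, P x.
Proof.
move=> h x; apply: h; move: x; apply: hnn_ind.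
- exact: gen_sg.
- by move=> g; apply: gen_in; left; exists g.
- by move=> i; apply: gen_in; right; exists i.
Qed.

(** * The universal property of HNN extensions *)

Section Universal.
Variables (H : grp) (f : G -> H) (tau : I -> H).
Hypothesis fh : is_hom f.
Hypothesis tr : forall i g h, R i g h -> tau i * f g * (tau i)^-1 = f h.
Definition ltau (l : letter) : H := if snd l then tau (fst l) else (tau (fst l))^-1.
Lemma ltau_neg l : ltau (neg l) = (ltau l)^-1.
Proof. by case: l => i []; [|exact: (eq_sym (invgK (tau i)))]. Qed.
Lemma ltau_rel l g h : lrel l g h -> ltau l * f g = f h * ltau l.
Proof.
case: l => i [] /= r; rewrite /ltau /=.
- by rewrite -(tr r); grp.
- by rewrite -(tr r); grp.
Qed.
Fixpoint evl (t : list (letter * G)) : H :=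
  match t with [] => 1 | (l, r) :: t' => ltau l * f r * evl t' end.
Definition evn (x : nf) : H := f (fst (proj1_sig x)) * evl (snd (proj1_sig x)).
Lemma evn_act l x : evn (act l x) = ltau l * evn x.
Proof.
case: x => [[g t] o]; rewrite /evn /=.
have sp := coset_rep_spec l g; have im := rel_img_spec sp.
case: (pushes_or_pops l g t) => [c|[r' [t' [et sk]]]].
  rewrite act_push //=.
  have := ltau_rel im; rewrite mulA => e; rewrite !mulA -e fh homV //; by grp.
subst t.
rewrite !act_pop //= fh ltau_neg !mulA (ltau_rel (rel_img_spec sk)); by grp.
Qed.
Definition hnn_lift (x : hnn) : H := evn (pf (proj1_sig x) nf_base).
Lemma evn_base : evn nf_base = 1.
Proof. by rewrite /evn /= mulg1 (hom1 fh). Qed.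
(** Under [evn] every x acts on normal forms as left multiplication by a fixed element of [H]. That
    element is found by induction over generators and then identified at the base point. *)
Lemma hnn_lift_evn (x : hnn) z : evn (pf (proj1_sig x) z) = hnn_lift x * evn z.
Proof.
have [h hh] : exists h, forall z, evn (pf (proj1_sig x) z) = h * evn z.
  case: x => p hp /=; elim: hp => {p} [p [[g ->]|[i ->]]||p q _ [h e] _ [k e']|p _ [h e]] /=.
  - by exists (f g) => y; rewrite /evn /= fh mulA.
  - by exists (ltau (i, true)) => y; rewrite evn_act.
  - by exists 1 => y; rewrite mul1g.
  - by exists (h * k) => y; rewrite e e' mulA.
  - by exists h^-1 => y; rewrite -{2}(pbK p y) e; grp.
by rewrite /hnn_lift !hh evn_base mulg1.
Qed.
Lemma hnn_lift_hom : is_hom hnn_lift.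
Proof. by move=> x y; rewrite {1}/hnn_lift hnn_mulE hnn_lift_evn. Qed.
Lemma hnn_lift_in g : hnn_lift (hin g) = f g.
Proof. by rewrite /hnn_lift /evn /=; grp. Qed.
Lemma hnn_lift_let i : hnn_lift (hlet i) = tau i.
Proof. by rewrite /hnn_lift /= evn_act evn_base mulg1. Qed.
End Universal.

Lemma hin_inj g h : hin g = hin h -> g = h.
Proof.
move=> e; have : proj1_sig (pf (proj1_sig (hin g)) nf_base) = proj1_sig (pf (proj1_sig (hin h)) nf_base) by rewrite e.
by rewrite /= !mulg1 => -[].
Qed.

(** * Britton's lemma and its consequences *)

Fixpoint word_prod (t : list (letter * G)) : hnn :=
  match t with [] => 1 | (l, g) :: t' => slet l * hin g * word_prod t' end.
Fixpoint reduced (t : list (letter * G)) : Prop :=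
  match t with
  | [] => True
  | (l, g) :: t' => match t' with (l', _) :: _ => l' = neg l -> ~ src l g | _ => True end /\ reduced t'
  end.
Lemma word_prod_cat t t' : word_prod (t ++ t') = word_prod t * word_prod t'.
Proof. by elim: t => [|[l g] t IH] /=; rewrite ?mul1g // IH; grp. Qed.

(** Applied to the base point, a reduced word acts by pushes only. After the push of l the head lies
    in the domain of the inverse of l; if the next letter popped, the coefficient between the two
    would lie in its domain too, against reducedness. *)
Lemma britton_aux l g t : reduced ((l, g) :: t) ->
  let x := proj1_sig (pf (proj1_sig (word_prod ((l, g) :: t))) nf_base) in
  length (snd x) = S (length t) /\ src (neg l) (fst x) /\ exists r t', snd x = (l, r) :: t'.
Proof.
elim: t l g => [|[l' g'] t IH] l g.
  move=> _ /=; rewrite slet_act [proj1_sig (act _ _)]/= act_push //=; split=> //.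
  split; last by eexists; eexists.
  eexists; apply/lrel_neg; exact: rel_img_spec (coset_rep_spec _ _).
move=> [h1 h2] x; have [e1 [e2 [r [t' e3]]]] := IH _ _ h2.
move: e1 e2 e3 @x; rewrite -[word_prod ((l, g) :: (l', g') :: t)]/(slet l * hin g * word_prod ((l', g') :: t)) !hnn_mulE !slet_act.
set y := act _ _; case: y => -[k s] o /= e1 e2 e3; subst s.
rewrite act_push.
  move=> e f; apply: (h1 e); subst l'; rewrite negK in e2.
  have a := src_coset_rep f.
  have := sgM (src_sg l) a (sgV (src_sg l) e2); by grp.
split; first by rewrite -e1.
split; last by eexists; eexists.
eexists; apply/lrel_neg; exact: rel_img_spec (coset_rep_spec _ _).
Qed.

Lemma britton g t h : reduced t -> hin g * word_prod t = hin h -> t = [] /\ g = h.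
Proof.
case: t => [|[l k] t] r e.
  by split=> //; apply: hin_inj; rewrite -e /= mulg1.
have [a _] := britton_aux r.
have e' : word_prod ((l, k) :: t) = hin (g^-1 * h).
  by rewrite hin_hom homV; [exact: hin_hom|rewrite -e; grp].
by move: a; rewrite e'.
Qed.

Section Reduce.
Variable M : G -> Prop.
Hypothesis Msg : subgroup M.
Hypothesis Minv : forall l g h, lrel l g h -> M g -> M h.

(** A pinch l g l^-1 is replaced by the image of g, which lies in [M] by [Minv]; reducing therefore
    never leaves coefficients in [M]. *)
Lemma reduce t : Forall (fun p => M (snd p)) t ->
  exists m t', M m /\ Forall (fun p => M (snd p)) t' /\ reduced t' /\ length t' <= length t /\ word_prod t = hin m * word_prod t'.
Proof.
elim: t => [|[l g] t IH] ht.
  exists 1, []; split; first exact: (sg1 Msg).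
  by do 3 (split => //); rewrite (hom1 hin_hom) mul1g.
have [mg ht'] : M g /\ Forall (fun p => M (snd p)) t by inversion ht.
have [m [t' [mm [mt [rt [lt' e]]]]]] := IH ht'.
have mgm : M (g * m) by exact: (sgM Msg).
have ee : word_prod ((l, g) :: t) = slet l * hin (g * m) * word_prod t' by rewrite /= e hin_hom; grp.
case: (dec (reduced ((l, g * m) :: t'))) => r.
  exists 1, ((l, g * m) :: t'); split; first exact: (sg1 Msg).
  split; first by constructor.
  split; first exact: r.
  split; first by move: lt' => /=; lia.
  by rewrite ee (hom1 hin_hom) mul1g.
case: t' mt rt lt' e ee r => [|[l' g'] t'] mt rt lt' e ee r; first by case: r.
have [hl s] : l' = neg l /\ src l (g * m).
  split; last by case: (dec (src l (g * m))) => // z; case: r; split=> //= _.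
  by case: (dec (l' = neg l)) => // z; case: r; split=> //= e'.
subst l'; case: s => h hr.
have mh : M h by exact: Minv hr mgm.
have [mg' mt'] : M g' /\ Forall (fun p => M (snd p)) t' by inversion mt.
exists (h * g'), t'; split; first exact: (sgM Msg).
split=> //; split; first by case: rt.
split; first by move: lt' => /=; lia.
by rewrite ee (slet_rel hr) /= slet_neg hin_hom; grp.
Qed.

Lemma gen_word x : gen (fun y => (exists g, M g /\ y = hin g) \/ exists i, y = hlet i) x ->
  exists m t, M m /\ Forall (fun p => M (snd p)) t /\ x = hin m * word_prod t.
Proof.
have sgl : forall l t, Forall (fun p => M (snd p)) t -> exists m t', M m /\ Forall (fun p => M (snd p)) t' /\ slet l * word_prod t = hin m * word_prod t'.
  move=> l t ht; exists 1, ((l, 1) :: t); split; first exact: (sg1 Msg).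
  split; first by constructor=> //; exact: (sg1 Msg).
  by rewrite /= !(hom1 hin_hom); grp.
have mulw : forall l m t, M m -> Forall (fun p => M (snd p)) t -> exists m' t', M m' /\ Forall (fun p => M (snd p)) t' /\ slet l * (hin m * word_prod t) = hin m' * word_prod t'.
  move=> l m t mm mt; exists 1, ((l, m) :: t); split; first exact: (sg1 Msg).
  split; first by constructor.
  by rewrite /= !(hom1 hin_hom); grp.
suff : forall x, gen (fun y => (exists g, M g /\ y = hin g) \/ exists i, y = hlet i) x ->
  forall m t, M m -> Forall (fun p => M (snd p)) t ->
  (exists m' t', M m' /\ Forall (fun p => M (snd p)) t' /\ x * (hin m * word_prod t) = hin m' * word_prod t') /\
  (exists m' t', M m' /\ Forall (fun p => M (snd p)) t' /\ x^-1 * (hin m * word_prod t) = hin m' * word_prod t').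
  move=> h hx; have [[m [t [a [b c]]]] _] := h x hx 1 [] (sg1 Msg) (Forall_nil _).
  by exists m, t; split=> //; split=> //; rewrite -c /= (hom1 hin_hom); grp.
move=> {}x; elim=> {x} [x [[g [mg ->]]|[i ->]]||x y _ IH1 _ IH2|x _ IH] m t mm mt.
- split.
  + exists (g * m), t; split; first exact: (sgM Msg).
    by split=> //; rewrite hin_hom mulA.
  + exists (g^-1 * m), t; split; first by apply: (sgM Msg) => //; exact: (sgV Msg).
    by split=> //; rewrite hin_hom (homV hin_hom) mulA.
- split; first exact: (mulw (i, true)).
  exact: (mulw (i, false)).
- by rewrite invg1 mul1g; split; exists m, t.
- have [[m1 [t1 [a1 [b1 c1]]]] _] := IH2 m t mm mt.
  have [[m2 [t2 [a2 [b2 c2]]]] _] := IH1 m1 t1 a1 b1.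
  have [_ [m3 [t3 [a3 [b3 c3]]]]] := IH1 m t mm mt.
  have [_ [m4 [t4 [a4 [b4 c4]]]]] := IH2 m3 t3 a3 b3.
  split; first by exists m2, t2; split=> //; split=> //; rewrite -mulA c1.
  by exists m4, t4; split=> //; split=> //; rewrite invMg -mulA c3.
- have [a b] := IH m t mm mt; by rewrite invgK.
Qed.

(** Words with coefficients in [M] can be reduced inside [M], and a reduced word that equals a base
    element has no letters. This computes the intersection of such a subgroup with the base. *)
Lemma hnn_sub_inter x g : gen (fun y => (exists g, M g /\ y = hin g) \/ exists i, y = hlet i) x ->
  x = hin g -> M g.
Proof.
move=> /gen_word [m [t [mm [mt ->]]]].
have [m' [t' [mm' [mt' [rt [_ ->]]]]]] := reduce mt.
rewrite mulA -hin_hom => e; have [_ <-] := britton rt e.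
exact: (sgM Msg).
Qed.
End Reduce.

Lemma all_sg : subgroup (fun _ : G => True).
Proof. by []. Qed.
Lemma Forall_all (t : list (letter * G)) : Forall (fun _ => True) t.
Proof. by elim: t => [|p t IH]; constructor. Qed.

Lemma hnn_word x : exists g t, reduced t /\ x = hin g * word_prod t.
Proof.
move: x; apply: hnn_gen_ind => x hx.
have [|g [t [_ [_ ->]]]] := @gen_word (fun _ => True) all_sg x.
  elim: hx => {x} [x [[g ->]|[i ->]]||x y _ h _ k|x _ h].
  - by apply: gen_in; left; exists g.
  - by apply: gen_in; right; exists i.
  - exact: gen1.
  - exact: genM.
  - exact: genV.
have [//|m [t' [_ [_ [rt [_ ->]]]]]] := @reduce (fun _ => True) all_sg _ t (Forall_all t).
by exists (g * m), t'; split=> //; rewrite hin_hom mulA.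
Qed.

Lemma reduced_cat t l g l' g' t' : reduced (t ++ [(l, g)]) -> reduced ((l', g') :: t') ->
  (l' = neg l -> ~ src l g) -> reduced ((t ++ [(l, g)]) ++ (l', g') :: t').
Proof.
move=> r1 r2 c; elim: t r1 => [|[k x] t IH] /= r1; first exact: (conj c r2).
case: r1 => a b; split; last exact: IH.
by case: t a {IH b} => [|[k' x'] t].
Qed.

(* A cyclically reduced word with at least one letter has infinite order: its powers are reduced. *)
Lemma cyc_reduced_pow l g t t' k x n : reduced ((l, g) :: t) -> (l, g) :: t = t' ++ [(k, x)] ->
  (l = neg k -> ~ src k x) -> exists t'', npow (word_prod ((l, g) :: t)) (S n) = word_prod ((l, g) :: t'') /\ reduced ((l, g) :: t'').
Proof.
move=> r e c; elim: n => [|n [t'' [e1 r1]]].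
  by exists t; split=> //; rewrite /npow mulg1.
exists (t ++ (l, g) :: t''); split.
  by rewrite -[npow _ (S (S n))]/(word_prod ((l, g) :: t) * npow (word_prod ((l, g) :: t)) (S n)) e1 -word_prod_cat.
rewrite -[(l, g) :: t ++ _]/(((l, g) :: t) ++ (l, g) :: t'') e; apply: reduced_cat => //.
by rewrite -e.
Qed.

Lemma pinch t : ~ reduced t -> exists m t', length t' < length t /\ word_prod t = hin m * word_prod t'.
Proof.
elim: t => [|[l g] t IH] nr; first by case: nr.
case: (dec (reduced t)) => rt; last first.
  have [m [t' [lt' e]]] := IH rt.
  exists 1, ((l, g * m) :: t'); split; first by move: lt' => /=; lia.
  by rewrite /= e !hin_hom (hom1 hin_hom); grp.
case: t rt nr {IH} => [|[l' g'] t] rt nr; first by case: nr.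
have [hl [h hr]] : l' = neg l /\ src l g.
  split; last by case: (dec (src l g)) => // z; case: nr; split.
  by case: (dec (l' = neg l)) => // z; case: nr; split.
subst l'; exists (h * g'), t; split; first by move=> /=; lia.
by rewrite /= !mulA (slet_rel hr) slet_neg hin_hom; grp.
Qed.

(** Cyclic reduction by induction on the number of letters. A pinch shortens the word; a pinch
    between last and first letter is removed by conjugating with the last letter; without either,
    all powers are reduced, so no positive power is 1. *)
Lemma hnn_torsion_conj x n : npow x (S n) = 1 -> exists c g, c * x * c^-1 = hin g.
Proof.
have [g [t [_ ->]]] := hnn_word x.
move: {2}(length t) (le_n (length t)) => N; elim: N g t => [|N IH] g t.
  by case: t => //= [|? ? l0]; [move=> _ _; exists (1 : hnn), g; grp|lia].
move=> lN e.
have conj : forall c y g' t', y = c * (hin g * word_prod t) * c^-1 -> y = hin g' * word_prod t' -> length t' <= N ->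
    exists c g0, c * (hin g * word_prod t) * c^-1 = hin g0.
  move=> c y g' t' e1 e2 l1.
  have [|c' [g0 e3]] := IH g' t' l1.
    by rewrite -e2 e1 npow_conj e mulg1 mulgV.
  by exists (c' * c), g0; rewrite -e3 -e2 e1; grp.
case: t lN e conj => [|[l k] t] lN e conj; first by exists (1 : hnn), g; rewrite /=; grp.
set w := hin g * _ in e conj *.
have [t' [k' [x' e1]]] : exists t' k' x', (l, k) :: t = t' ++ [(k', x')].
  have : (l, k) :: t <> [] by [].
  move/exists_last => [t' [[k' x'] ->]]; by exists t', k', x'.
(* Conjugation by the leading base element moves it into the last coefficient, which leaves a word
   that begins with a letter. *)
pose t1 := t' ++ [(k', x' * g)].
have len1 : length t1 = length ((l, k) :: t) by rewrite e1 /t1 !length_app.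
have ew : word_prod t1 = (hin g)^-1 * w * (hin g)^-1^-1.
  by rewrite /w e1 /t1 !word_prod_cat /= hin_hom; grp.
have e0 : npow (word_prod t1) (S n) = 1 by rewrite ew npow_conj e; grp.
case: (dec (reduced t1)) => r; last first.
  have [m [t2 [lt2 e2]]] := pinch r.
  apply: (conj _ _ m t2 ew e2); move: lt2 lN; rewrite len1 /=; lia.
have [k1 [t2 e2]] : exists k1 t2, t1 = (l, k1) :: t2.
  rewrite /t1; case: t' e1 {len1 ew e0 r t1} => [|[k2 x2] t'] /= [-> _ _]; by eexists; eexists.
case: (dec (l = neg k' -> ~ src k' (x' * g))) => c.
  have r2 : reduced ((l, k1) :: t2) by rewrite -e2.
  have e3 : (l, k1) :: t2 = t' ++ [(k', x' * g)] by rewrite -e2.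
  have [t3 [e4 r4]] := cyc_reduced_pow n r2 e3 c.
  move: e0; rewrite e2 e4 => e5.
  have e6 : hin 1 * word_prod ((l, k1) :: t3) = hin 1 by rewrite e5 (hom1 hin_hom) mul1g.
  by case: (britton r4 e6).
have [hl [h hr]] : l = neg k' /\ src k' (x' * g).
  split; last by case: (dec (src k' (x' * g))) => // z; case: c.
  by case: (dec (l = neg k')) => // z; case: c.
(* conjugating by the last letter cancels the first one *)
case: t' e1 @t1 len1 ew e0 r e2 => [|[k2 x2] t'] e1 t1 len1 ew e0 r e2.
  case: e1 => e1 _ _; move: hl; rewrite e1 => hl.
  by case: (@neg_neq k'); rewrite -hl.
have [e3 e4] : l = k2 /\ length t = S (length t').
  by case: e1 => -> _ ->; rewrite length_app /=; split=> //; lia.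
have e6 : slet k' * word_prod t1 * (slet k')^-1 = hin x2 * (word_prod t' * hin h).
  rewrite /t1 /= word_prod_cat /= mulg1 -e3 hl slet_neg.
  have := slet_rel hr => er; rewrite er; grp. by [].
have [g3 [t3 [e7 l7]]] : exists g3 t3, hin x2 * (word_prod t' * hin h) = hin g3 * word_prod t3 /\ length t3 = length t'.
  case: (dec (t' = [])) => z.
    by exists (x2 * h), []; rewrite z /= hin_hom; grp.
  have [t4 [[l4 g4] ->]] := exists_last z.
  exists x2, (t4 ++ [(l4, g4 * h)]); split; last by rewrite !length_app.
  by rewrite !word_prod_cat /= hin_hom; grp.
apply: (conj (slet k' * (hin g)^-1) (slet k' * word_prod t1 * (slet k')^-1) g3 t3).
- by rewrite ew; grp.
- by rewrite e6 e7.
- by move: lN; rewrite l7 /=; lia.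
Qed.

Lemma hnn_torsion_free : torsion_free G -> torsion_free hnn.
Proof.
move=> tf x [|n]; first by lia.
move=> _ e; have [c [g eg]] := hnn_torsion_conj e.
have e1 : npow g (S n) = 1.
  apply: hin_inj; rewrite (homX hin_hom) -eg npow_conj e (hom1 hin_hom); by grp.
have e2 : g = 1 by apply: (tf g (S n)) => //; lia.
have -> : x = c^-1 * (c * x * c^-1) * c by grp.
by rewrite eg e2 (hom1 hin_hom); grp.
Qed.
End HNN.

Section HnnMap.
Variables (G G' : grp) (I : Type) (R : I -> piso G) (R' : I -> piso G') (f : G -> G').
Hypothesis fh : is_hom f.
Hypothesis finj : forall x, f x = 1 -> x = 1.
Hypothesis fR : forall i g h, R i g h -> R' i (f g) (f h).
Hypothesis fsrc : forall l g, src R' l (f g) -> src R l g.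

Lemma hnn_map_rel i g h : R i g h -> hlet R' i * hin R' (f g) * (hlet R' i)^-1 = hin R' (f h).
Proof. by move=> r; apply: hnn_rel; exact: fR. Qed.
Definition hnn_map : hnn R -> hnn R' := hnn_lift (fun g => hin R' (f g)) (hlet R').
Lemma hnn_map_hom : is_hom hnn_map.
Proof. apply: hnn_lift_hom; [exact: (hom_comp fh (@hin_hom _ _ R'))|exact: hnn_map_rel]. Qed.
Lemma hnn_map_in g : hnn_map (hin R g) = hin R' (f g).
Proof. apply: hnn_lift_in. Qed.
Lemma hnn_map_let i : hnn_map (hlet R i) = hlet R' i.
Proof. apply: hnn_lift_let; [exact: (hom_comp fh (@hin_hom _ _ R'))|exact: hnn_map_rel]. Qed.
(** By [fsrc], an image lies in a domain only if the element already did, so reduced words stay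
    reduced and Britton's lemma applies to the image. *)
Lemma hnn_map_inj x : hnn_map x = 1 -> x = 1.
Proof.
have [g [t [r ->]]] := hnn_word x.
have mt : forall t, hnn_map (word_prod R t) = word_prod R' (map (fun p => (fst p, f (snd p))) t).
  have ml : forall l, hnn_map (slet R l) = slet R' l.
    case=> i [] /=; first exact: hnn_map_let.
    by rewrite /slet /= (homV hnn_map_hom) hnn_map_let.
  elim=> [|[l k] t' IH] /=; first exact: (hom1 hnn_map_hom).
  by rewrite !hnn_map_hom hnn_map_in IH ml.
have rt : reduced R' (map (fun p => (fst p, f (snd p))) t).
  elim: t r {mt} => [|[l k] t IH] //= [a b]; split; last exact: IH.
  by case: t a {IH b} => [|[l' k'] t] //= a e s; apply: (a e); exact: fsrc.
rewrite hnn_map_hom hnn_map_in mt -(hom1 (hin_hom R')) => e.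
have [e1 e2] := britton rt e.
have -> : t = [] by case: t {r mt rt e} e1.
by rewrite (finj e2) (hom1 (hin_hom _)) /= mulg1.
Qed.
End HnnMap.

(** * Free groups and semidirect products *)

Section IntPow.
Variable G : grp.
Implicit Types x y : G.
Definition gpow x (k : Z) : G :=
  if (0 <=? k)%Z then npow x (Z.to_nat k) else (npow x (Z.to_nat (- k)))^-1.
Lemma gpow0 x : gpow x 0 = 1.
Proof. by []. Qed.
Lemma gpow1 x : gpow x 1 = x.
Proof. by rewrite /gpow /= mulg1. Qed.
Lemma gpow_nat x n : gpow x (Z.of_nat n) = npow x n.
Proof. by rewrite /gpow; case: Z.leb_spec; try lia; rewrite Nat2Z.id. Qed.
Lemma gpow_opp_nat x n : gpow x (- Z.of_nat n) = (npow x n)^-1.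
Proof.
case: n => [|n]; first by rewrite /= /gpow /= invg1.
rewrite /gpow; case: Z.leb_spec; try lia; by rewrite Z.opp_involutive Nat2Z.id.
Qed.
Lemma gpowS x k : gpow x (k + 1) = gpow x k * x.
Proof.
case: (Z.le_gt_cases 0 k) => h.
  rewrite -(Z2Nat.id k h); move: (Z.to_nat k) => n.
  have -> : (Z.of_nat n + 1 = Z.of_nat (S n))%Z by lia.
  by rewrite !gpow_nat npowS.
have -> : (k = - Z.of_nat (S (Z.to_nat (- k - 1))))%Z by lia.
move: (Z.to_nat _) => n.
have -> : (- Z.of_nat (S n) + 1 = - Z.of_nat n)%Z by lia.
by rewrite !gpow_opp_nat /= invMg -mulA mulVg mulg1.
Qed.
Lemma gpowP x k : gpow x (k - 1) = gpow x k * x^-1.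
Proof. have -> : k = (k - 1 + 1)%Z by lia. rewrite gpowS; grp. by have -> : (k - 1 + 1 - 1 = k - 1)%Z by lia. Qed.
Lemma gpowD x k l : gpow x (k + l) = gpow x k * gpow x l.
Proof.
move: l; apply: Z.peano_ind => [|l IH|l IH].
- by rewrite Z.add_0_r gpow0 mulg1.
- by rewrite -Z.add_1_r Z.add_assoc !gpowS IH mulA.
- by rewrite -Z.sub_1_r Z.add_sub_assoc !gpowP IH mulA.
Qed.
Lemma gpowN x k : gpow x (- k) = (gpow x k)^-1.
Proof. by apply: eq_invg_mul; rewrite -gpowD; have -> : (k + - k = 0)%Z by lia. Qed.
Lemma gpow_sg (S : G -> Prop) x k : subgroup S -> S x -> S (gpow x k).
Proof.
move=> s h; rewrite /gpow; case: Z.leb => //; first exact: npow_sg.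
apply: (sgV s); exact: npow_sg.
Qed.
Lemma gpowM x k l : gpow (gpow x k) l = gpow x (k * l).
Proof.
move: l; apply: Z.peano_ind => [|l IH|l IH].
- by rewrite Z.mul_0_r !gpow0.
- by rewrite -Z.add_1_r gpowS IH -gpowD; congr gpow; lia.
- by rewrite -Z.sub_1_r gpowP IH -gpowN -gpowD; congr gpow; lia.
Qed.
Lemma gpow_conj x y k : gpow (x * y * x^-1) k = x * gpow y k * x^-1.
Proof. by rewrite /gpow !npow_conj; case: Z.leb => //; grp. Qed.
End IntPow.
Lemma hom_gpow (G H : grp) (f : G -> H) x k : is_hom f -> f (gpow x k) = gpow (f x) k.
Proof. by move=> fh; rewrite /gpow; case: Z.leb; rewrite ?(homV fh) (homX fh). Qed.

Definition unit_grp : grp.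
by refine (@Grp unit (fun _ _ => tt) tt (fun _ => tt) _ _ _); repeat case.
Defined.
Definition piso_all : piso unit_grp.
by refine (@Piso unit_grp (fun _ _ => True) _ _ _ _ _) => //; case.
Defined.

Section Free.
Variable X : Type.
(** As an HNN extension of the trivial group, the free group inherits normal forms, the universal
    property and torsion-freeness. *)
Definition free : grp := hnn (fun _ : X => piso_all).
Definition fx (x : X) : free := hlet _ x.
Lemma free_ind (P : free -> Prop) : subgroup P -> (forall x, P (fx x)) -> forall w, P w.
Proof.
move=> sg h; apply: hnn_ind => // -[].
by have -> : hin (fun _ : X => piso_all) tt = 1 := hom1 (@hin_hom _ _ _); exact: (sg1 sg).
Qed.
Lemma free_torsion_free : torsion_free free.
Proof. by apply: hnn_torsion_free => -[]. Qed.
Variables (H : grp) (f : X -> H).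
Definition free_lift : free -> H := hnn_lift (fun _ : unit_grp => 1) f.
Lemma free_lift_hom : is_hom free_lift.
Proof.
apply: hnn_lift_hom; first by move=> ? ?; rewrite mul1g.
by move=> *; grp.
Qed.
Lemma free_lift_fx x : free_lift (fx x) = f x.
Proof.
apply: hnn_lift_let; first by move=> ? ?; rewrite mul1g.
by move=> *; grp.
Qed.
End Free.
Lemma free_hom_eq (X : Type) (H : grp) (f g : free X -> H) : is_hom f -> is_hom g ->
  (forall x, f (fx x) = g (fx x)) -> forall w, f w = g w.
Proof. move=> fh gh e; apply: free_ind => //; exact: sub_sg_eq. Qed.

Section Prod.
Variables G H : grp.
Definition prod_grp : grp.
refine (@Grp (G * H) (fun x y => (fst x * fst y, snd x * snd y)) (1, 1)
  (fun x => ((fst x)^-1, (snd x)^-1)) _ _ _).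
- by case=> a b [c d] [e f] /=; rewrite !mulA.
- by case=> a b /=; rewrite !mul1g.
- by case=> a b /=; rewrite !mulVg.
Defined.
Lemma prod_mulE (x y : prod_grp) : x * y = (fst x * fst y, snd x * snd y).
Proof. by []. Qed.
Lemma fst_hom : is_hom (fst : prod_grp -> G).
Proof. by []. Qed.
Lemma inl_hom : is_hom (fun x : G => (x, 1) : prod_grp).
Proof. by move=> x y; rewrite prod_mulE /= mulg1. Qed.
Lemma inr_hom : is_hom (fun x : H => (1, x) : prod_grp).
Proof. by move=> x y; rewrite prod_mulE /= mulg1. Qed.
Lemma npow_prod (x : prod_grp) n : npow x n = (npow (fst x) n, npow (snd x) n).
Proof. by elim: n => [|n IH] //=; rewrite IH prod_mulE. Qed.
Lemma prod_torsion_free : torsion_free G -> torsion_free H -> torsion_free prod_grp.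
Proof.
move=> tg th [x y] n hn; rewrite npow_prod /= => e.
by rewrite (tg x n hn (f_equal fst e)) (th y n hn (f_equal snd e)).
Qed.
End Prod.

Section Semidirect.
Variables (G : grp) (al : Z -> G -> G).
Hypothesis alh : forall k, is_hom (al k).
Hypothesis al0 : forall g, al 0 g = g.
Hypothesis alD : forall k l g, al (k + l) g = al k (al l g).
Definition sd : grp.
refine (@Grp (G * Z) (fun x y => (fst x * al (snd x) (fst y), (snd x + snd y)%Z)) (1, 0%Z)
  (fun x => (al (- snd x) (fst x)^-1, (- snd x)%Z)) _ _ _).
- by case=> a b [c d] [e f] /=; rewrite alh alD mulA Z.add_assoc.
- by case=> a b /=; rewrite al0 !mul1g.
- by case=> a b /=; rewrite -(alh (- b)) mulVg (hom1 (alh _)); congr (_, _); lia.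
Defined.
Lemma sd_mulE (x y : sd) : x * y = (fst x * al (snd x) (fst y), (snd x + snd y)%Z).
Proof. by []. Qed.
Lemma sd_oneE : (1 : sd) = (1, 0%Z).
Proof. by []. Qed.
Lemma sd_invE (x : sd) : x^-1 = (al (- snd x) (fst x)^-1, (- snd x)%Z).
Proof. by []. Qed.
Definition sdz : sd := (1, 1%Z).
Definition sdi (g : G) : sd := (g, 0%Z).
Lemma sdi_hom : is_hom sdi.
Proof. by move=> x y; rewrite sd_mulE /= al0. Qed.
Lemma sdz_pow k : gpow sdz k = (1, k).
Proof.
move: k; apply: Z.peano_ind => [|l IH|l IH] //.
- by rewrite -Z.add_1_r gpowS IH sd_mulE /= (hom1 (alh _)) mulg1.
- rewrite -Z.sub_1_r gpowP IH sd_invE sd_mulE /= invg1 !(hom1 (alh _)) mulg1.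
  by [].
Qed.
Lemma sd_split (x : sd) : x = sdi (fst x) * gpow sdz (snd x).
Proof. by case: x => g k; rewrite sdz_pow sd_mulE /= (hom1 (alh _)) mulg1. Qed.
Lemma sdz_conj k g : gpow sdz k * sdi g * (gpow sdz k)^-1 = sdi (al k g).
Proof.
rewrite -gpowN !sdz_pow !sd_mulE /= (hom1 (alh _)) mul1g mulg1 Z.add_0_r.
by rewrite Z.add_opp_diag_r.
Qed.
Lemma sd_torsion_free : torsion_free G -> torsion_free sd.
Proof.
move=> tf [g k] n hn e.
have e2 : forall m, snd (npow ((g, k) : sd) m) = (Z.of_nat m * k)%Z.
  by elim=> [|m IH] //; rewrite -[npow _ (S m)]/(((g, k) : sd) * npow ((g, k) : sd) m) sd_mulE /= IH; lia.
have k0 : k = 0%Z by have := e2 n; rewrite e /=; nia.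
subst k; move: e; rewrite -/(sdi g) -(homX sdi_hom) => -[e].
by rewrite (tf g n hn e).
Qed.
Lemma sd_ind (P : sd -> Prop) : subgroup P -> (forall g, P (sdi g)) -> P sdz -> forall x, P x.
Proof.
move=> sg h hz x; rewrite (sd_split x); apply: (sgM sg) => //; exact: gpow_sg.
Qed.

Variables (H : grp) (f : G -> H) (z : H).
Hypothesis fh : is_hom f.
Hypothesis fz : forall g, z * f g * z^-1 = f (al 1 g).
Lemma sd_lift_conj k g : gpow z k * f g = f (al k g) * gpow z k.
Proof.
move: k g; apply: (Z.peano_ind (fun k => forall g, _)) => [|l IH|l IH] g.
- by rewrite al0 gpow0; grp.
- rewrite -Z.add_1_r gpowS alD.
  have -> : gpow z l * z * f g = gpow z l * (z * f g * z^-1) * z by grp.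
  by rewrite fz IH; grp.
- rewrite -Z.sub_1_r gpowP.
  have -> : g = al 1 (al (-1) g) by rewrite -alD al0.
  rewrite -fz; have -> : gpow z l * z^-1 * (z * f (al (-1) g) * z^-1) = gpow z l * f (al (-1) g) * z^-1 by grp.
  have -> : al (l - 1) (al 1 (al (-1) g)) = al l (al (-1) g).
    by rewrite -alD; have -> : (l - 1 + 1 = l)%Z by lia.
  by rewrite IH mulA.
Qed.
Definition sd_lift (x : sd) : H := f (fst x) * gpow z (snd x).
Lemma sd_lift_hom : is_hom sd_lift.
Proof.
move=> [g k] [h l]; rewrite /sd_lift sd_mulE /= fh gpowD !mulA; congr (_ * _).
by rewrite -!mulA sd_lift_conj.
Qed.
Lemma sd_lift_i g : sd_lift (sdi g) = f g.
Proof. by rewrite /sd_lift /= gpow0 mulg1. Qed.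
Lemma sd_lift_z : sd_lift sdz = z.
Proof. by rewrite /sd_lift /= gpow1 (hom1 fh) mul1g. Qed.
End Semidirect.

(** * The tower of HNN extensions *)

Section Base.
Definition FZ := free Z.
Definition shiftZ (k : Z) : FZ -> FZ := free_lift (fun i => fx (i + k)%Z).
Lemma shiftZ_hom k : is_hom (shiftZ k).
Proof. exact: free_lift_hom. Qed.
Lemma shiftZ_fx k i : shiftZ k (fx i) = fx (i + k)%Z.
Proof. exact: free_lift_fx. Qed.
Lemma shiftZ0 g : shiftZ 0 g = g.
Proof.
move: g; apply: free_hom_eq; [exact: shiftZ_hom|exact: hom_id|move=> i].
by rewrite shiftZ_fx Z.add_0_r.
Qed.
Lemma shiftZD k l g : shiftZ (k + l) g = shiftZ k (shiftZ l g).
Proof.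
move: g; apply: free_hom_eq; [exact: shiftZ_hom|exact: hom_comp (shiftZ_hom _) (shiftZ_hom _)|move=> i].
by rewrite !shiftZ_fx; congr fx; lia.
Qed.
Definition V : grp := sd shiftZ_hom shiftZ0 shiftZD.

Inductive three := Gb | Gd | Gg.
Definition F3 := free three.
Notation fb := (fx Gb : F3).
Notation fd := (fx Gd : F3).
Notation fg := (fx Gg : F3).
(** The action of z^k: only d is conjugated by b^k, while b and g stay fixed, so that u_i goes to
    u_(i+k). *)
Definition shift3_gen (k : Z) (x : three) : F3 :=
  match x with Gb => fb | Gd => gpow fb k * fd * (gpow fb k)^-1 | Gg => fg end.
Definition shift3 (k : Z) : F3 -> F3 := free_lift (shift3_gen k).
Lemma shift3_hom k : is_hom (shift3 k).
Proof. exact: free_lift_hom. Qed.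
Lemma shift3_fx k x : shift3 k (fx x) = shift3_gen k x.
Proof. exact: free_lift_fx. Qed.
Lemma shift30 g : shift3 0 g = g.
Proof.
move: g; apply: free_hom_eq; [exact: shift3_hom|exact: hom_id|].
by case; rewrite shift3_fx /= ?gpow0; grp.
Qed.
Lemma shift3D k l g : shift3 (k + l) g = shift3 k (shift3 l g).
Proof.
move: g; apply: free_hom_eq; [exact: shift3_hom|exact: hom_comp (shift3_hom _) (shift3_hom _)|].
case; rewrite !shift3_fx /= ?shift3_fx //.
rewrite !shift3_hom (homV (shift3_hom _)) (hom_gpow _ _ (shift3_hom _)) !shift3_fx /= Z.add_comm gpowD.
by grp.
Qed.
Definition B : grp := sd shift3_hom shift30 shift3D.

Definition comu (G : grp) (b d g : G) (i : Z) : G :=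
  (gpow b i * d * (gpow b i)^-1) * g * (gpow b i * d * (gpow b i)^-1)^-1 * g^-1.
Definition u_elt (i : Z) : F3 := comu fb fd fg i.
Lemma shift3_u_elt k i : shift3 k (u_elt i) = u_elt (i + k).
Proof.
rewrite /u_elt /comu !shift3_hom !(homV (shift3_hom _)) !shift3_hom !(homV (shift3_hom _)).
rewrite !(hom_gpow _ _ (shift3_hom _)) !shift3_fx /= gpowD; by grp.
Qed.
Definition u_hom : FZ -> F3 := free_lift u_elt.
Lemma u_hom_hom : is_hom u_hom.
Proof. exact: free_lift_hom. Qed.
Lemma u_hom_fx i : u_hom (fx i) = u_elt i.
Proof. exact: free_lift_fx. Qed.
Lemma u_hom_shift k w : u_hom (shiftZ k w) = shift3 k (u_hom w).
Proof.
move: w; apply: free_hom_eq; [exact: hom_comp (shiftZ_hom _) u_hom_hom|exact: hom_comp u_hom_hom (shift3_hom _)|move=> i].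
by rewrite shiftZ_fx !u_hom_fx shift3_u_elt.
Qed.

(* F3 acts on two copies of FZ: d multiplies the first copy by x_0, b shifts, g swaps the copies;
   then u_i multiplies the first copy by x_i. *)
Definition FZ2 := sym_grp (FZ * bool).
Definition perm_d : FZ2.
refine (@Perm (FZ * bool) (fun p => if snd p then p else (fx 0%Z * fst p, false))
  (fun p => if snd p then p else ((fx 0%Z)^-1 * fst p, false)) _ _).
- by case=> w [] //=; grp.
- by case=> w [] //=; grp.
Defined.
Definition perm_b : FZ2.
refine (@Perm (FZ * bool) (fun p => (shiftZ 1 (fst p), snd p)) (fun p => (shiftZ (-1) (fst p), snd p)) _ _).
- by case=> w t /=; rewrite -shiftZD shiftZ0.
- by case=> w t /=; rewrite -shiftZD shiftZ0.
Defined.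
Definition perm_g : FZ2.
refine (@Perm (FZ * bool) (fun p => (fst p, negb (snd p))) (fun p => (fst p, negb (snd p))) _ _).
- by case=> w [].
- by case=> w [].
Defined.
Definition act3 : F3 -> FZ2 := free_lift (fun x => match x with Gb => perm_b | Gd => perm_d | Gg => perm_g end).
Lemma act3_hom : is_hom act3.
Proof. exact: free_lift_hom. Qed.
Lemma sym_mulE (X : Type) (p q : sym_grp X) x : pf (p * q) x = pf p (pf q x).
Proof. by []. Qed.
Lemma sym_invE (X : Type) (p : sym_grp X) x : pf (p^-1) x = pb p x.
Proof. by []. Qed.
Lemma perm_b_pow k w t : pf (gpow perm_b k) (w, t) = (shiftZ k w, t).
Proof.
move: k w t; apply: (Z.peano_ind (fun k => forall w t, _)) => [|l IH|l IH] w t.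
- by rewrite shiftZ0.
- by rewrite -Z.add_1_r gpowS sym_mulE /= IH -shiftZD.
- by rewrite -Z.sub_1_r gpowP sym_mulE sym_invE /= IH -shiftZD.
Qed.
Lemma act3_fx x : act3 (fx x) = match x with Gb => perm_b | Gd => perm_d | Gg => perm_g end.
Proof. exact: free_lift_fx. Qed.
Lemma act3_u_elt i w : pf (act3 (u_elt i)) (w, false) = (fx i * w, false).
Proof.
rewrite /u_elt /comu !act3_hom !(homV act3_hom) !act3_hom !(homV act3_hom) !(hom_gpow _ _ act3_hom) !act3_fx.
have pgE : forall v t, pf perm_g (v, t) = (v, negb t) by [].
have pgVE : forall v t, pb perm_g (v, t) = (v, negb t) by [].
have pdVE : forall v, pb perm_d (v, true) = (v, true) by [].
have pdE : forall v, pf perm_d (v, false) = (fx 0%Z * v, false) by [].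
rewrite !invMg -!gpowN Z.opp_involutive !sym_mulE !sym_invE pgVE perm_b_pow pdVE perm_b_pow pgE perm_b_pow pdE perm_b_pow.
have sK : forall v, shiftZ i (shiftZ (- i) v) = v.
  by move=> v; rewrite -shiftZD Z.add_opp_diag_r shiftZ0.
by rewrite shiftZ_hom shiftZ_fx !sK Z.add_0_l.
Qed.
Lemma act3_u_hom w v : pf (act3 (u_hom w)) (v, false) = (w * v, false).
Proof.
move: w v; apply: free_ind.
  split.
  - by move=> v; rewrite (hom1 u_hom_hom) (hom1 act3_hom) mul1g.
  - by move=> x y IH1 IH2 v; rewrite u_hom_hom act3_hom sym_mulE IH2 IH1 mulA.
  - move=> x IH v; rewrite (homV u_hom_hom) (homV act3_hom) sym_invE.
    by rewrite -{1}(mulKVg x v) -IH pfK.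
by move=> i v; rewrite u_hom_fx act3_u_elt.
Qed.
Lemma u_hom_inj w v : u_hom w = u_hom v -> w = v.
Proof.
move=> e; have : pf (act3 (u_hom w)) (1, false) = pf (act3 (u_hom v)) (1, false) by rewrite e.
by rewrite !act3_u_hom !mulg1 => -[].
Qed.

Definition incV (v : V) : B := (u_hom (fst v), snd v).
Lemma incV_hom : is_hom incV.
Proof. by move=> x y; rewrite /incV !sd_mulE /= u_hom_hom u_hom_shift. Qed.
Lemma incV_inj v : incV v = 1 -> v = 1.
Proof.
case: v => w k h; rewrite sd_oneE.
have e : u_hom w = 1 := f_equal fst h; have -> : k = 0%Z := f_equal snd h; congr (_, _).
by apply: u_hom_inj; rewrite e (hom1 u_hom_hom).
Qed.

Definition relab (m j : Z) : FZ -> FZ := free_lift (fun i => fx (m * i + j)%Z).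
Lemma relab_hom m j : is_hom (relab m j).
Proof. exact: free_lift_hom. Qed.
Lemma relab_fx m j i : relab m j (fx i) = fx (m * i + j)%Z.
Proof. exact: free_lift_fx. Qed.
Lemma relab_shift m j k w : relab m j (shiftZ k w) = shiftZ (m * k) (relab m j w).
Proof.
move: w; apply: free_hom_eq; [exact: hom_comp (shiftZ_hom _) (relab_hom _ _)|exact: hom_comp (relab_hom _ _) (shiftZ_hom _)|move=> i].
by rewrite shiftZ_fx !relab_fx shiftZ_fx; congr fx; lia.
Qed.
Definition iota (m j : Z) (v : V) : V := (relab m j (fst v), (m * snd v)%Z).
Lemma iota_hom m j : is_hom (iota m j).
Proof.
move=> x y; rewrite /iota !sd_mulE /= relab_hom relab_shift; congr (_, _); lia.
Qed.
(* Sends x_(mi+j) to x_(m'i+j') and kills the other letters. *)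
Definition transfer (m j m' j' : Z) : FZ -> FZ :=
  free_lift (fun i => if dec (((i - j) mod m)%Z = 0%Z) then fx (m' * ((i - j) / m) + j')%Z else 1).
Lemma transfer_hom m j m' j' : is_hom (transfer m j m' j').
Proof. exact: free_lift_hom. Qed.
Lemma transfer_relab m j m' j' w : m <> 0%Z -> transfer m j m' j' (relab m j w) = relab m' j' w.
Proof.
move=> m0; move: w; apply: free_hom_eq; [exact: hom_comp (relab_hom _ _) (transfer_hom _ _ _ _)|exact: relab_hom|move=> i].
rewrite !relab_fx /transfer free_lift_fx.
have -> : (m * i + j - j = i * m)%Z by lia.
by rewrite Z.mod_mul // Z.div_mul //; case: (dec _).
Qed.
Lemma iota_inj m j v : m <> 0%Z -> iota m j v = 1 -> v = 1.
Proof.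
case: v => w k m0 h; rewrite sd_oneE.
have e : relab m j w = 1 := f_equal fst h; have e' : (m * k = 0)%Z := f_equal snd h.
have -> : k = 0%Z by nia.
congr (_, _).
have <- : relab 1 0 w = w.
  move: {e h} w; apply: free_hom_eq; [exact: relab_hom|exact: hom_id|move=> i].
  by rewrite relab_fx; congr fx; lia.
by rewrite -(@transfer_relab m j 1 0 w m0) e (hom1 (transfer_hom _ _ _ _)).
Qed.
Definition inF (f : F3) : B := (f, 0%Z).
Definition zB : B := (1, 1%Z).
Lemma inF_hom : is_hom inF.
Proof. exact: sdi_hom. Qed.
Lemma zB_pow k : gpow zB k = (1, k).
Proof. exact: sdz_pow. Qed.
Lemma zB_conj k f : gpow zB k * inF f * (gpow zB k)^-1 = inF (shift3 k f).
Proof. exact: sdz_conj. Qed.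
Lemma B_torsion_free : torsion_free B.
Proof. apply: sd_torsion_free; exact: free_torsion_free. Qed.
End Base.

(** * The groups attached to a rule system *)

Section Machine.
Variables (rl : nat -> rule) (tg : list Z) (q0 Q : Z) (a : nat).
Hypothesis rlwf : forall k, wf_rule (rl k).

Local Notation eqv := (eqv_of rl).
Local Notation halts := (halts_of rl tg).
Definition start_class i := exists x, eqv i (Q * x + q0)%Z.

(** It matches z^m with z^m' and u_(m i + j) with u_(m' i + j'). Both sides are embedded copies of
    [V], which is why m and m' must be nonzero. *)
Definition piso_rule (r : rule) (w : wf_rule r) : piso B.
refine (@Piso B (let '(m, j, m', j') := r in
  fun g h => exists v, g = incV (iota m j v) /\ h = incV (iota m' j' v)) _ _ _ _ _);
  move: r w => [[[m j] m'] j'] [m0 m0'].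
- by exists 1; rewrite !(hom1 (iota_hom _ _)) (hom1 incV_hom).
- move=> g h g' h' [v [-> ->]] [v' [-> ->]]; exists (v * v'); by rewrite !iota_hom !incV_hom.
- by move=> g h [v [-> ->]]; exists v^-1; rewrite !(homV (iota_hom _ _)) !(homV incV_hom).
- move=> h [v [e ->]].
  have -> : v = 1 by apply: (@iota_inj m j); [lia|exact: incV_inj].
  by rewrite (hom1 (iota_hom _ _)) (hom1 incV_hom).
- move=> h [v [-> e]].
  have -> : v = 1 by apply: (@iota_inj m' j'); [lia|exact: incV_inj].
  by rewrite (hom1 (iota_hom _ _)) (hom1 incV_hom).
Defined.

Lemma piso_ruleE m j m' j' (w : wf_rule (m, j, m', j')) g h :
  piso_rule w g h <-> exists v, g = incV (iota m j v) /\ h = incV (iota m' j' v).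
Proof. by []. Qed.

Definition Na : F3 -> Prop := gen (fun f => exists x, f = npow (u_elt (Q * x + q0)) a).
(** The domain of the stable letter with index 0, generated by the a-th powers at all start values
    and z^Q. The letter acts on it as z^Q does; admitting only a-th powers keeps the u_i themselves
    out of [L]. *)
Definition GEN (g : B) := Na (fst g) /\ exists k, snd g = (Q * k)%Z.
Lemma Na_shift k f : Na f -> Na (shift3 (Q * k) f).
Proof.
move: f; apply: gen_min; first exact: (sub_sg_pre (shift3_hom _) (gen_sg _)).
move=> f [x ->]; rewrite (homX (shift3_hom _)) shift3_u_elt; apply: gen_in.
exists (x + k)%Z; congr (npow (u_elt _) _); lia.
Qed.
Lemma GEN_sg : subgroup GEN.
Proof.
split.
- split; first exact: gen1. exists 0%Z => /=; lia.
- move=> [f k] [g l] [h1 [k1 /= e1]] [h2 [k2 /= e2]]; subst; split.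
    rewrite sd_mulE /=; apply: genM => //; exact: Na_shift.
  exists (k1 + k2)%Z => /=; lia.
- move=> [f k] [h1 [k1 /= e1]]; subst; split; rewrite sd_invE /=.
    have -> : (- (Q * k1) = Q * - k1)%Z by lia.
    by apply: Na_shift; exact: genV.
  exists (- k1)%Z; lia.
Qed.
Definition piso_conj (G : grp) (S : G -> Prop) (c : G) (sg : subgroup S) : piso G.
refine (@Piso G (fun g h => S g /\ h = c * g * c^-1) _ _ _ _ _).
- by split; [exact: (sg1 sg)|grp].
- by move=> g h g' h' [s ->] [s' ->]; split; [exact: (sgM sg)|grp].
- by move=> g h [s ->]; split; [exact: (sgV sg)|grp].
- by move=> h [_ ->]; grp.
- move=> g [_ e]; have -> : g = c^-1 * (c * g * c^-1) * c by grp.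
  by rewrite -e; grp.
Defined.
(** The start letter takes index 0, hence the shift that recurs below: rule [k] has the stable
    letter [S k], which becomes generator [10 + k]. *)
Definition RK (k : nat) : piso B :=
  match k with O => piso_conj (gpow zB Q) GEN_sg | S k => piso_rule (rlwf k) end.
Definition K : grp := hnn RK.
Definition inK (f : F3) : K := hin RK (inF f).
Lemma inK_hom : is_hom inK.
Proof. exact: (hom_comp inF_hom (@hin_hom _ _ RK)). Qed.
Definition Lgens (x : K) := (exists t, In t tg /\ x = inK (u_elt t)) \/ x = inK (npow (u_elt q0) a) \/ exists k, x = hlet RK k.
Definition L : K -> Prop := gen Lgens.

(** The intended value of the intersection of [L] with F3. [N0Z] is its counterpart in the free
    group on the x_i, where indices can be moved by homomorphisms. *)
Definition N0 : F3 -> Prop := gen (fun f => (exists i, halts i /\ f = u_elt i) \/ exists i, start_class i /\ f = npow (u_elt i) a).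
Definition N0Z : FZ -> Prop := gen (fun f => (exists i, halts i /\ f = fx i) \/ exists i, start_class i /\ f = npow (fx i) a).
Lemma N0_u_hom f : N0 f -> exists w, N0Z w /\ f = u_hom w.
Proof.
move: f; apply: gen_min.
  split.
  - exists 1; split; [exact: gen1|by rewrite (hom1 u_hom_hom)].
  - by move=> x y [w [h ->]] [v [k ->]]; exists (w * v); split; [exact: genM|rewrite u_hom_hom].
  - by move=> x [w [h ->]]; exists w^-1; split; [exact: genV|rewrite (homV u_hom_hom)].
move=> f [[i [h ->]]|[i [h ->]]].
- exists (fx i); split; last by rewrite u_hom_fx.
  by apply: gen_in; left; exists i.
- exists (npow (fx i) a); split; last by rewrite (homX u_hom_hom) u_hom_fx.
  by apply: gen_in; right; exists i.
Qed.
Lemma u_hom_N0 w : N0Z w -> N0 (u_hom w).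
Proof.
move: w; apply: gen_min; first exact: (sub_sg_pre u_hom_hom (gen_sg _)).
move=> f [[i [h ->]]|[i [h ->]]].
- by rewrite u_hom_fx; apply: gen_in; left; exists i.
- by rewrite (homX u_hom_hom) u_hom_fx; apply: gen_in; right; exists i.
Qed.
(** An element of [N0Z] in the image of [relab] may be written with generators outside the
    progression. As [transfer] is defined on all of [FZ] and kills those letters, it can be applied
    factor by factor; the other indices move within their class. *)
Lemma N0Z_transfer m j m' j' w : m <> 0%Z ->
  (forall u, eqv (m * u + j) (m' * u + j'))%Z -> N0Z (relab m j w) -> N0Z (relab m' j' w).
Proof.
move=> m0 he h; rewrite -(@transfer_relab m j m' j' w m0).
move: h; move: (relab m j w); apply: gen_min; first exact: (sub_sg_pre (transfer_hom _ _ _ _) (gen_sg _)).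
have key : forall i, transfer m j m' j' (fx i) = 1 \/ exists i', eqv i i' /\ transfer m j m' j' (fx i) = fx i'.
  move=> i; rewrite /transfer free_lift_fx; case: (dec _) => e; last by left.
  right; exists (m' * ((i - j) / m) + j')%Z; split=> //.
  have {1}-> : (i = m * ((i - j) / m) + j)%Z by have := Z.div_mod (i - j) m m0; lia.
  exact: he.
move=> f [[i [h ->]]|[i [h ->]]].
- case: (key i) => [->|[i' [e ->]]]; first exact: gen1.
  apply: gen_in; left; exists i'; split=> //; case: h => t [ht et].
  exists t; split=> //; apply: rst_trans et; exact: rst_sym.
- rewrite (homX (transfer_hom _ _ _ _)); case: (key i) => [->|[i' [e ->]]].
    by rewrite npow1; exact: gen1.
  apply: gen_in; right; exists i'; split=> //; case: h => t ht.
  exists t; apply: rst_trans ht; exact: rst_sym.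
Qed.
Definition MB (g : B) := snd g = 0%Z /\ N0 (fst g).
Lemma MB_sg : subgroup MB.
Proof.
split.
- by split=> //; exact: gen1.
- move=> [f k] [g l] [/= -> h1] [/= -> h2]; split; rewrite sd_mulE //= shift30; exact: genM.
- move=> [f k] [/= -> h1]; split; rewrite sd_invE //= shift30; exact: genV.
Qed.
Lemma Na_N0 f : Na f -> N0 f.
Proof.
move: f; apply: gen_min; first exact: gen_sg.
move=> f [x ->]; apply: gen_in; right; exists (Q * x + q0)%Z; split=> //; exists x; exact: rst_refl.
Qed.
Lemma MB_rule m j m' j' v : m <> 0%Z -> m' <> 0%Z -> (forall u, eqv (m * u + j) (m' * u + j'))%Z ->
  MB (incV (iota m j v)) -> MB (incV (iota m' j' v)).
Proof.
case: v => w k m0 m0' he [/= e h].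
have k0 : k = 0%Z by nia.
subst k; split=> /=; first by lia.
apply: u_hom_N0; apply: (N0Z_transfer m0 he).
by have [w' [h' /u_hom_inj ->]] := N0_u_hom h.
Qed.
Lemma eqv_rule k : let '(m, j, m', j') := rl k in forall u, eqv (m * u + j) (m' * u + j')%Z.
Proof.
case e : (rl k) => [[[m j] m'] j'] u; apply: rst_step; exists k; rewrite e; by exists u.
Qed.
(** Letter 0 meets [MB] only in [Na], because the z-exponent vanishes there, and [Na] is invariant
    under the shift by Q. The other letters are handled by [N0Z_transfer], in either direction. *)
Lemma MB_inv l g h : lrel RK l g h -> MB g -> MB h.
Proof.
case: l => -[|k] b.
  have conjQ : forall x, Na x -> Na (shift3 Q x).
    by move=> x hx; have := Na_shift 1 hx; rewrite Z.mul_1_r.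
  case: b => /= -[hs ->].
  - case: g hs => f k [/= h1 _] [/= k0 _]; subst k.
    rewrite zB_conj; split=> //=; apply: Na_N0; exact: conjQ.
  - case: h hs => f k [/= h1 [k' e']] [e _].
    have k0 : k = 0%Z.
      by move: e; rewrite -gpowN !zB_pow !sd_mulE /=; lia.
    subst k; split=> //=; exact: Na_N0.
have := eqv_rule k; rewrite /lrel /=; move: (rlwf k); case: (rl k) => [[[m j] m'] j'] [m0 m0'] he.
have he' : forall u, eqv (m' * u + j') (m * u + j)%Z by move=> u; apply: rst_sym; exact: he.
have m1 : m <> 0%Z by lia.
have m2 : m' <> 0%Z by lia.
case: b => /= r.
- have [v [-> ->]] := proj1 (piso_ruleE (conj m0 m0') g h) r; exact: (MB_rule m1 m2 he).
- have [v [-> ->]] := proj1 (piso_ruleE (conj m0 m0') h g) r; exact: (MB_rule m2 m1 he').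
Qed.
(** [MB] is closed under all stable letters, so the subgroup generated by [MB] and these letters
    meets [B] in [MB]; it contains [L]. *)
Lemma L_inter f : L (inK f) -> N0 f.
Proof.
move=> h; suff : MB (inF f) by case.
apply: (@hnn_sub_inter B nat RK MB MB_sg MB_inv (inK f)) => //.
move: h; apply: gen_min; first exact: gen_sg.
have zN : forall f, N0 f -> gen (fun y : K => (exists g, MB g /\ y = hin RK g) \/ exists i, y = hlet RK i) (inK f).
  by move=> f' h; apply: gen_in; left; exists (inF f').
move=> x [[t [ht ->]]|[->|[k ->]]].
- apply: zN; apply: gen_in; left; exists t; split=> //; exists t; split=> //; exact: rst_refl.
- apply: zN; apply: gen_in; right; exists q0; split=> //; exists 0%Z.
  have -> : (Q * 0 + q0 = q0)%Z by lia.
  exact: rst_refl.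
- by apply: gen_in; right; exists k.
Qed.

Lemma K_rule k m j m' j' u : rl k = (m, j, m', j') ->
  hlet RK (S k) * inK (u_elt (m * u + j)) * (hlet RK (S k))^-1 = inK (u_elt (m' * u + j')).
Proof.
move=> e; apply: hnn_rel => /=; move: (rlwf k); rewrite e => w.
apply/(piso_ruleE w); pose v := ((fx u, 0%Z) : V); exists v.
by split; rewrite /incV /iota /= relab_fx u_hom_fx Z.mul_0_r.
Qed.
Lemma K_zrule k m j m' j' : rl k = (m, j, m', j') ->
  hlet RK (S k) * hin RK (gpow zB m) * (hlet RK (S k))^-1 = hin RK (gpow zB m').
Proof.
move=> e; apply: hnn_rel => /=; move: (rlwf k); rewrite e => w.
apply/(piso_ruleE w); pose v := ((1, 1%Z) : V); exists v.
by split; rewrite /incV /iota /= zB_pow (hom1 (relab_hom _ _)) (hom1 u_hom_hom) Z.mul_1_r.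
Qed.
Lemma K_start x : hlet RK 0 * inK (npow (u_elt (Q * x + q0)) a) * (hlet RK 0)^-1 = inK (npow (u_elt (Q * (x + 1) + q0)) a).
Proof.
apply: hnn_rel => /=; split.
  split; last by exists 0%Z => /=; lia.
  by apply: gen_in; exists x.
rewrite zB_conj (homX (shift3_hom _)) shift3_u_elt; congr (inF (npow (u_elt _) _)); lia.
Qed.
Lemma K_zstart : hlet RK 0 * hin RK (gpow zB Q) * (hlet RK 0)^-1 = hin RK (gpow zB Q).
Proof.
apply: hnn_rel => /=; split; last by grp.
rewrite zB_pow; split => /=; first exact: gen1.
by exists 1%Z; lia.
Qed.
Lemma L_sg : subgroup L.
Proof. exact: gen_sg. Qed.
Lemma L_let k : L (hlet RK k).
Proof. by apply: gen_in; right; right; exists k. Qed.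
Lemma L_conj k x y : hlet RK k * x * (hlet RK k)^-1 = y -> (L x <-> L y).
Proof.
move=> <-; split=> h.
  apply: (sgM L_sg); last exact: (sgV L_sg (L_let k)).
  by apply: (sgM L_sg) => //; exact: L_let.
have -> : x = (hlet RK k)^-1 * (hlet RK k * x * (hlet RK k)^-1) * hlet RK k by grp.
apply: (sgM L_sg); last exact: L_let.
by apply: (sgM L_sg) => //; exact: (sgV L_sg (L_let k)).
Qed.
Lemma L_eqv i i' e : eqv i i' -> (L (inK (npow (u_elt i) e)) <-> L (inK (npow (u_elt i') e))).
Proof.
elim=> {i i'} [i i' [k]|i|i i' _ [h1 h2]|i i' i'' _ h _ h']; [|by []|by split|by rewrite h].
case er : (rl k) => [[[m j] m'] j'] [u [-> ->]].
by apply: (@L_conj (S k)); rewrite !(homX inK_hom) -npow_conj (K_rule _ er).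
Qed.
Lemma L_halts i : halts i -> L (inK (u_elt i)).
Proof.
case=> t [ht e]; have := L_eqv 1 e; rewrite /= !mulg1 => h; apply/h.
by apply: gen_in; left; exists t.
Qed.
Lemma L_start i : start_class i -> L (inK (npow (u_elt i) a)).
Proof.
case=> x e; apply/(L_eqv a e); move: x {e}.
have step := fun x => L_conj (K_start x).
apply: Z.peano_ind => [|x IH|x IH].
- rewrite Z.mul_0_r Z.add_0_l; by apply: gen_in; right; left.
- by rewrite -Z.add_1_r; exact: (proj1 (step x) IH).
- by apply: (proj2 (step _)); have -> : (Z.pred x + 1 = x)%Z by lia.
Qed.
Lemma K_torsion_free : torsion_free K.
Proof. apply: hnn_torsion_free; exact: B_torsion_free. Qed.

Definition RX (_ : unit) : piso K := piso_conj 1 L_sg.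
Definition X : grp := hnn RX.
Definition yX : X := hlet RX tt.
Definition iX (x : K) : X := hin RX x.
Lemma iX_hom : is_hom iX.
Proof. exact: hin_hom. Qed.
Lemma X_y x : L x -> comm yX (iX x).
Proof. by move=> h; apply: conj_comm; apply: hnn_rel; split=> //; grp. Qed.
Lemma X_torsion_free : torsion_free X.
Proof. apply: hnn_torsion_free; exact: K_torsion_free. Qed.
Definition iF (f : F3) : X := iX (inK f).
Lemma iF_hom : is_hom iF.
Proof. exact: (hom_comp inK_hom iX_hom). Qed.

(** [Y] is the subgroup of [X] generated by F3 and y, rebuilt as an HNN extension of F3 over L ∩ F3.
    In this form, homomorphisms out of it can be defined by the universal property. *)
Definition RY (_ : unit) : piso F3 := piso_conj 1 (sub_sg_pre inK_hom L_sg).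
Definition Y : grp := hnn RY.
Definition YX : Y -> X := @hnn_map _ _ _ RY RX inK.
Lemma YX_rel (i : unit) g h : RY i g h -> RX i (inK g) (inK h).
Proof. by case=> l ->; split=> //; rewrite !inK_hom (homV inK_hom) (hom1 inK_hom). Qed.
Lemma YX_hom : is_hom YX.
Proof. exact: (hnn_map_hom inK_hom YX_rel). Qed.
Lemma YX_in f : YX (hin RY f) = iF f.
Proof. exact: hnn_map_in. Qed.
Lemma YX_let : YX (hlet RY tt) = yX.
Proof. exact: (hnn_map_let inK_hom YX_rel). Qed.
Lemma inK_inj f : inK f = 1 -> f = 1.
Proof.
rewrite -(hom1 (@hin_hom _ _ RK)) => /hin_inj e.
exact: (f_equal fst e).
Qed.
Lemma YX_inj y : YX y = 1 -> y = 1.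
Proof.
apply: (hnn_map_inj inK_hom inK_inj YX_rel).
case=> [] [] [] g [h] /=.
- by case=> l _; exists g; split=> //; grp.
- move=> [l e]; exists g; split; last by grp.
  by rewrite e; move: l; grp.
Qed.

(** * The last stable letter s, over a homomorphism [psi] on F3 *)

Section Psi.
Variables (A2 : grp) (psi : F3 -> A2).
Hypothesis psih : is_hom psi.
Hypothesis psi_halts : forall i, halts i -> psi (u_elt i) = 1.
Hypothesis psi_start : forall i, start_class i -> npow (psi (u_elt i)) a = 1.
Lemma psi_N0 f : N0 f -> psi f = 1.
Proof.
move: f; apply: gen_min; first exact: (sub_sg_ker psih).
move=> f [[i [h ->]]|[i [h ->]]]; first exact: psi_halts.
by rewrite (homX psih); exact: psi_start.
Qed.
Lemma psi_L f : L (inK f) -> psi f = 1.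
Proof. by move=> h; apply: psi_N0; exact: L_inter. Qed.

Definition XA := prod_grp X A2.
Definition Dgens (p : XA) := (exists f, p = (iF f, psi f)) \/ exists f, p = (yX * iF f * yX^-1, 1).
Definition Delta : XA -> Prop := gen Dgens.

(* Y acts on two copies of A2, f by multiplication by psi f on the first one and y by swapping them. *)
Definition AB := sym_grp (A2 * bool).
Definition lperm (x : A2) : AB.
refine (@Perm (A2 * bool) (fun p => if snd p then p else (x * fst p, false))
  (fun p => if snd p then p else (x^-1 * fst p, false)) _ _).
- by case=> w [] //=; grp.
- by case=> w [] //=; grp.
Defined.
Definition swp : AB.
refine (@Perm (A2 * bool) (fun p => (fst p, negb (snd p))) (fun p => (fst p, negb (snd p))) _ _).
- by case=> w [].
- by case=> w [].
Defined.
Lemma lperm_hom : is_hom lperm.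
Proof. by move=> x y; apply: perm_eq => -[w []]; rewrite sym_mulE //= mulA. Qed.
Definition actY : Y -> AB := hnn_lift (fun f => lperm (psi f)) (fun _ : unit => swp).
(** The swap is not central, yet y must commute with L ∩ F3; this is consistent because [psi] is
    trivial there. *)
Lemma actY_rel (i : unit) g h : RY i g h -> swp * lperm (psi g) * swp^-1 = lperm (psi h).
Proof.
case=> l ->; have -> : (1 : F3) * g * 1^-1 = g by grp.
by rewrite (psi_L l) (hom1 lperm_hom); grp.
Qed.
Lemma actY_hom : is_hom actY.
Proof. exact: (hnn_lift_hom (hom_comp psih lperm_hom) actY_rel). Qed.
Lemma actY_in f : actY (hin RY f) = lperm (psi f).
Proof. exact: (hnn_lift_in RY (fun f => lperm (psi f)) (fun _ : unit => swp)). Qed.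
Lemma actY_let : actY (hlet RY tt) = swp.
Proof. exact: (hnn_lift_let (hom_comp psih lperm_hom) actY_rel). Qed.

(** Conjugated by the swap, y f y^-1 moves only the second copy, whereas f acts on the first copy as
    psi f. Since [Y] embeds in [X], the first component of an element of [Delta] determines its
    second one. *)
Lemma Delta_act p : Delta p -> exists y, YX y = fst p /\ forall x, pf (actY y) (x, false) = (snd p * x, false).
Proof.
move: p; apply: gen_min.
  split.
  - exists 1; split; first exact: (hom1 YX_hom).
    by move=> x; rewrite (hom1 actY_hom); cbn [fst snd]; rewrite mul1g.
  - move=> p q [y [e1 e2]] [y' [e1' e2']]; exists (y * y'); split; first by rewrite YX_hom e1 e1'.
    by move=> x; rewrite actY_hom sym_mulE e2' e2 mulA.
  - move=> p [y [e1 e2]]; exists y^-1; split; first by rewrite (homV YX_hom) e1.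
    move=> x; rewrite (homV actY_hom) sym_invE.
    by rewrite -{1}(mulKVg (snd p) x) -e2 pfK.
move=> p [[f ->]|[f ->]]; cbn [fst snd].
- by exists (hin RY f); split; [exact: YX_in|move=> x; rewrite actY_in].
- exists (hlet RY tt * hin RY f * (hlet RY tt)^-1); split.
    by rewrite !YX_hom (homV YX_hom) YX_in YX_let.
  move=> x; rewrite !actY_hom (homV actY_hom) actY_in actY_let !sym_mulE sym_invE /=; by grp.
Qed.
Lemma Delta_fun z : Delta (1, z) -> z = 1.
Proof.
move=> /Delta_act [y [e1 e]].
have := e 1; rewrite (YX_inj e1) (hom1 actY_hom) mulg1 => h.
by have := f_equal fst h.
Qed.
Definition piso_D : piso XA.
refine (@Piso XA (fun g h => g = (fst h, 1) /\ Delta h) _ _ _ _ _).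
- by split=> //; exact: gen1.
- move=> g h g' h' [-> d] [-> d']; split; last exact: genM.
  by rewrite prod_mulE /= mulg1.
- move=> g h [-> d]; split; last exact: genV.
  by rewrite -[_^-1]/(((fst h)^-1, 1^-1) : XA) invg1.
- move=> [x z] [e d]; move: d; have -> : x = 1 := eq_sym (f_equal fst e).
  by move=> /Delta_fun ->.
- by move=> g [-> _].
Defined.
Definition RG (_ : unit) : piso XA := piso_D.
Definition Gam : grp := hnn RG.
Definition sG : Gam := hlet RG tt.
Definition jX (x : X) : Gam := hin RG ((x, 1) : XA).
Definition jA (z : A2) : Gam := hin RG ((1, z) : XA).
Lemma jX_hom : is_hom jX.
Proof. exact: (hom_comp (@inl_hom X A2) (@hin_hom _ _ RG)). Qed.
Lemma jA_hom : is_hom jA.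
Proof. exact: (hom_comp (@inr_hom X A2) (@hin_hom _ _ RG)). Qed.
Lemma jXA_comm x z : comm (jX x) (jA z).
Proof. by rewrite /comm /jX /jA -!(@hin_hom _ _ RG) !prod_mulE /=; grp. Qed.
Lemma jA_inj z : jA z = 1 -> z = 1.
Proof. by rewrite -(hom1 (@hin_hom _ _ RG)) => /hin_inj e; exact: (f_equal snd e). Qed.
Lemma sG_F f : sG * jX (iF f) * sG^-1 = jX (iF f) * jA (psi f).
Proof.
rewrite /jX /jA -(@hin_hom _ _ RG) prod_mulE /= mulg1 mul1g.
by apply: hnn_rel; split=> //; apply: gen_in; left; exists f.
Qed.
Lemma sG_yF f : sG * jX (yX * iF f * yX^-1) * sG^-1 = jX (yX * iF f * yX^-1).
Proof. by apply: hnn_rel; split=> //; apply: gen_in; right; exists f. Qed.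
Lemma Gam_torsion_free : torsion_free A2 -> torsion_free Gam.
Proof. by move=> tf; apply: hnn_torsion_free; apply: prod_torsion_free => //; exact: X_torsion_free. Qed.
End Psi.

(** * The defining relations and their consequences in an arbitrary group *)

Variable nr : nat.
Hypothesis rl_default : forall k, nr <= k -> rl k = (1, 0, 1, 0)%Z.

(** The form z^i [d, g] z^-i of u_i, equal to the commutator of b^i d b^-i with g by the relations
    for z; it makes shifts by powers of z immediate. *)
Definition u_in (H : grp) (y : nat -> H) (i : Z) : H :=
  gpow (y 3) i * (y 1%nat * y 2 * (y 1%nat)^-1 * (y 2)^-1) * (gpow (y 3) i)^-1.

(* The letters 0..8 stand for b, d, g, z, y, s and the copies of b, d, g; letter 9 + k is r_k. *)
Record Rels (H : grp) (y : nat -> H) : Prop := {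
  R_zd : y 3 * y 1%nat * (y 3)^-1 = y 0 * y 1%nat * (y 0)^-1;
  R_zb : comm (y 3) (y 0);
  R_zg : comm (y 3) (y 2);
  R_rz : forall k, k < nr -> let '(m, j, m', j') := rl k in
    y (10 + k) * gpow (y 3) m * (y (10 + k))^-1 = gpow (y 3) m';
  R_ru : forall k, k < nr -> let '(m, j, m', j') := rl k in
    y (10 + k) * u_in y j * (y (10 + k))^-1 = u_in y j';
  R_0z : y 9 * gpow (y 3) Q * (y 9)^-1 = gpow (y 3) Q;
  R_0u : y 9 * npow (u_in y q0) a * (y 9)^-1 = npow (u_in y (q0 + Q)) a;
  R_yt : forall t, In t tg -> comm (y 4) (u_in y t);
  R_ya : comm (y 4) (npow (u_in y q0) a);
  R_yr : forall k, k <= nr -> comm (y 4) (y (9 + k));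
  R_bar : forall i j, i < 5 \/ 9 <= i < 10 + nr -> 6 <= j < 9 -> comm (y i) (y j);
  R_s : forall i, i < 3 -> y 5 * y i * (y 5)^-1 = y i * y (6 + i);
  R_sy : forall i, i < 3 -> y 5 * (y 4 * y i * (y 4)^-1) * (y 5)^-1 = y 4 * y i * (y 4)^-1 }.

Lemma hom_comu (G H : grp) (f : G -> H) b d g i : is_hom f -> f (comu b d g i) = comu (f b) (f d) (f g) i.
Proof. by move=> fh; rewrite /comu !fh !(homV fh) !fh !(homV fh) !(hom_gpow _ _ fh). Qed.

Section HomB.
Variables (H : grp) (th : B -> H).
Hypothesis thh : is_hom th.
Lemma hom_u_elt i : th (inF (u_elt i)) =
  gpow (th zB) i * (th (inF (fx Gd)) * th (inF (fx Gg)) * (th (inF (fx Gd)))^-1 * (th (inF (fx Gg)))^-1) * (gpow (th zB) i)^-1.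
Proof.
rewrite -{1}[i]Z.add_0_l -shift3_u_elt -zB_conj !thh (homV thh) (hom_gpow _ _ thh); congr (_ * _ * _).
rewrite (hom_comu _ _ _ _ inF_hom) (hom_comu _ _ _ _ thh) /comu gpow0; by grp.
Qed.
End HomB.

Section ToH.
Variables (H : grp) (y : nat -> H).
Hypothesis rels : Rels y.

Definition th3 : F3 -> H := free_lift (fun x => match x with Gb => y 0 | Gd => y 1%nat | Gg => y 2 end).
Lemma th3_hom : is_hom th3.
Proof. exact: free_lift_hom. Qed.
Lemma th3_fx x : th3 (fx x) = match x with Gb => y 0 | Gd => y 1%nat | Gg => y 2 end.
Proof. exact: free_lift_fx. Qed.
Lemma th3_shift f : y 3 * th3 f * (y 3)^-1 = th3 (shift3 1 f).
Proof.
move: f; apply: free_hom_eq; [exact: (hom_conj _ th3_hom)|exact: (hom_comp (shift3_hom _) th3_hom)|].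
case; rewrite shift3_fx /shift3_gen ?gpow1 ?th3_hom ?(homV th3_hom) !th3_fx.
- apply: comm_conj; exact: R_zb rels.
- exact: R_zd rels.
- apply: comm_conj; exact: R_zg rels.
Qed.
Definition thB : B -> H := sd_lift th3 (y 3).
Lemma thB_hom : is_hom thB.
Proof. exact: (@sd_lift_hom _ _ shift3_hom shift30 shift3D H th3 (y 3) th3_hom th3_shift). Qed.
Lemma thB_F f : thB (inF f) = th3 f.
Proof. exact: sd_lift_i. Qed.
Lemma thB_z : thB zB = y 3.
Proof. exact: (@sd_lift_z _ _ shift3_hom shift30 shift3D H th3 (y 3) th3_hom). Qed.
Lemma thB_u_elt i : thB (inF (u_elt i)) = u_in y i.
Proof. by rewrite (hom_u_elt thB_hom) thB_z !thB_F !th3_fx. Qed.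
Lemma u_in_shift k i : gpow (y 3) k * u_in y i * (gpow (y 3) k)^-1 = u_in y (i + k).
Proof. by rewrite /u_in Z.add_comm gpowD; grp. Qed.

(** [K] has a stable letter for every natural number. Those of index above [nr] belong to identity
    rules and may be sent to 1, which leaves finitely many generators; the bound includes [nr]
    because of the extra letter 0. *)
Definition rH (k : nat) : H := if k <=? nr then y (9 + k) else 1.
(** Two relations per rule suffice: [V] is generated by x_0 and z, and every u_(m i + j) is the
    conjugate of u_j by a power of z^m. *)
Lemma rule_conj m j m' j' t v :
  t * gpow (y 3) m * t^-1 = gpow (y 3) m' -> t * u_in y j * t^-1 = u_in y j' ->
  t * thB (incV (iota m j v)) * t^-1 = thB (incV (iota m' j' v)).
Proof.
move=> e1 e2.
have h := fun m j => hom_comp (hom_comp (iota_hom m j) incV_hom) thB_hom.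
have ez : forall u, t * gpow (y 3) (m * u) * t^-1 = gpow (y 3) (m' * u).
  by move=> u; rewrite -!gpowM -gpow_conj e1.
move: v; apply: sd_ind; first exact: (sub_sg_eq (hom_conj _ (h m j)) (h m' j')).
- apply: free_ind.
    apply: (sub_sg_pre (@sdi_hom _ _ shiftZ_hom shiftZ0 shiftZD) (S := fun v => t * thB (incV (iota m j v)) * t^-1 = thB (incV (iota m' j' v)))).
    exact: (sub_sg_eq (hom_conj _ (h m j)) (h m' j')).
  move=> u; rewrite /incV /iota /= !relab_fx !u_hom_fx !Z.mul_0_r -!/(inF _) !thB_u_elt.
  rewrite ![(_ * u + _)%Z]Z.add_comm -!u_in_shift -e2 -ez; by grp.
- rewrite /incV /iota /= !(hom1 (relab_hom _ _)) !(hom1 u_hom_hom) !Z.mul_1_r -!zB_pow !(hom_gpow _ _ thB_hom) !thB_z.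
  exact: e1.
Qed.
(** Again two relations suffice: the letter commutes with all powers of z^Q, and conjugating its
    action on u_q0^a by them gives the action at every start value. *)
Lemma R0_conj g : GEN g -> y 9 * thB g * (y 9)^-1 = thB (gpow zB Q * g * (gpow zB Q)^-1).
Proof.
have hr : is_hom (fun g => thB (gpow zB Q * g * (gpow zB Q)^-1)).
  exact: (hom_comp (hom_conj (gpow zB Q) (@hom_id B)) thB_hom).
have sg := sub_sg_eq (hom_conj (y 9) thB_hom) hr.
have ez : forall x, y 9 * gpow (y 3) (Q * x) * (y 9)^-1 = gpow (y 3) (Q * x).
  by move=> x; rewrite -gpowM -gpow_conj (R_0z rels).
case: g => f k [/= hf [x ->]].
have -> : ((f, (Q * x)%Z) : B) = inF f * gpow zB (Q * x).
  by rewrite zB_pow sd_mulE /= (hom1 (shift3_hom _)) mulg1.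
apply: (sgM sg).
  move: f hf; apply: gen_min; first exact: (sub_sg_pre inF_hom sg).
  move=> f [u ->]; rewrite zB_conj (homX (shift3_hom _)) shift3_u_elt !(homX inF_hom) !(homX thB_hom) !thB_u_elt.
  have -> : (Q * u + q0 + Q = q0 + Q + Q * u)%Z by lia.
  have sh : forall k i, npow (u_in y (i + k)) a = gpow (y 3) k * npow (u_in y i) a * (gpow (y 3) k)^-1.
    by move=> k' i; rewrite -u_in_shift npow_conj.
  rewrite [(Q * u + q0)%Z]Z.add_comm (sh (Q * u)%Z q0) (sh (Q * u)%Z (q0 + Q)%Z).
  have -> : npow (u_in y (q0 + Q)) a = y 9 * npow (u_in y q0) a * (y 9)^-1 by rewrite (R_0u rels).
  have := conj_comm (ez u); move: (gpow (y 3) _) => c ec.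
  transitivity (y 9 * c * npow (u_in y q0) a * (y 9 * c)^-1); first by grp.
  by rewrite ec; grp.
rewrite /= -gpowN -!gpowD !(hom_gpow _ _ thB_hom) thB_z ez; congr gpow; lia.
Qed.
Lemma thK_rel k g h : RK k g h -> rH k * thB g * (rH k)^-1 = thB h.
Proof.
case: k => [|k] r.
  have [hg e] : GEN g /\ h = gpow zB Q * g * (gpow zB Q)^-1 := r.
  rewrite e; exact: (R0_conj hg).
move: r; rewrite -[RK (S k)]/(piso_rule (rlwf k)) /rH; case: (Nat.leb_spec (S k) nr) => hk.
  have := R_rz rels hk; have := R_ru rels hk; move: (rlwf k); case: (rl k) => [[[m j] m'] j'] w e1 e2.
  move=> r; have [v [-> ->]] := proj1 (piso_ruleE w g h) r; exact: rule_conj.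
move: (rlwf k); rewrite (rl_default (proj1 (Nat.lt_succ_r _ _) hk)) => w.
by move=> r; have [v [-> ->]] := proj1 (piso_ruleE w g h) r; grp.
Qed.
Definition thK : K -> H := hnn_lift thB rH.
Lemma thK_hom : is_hom thK.
Proof. exact: (hnn_lift_hom thB_hom thK_rel). Qed.
Lemma thK_in g : thK (hin RK g) = thB g.
Proof. exact: (hnn_lift_in RK thB rH). Qed.
Lemma thK_let k : thK (hlet RK k) = rH k.
Proof. exact: (hnn_lift_let thB_hom thK_rel). Qed.
Lemma thK_u_elt i : thK (inK (u_elt i)) = u_in y i.
Proof. by rewrite thK_in thB_u_elt. Qed.
Lemma y_L x : L x -> comm (y 4) (thK x).
Proof.
move: x; apply: gen_min; first exact: (sub_sg_pre thK_hom (sub_sg_cent _)).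
move=> x [[t [ht ->]]|[->|[k ->]]].
- by rewrite thK_u_elt; exact: R_yt.
- by rewrite (homX inK_hom) (homX thK_hom) thK_u_elt; exact: R_ya.
- rewrite thK_let /rH; case: (Nat.leb_spec k nr) => hk; [exact: R_yr|exact: comm1].
Qed.
Lemma thX_rel (i : unit) g h : RX i g h -> y 4 * thK g * (y 4)^-1 = thK h.
Proof. by case=> l ->; rewrite mul1g invg1 mulg1; apply: comm_conj; exact: y_L. Qed.
Definition thX : X -> H := hnn_lift thK (fun _ : unit => y 4).
Lemma thX_hom : is_hom thX.
Proof. exact: (hnn_lift_hom thK_hom thX_rel). Qed.
Lemma thX_in x : thX (iX x) = thK x.
Proof. exact: (hnn_lift_in RX thK (fun _ => y 4)). Qed.
Lemma thX_y : thX yX = y 4.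
Proof. exact: (hnn_lift_let thK_hom thX_rel). Qed.
Lemma thX_F f : thX (iF f) = th3 f.
Proof. by rewrite thX_in thK_in thB_F. Qed.

Definition bar_gen (x : three) : H := match x with Gb => y 6 | Gd => y 7 | Gg => y 8 end.
Definition bar : F3 -> H := free_lift bar_gen.
Lemma bar_hom : is_hom bar.
Proof. exact: free_lift_hom. Qed.
Lemma bar_fx x : bar (fx x) = bar_gen x.
Proof. exact: free_lift_fx. Qed.
Lemma bar_comm f x : comm (bar f) (thX x).
Proof.
apply: comm_sym; move: f; apply: free_ind; first exact: (sub_sg_pre bar_hom (sub_sg_cent _)).
move=> g; rewrite bar_fx; apply: comm_sym.
set c := bar_gen g.
have hc : forall i, i < 5 \/ 9 <= i < 10 + nr -> comm c (y i).
  by move=> i hi; apply: comm_sym; rewrite /c; case: g {c}; apply: (R_bar rels) => //; lia.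
move: x; apply: hnn_ind; first exact: (sub_sg_pre thX_hom (sub_sg_cent _)).
- move=> x; rewrite -/(iX x) thX_in; move: x; apply: hnn_ind; first exact: (sub_sg_pre thK_hom (sub_sg_cent _)).
  + move=> x; rewrite thK_in; move: x; apply: sd_ind; first exact: (sub_sg_pre thB_hom (sub_sg_cent _)).
    * move=> f; rewrite -/(inF f) thB_F; move: f; apply: free_ind; first exact: (sub_sg_pre th3_hom (sub_sg_cent _)).
      by case; rewrite th3_fx; apply: hc; lia.
    * by rewrite -/zB thB_z; apply: hc; lia.
  + move=> k; rewrite thK_let /rH; case: (Nat.leb_spec k nr) => hk; [apply: hc; lia|exact: comm1].
- by case; rewrite -/yX thX_y; apply: hc; lia.
Qed.
Lemma s_graph f : y 5 * thX (iF f) * (y 5)^-1 = thX (iF f) * bar f.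
Proof.
move: f; apply: free_hom_eq.
- exact: (hom_conj _ (hom_comp iF_hom thX_hom)).
- move=> f g; rewrite iF_hom thX_hom bar_hom.
  transitivity (thX (iF f) * (thX (iF g) * bar f) * bar g); first by grp.
  by rewrite -(bar_comm f (iF g)); grp.
- by case; rewrite thX_F th3_fx bar_fx; apply: (R_s rels); lia.
Qed.
Lemma s_yF f : y 5 * thX (yX * iF f * yX^-1) * (y 5)^-1 = thX (yX * iF f * yX^-1).
Proof.
have h : is_hom (fun f => thX (yX * iF f * yX^-1)) := hom_comp (hom_conj yX iF_hom) thX_hom.
move: f; apply: free_hom_eq; [exact: (hom_conj _ h)|exact: h|].
by case; rewrite !thX_hom (homV thX_hom) thX_y thX_F th3_fx; apply: (R_sy rels); lia.
Qed.
(** The rope trick itself: an f in [L] commutes with y, so y f y^-1 = f is fixed by s, while s also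
    sends f to f f'. Hence f' = 1. *)
Lemma bar_L f : L (inK f) -> bar f = 1.
Proof.
move=> h; have e := s_yF f; move: e; rewrite (X_y h).
have -> : iX (inK f) * yX * yX^-1 = iF f by rewrite /iF; grp.
by rewrite s_graph => e; apply: (@mulgI _ (thX (iF f))); rewrite e mulg1.
Qed.
Lemma bar_u_elt i : bar (u_elt i) = comu (y 6) (y 7) (y 8) i.
Proof. by rewrite (hom_comu _ _ _ _ bar_hom) !bar_fx. Qed.
Lemma comu_torsion i : start_class i -> npow (comu (y 6) (y 7) (y 8) i) a = 1.
Proof. by move=> h; rewrite -bar_u_elt -(homX bar_hom); apply: bar_L; exact: L_start. Qed.
Lemma comu_trivial i : halts i -> comu (y 6) (y 7) (y 8) i = 1.
Proof. by move=> h; rewrite -bar_u_elt; apply: bar_L; exact: L_halts. Qed.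

Section ThGam.
Variables (A2 : grp) (psi : F3 -> A2).
Hypothesis psih : is_hom psi.
Hypothesis psi_halts : forall i, halts i -> psi (u_elt i) = 1.
Hypothesis psi_start : forall i, start_class i -> npow (psi (u_elt i)) a = 1.
Hypothesis psi_surj : forall z, exists f, z = psi f.
Variable th2 : A2 -> H.
Hypothesis th2h : is_hom th2.
Hypothesis th2_psi : forall f, th2 (psi f) = bar f.
Definition thXA (p : XA A2) : H := thX (fst p) * th2 (snd p).
(** The images of [X] and [A2] must commute. By surjectivity of [psi], each value of [th2] is some
    [bar f], to which [bar_comm] applies. *)
Lemma thXA_hom : is_hom thXA.
Proof.
move=> [x z] [x' z']; rewrite /thXA prod_mulE; cbn [fst snd]; rewrite thX_hom th2h.
have [f ->] := psi_surj z; rewrite th2_psi.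
transitivity (thX x * (thX x' * bar f) * th2 z'); first by grp.
by rewrite -(bar_comm f x'); grp.
Qed.
Lemma thGam_rel (i : unit) g h : RG psih psi_halts psi_start i g h -> y 5 * thXA g * (y 5)^-1 = thXA h.
Proof.
case=> -> d; rewrite {1}/thXA /= (hom1 th2h) mulg1.
move: h d; apply: gen_min.
  exact: (sub_sg_eq (hom_conj (y 5) (hom_comp (@fst_hom X A2) thX_hom)) thXA_hom).
move=> p [[f ->]|[f ->]]; rewrite /thXA; cbn [fst snd].
- by rewrite th2_psi; exact: s_graph.
- by rewrite (hom1 th2h) mulg1; exact: s_yF.
Qed.
Definition thGam : Gam psih psi_halts psi_start -> H := hnn_lift thXA (fun _ : unit => y 5).
Lemma thGam_hom : is_hom thGam.
Proof. exact: (hnn_lift_hom thXA_hom thGam_rel). Qed.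
Lemma thGam_X x : thGam (jX psih psi_halts psi_start x) = thX x.
Proof. by rewrite /thGam /jX (hnn_lift_in _ thXA (fun _ => y 5)) /thXA /= (hom1 th2h) mulg1. Qed.
Lemma thGam_A z : thGam (jA psih psi_halts psi_start z) = th2 z.
Proof. by rewrite /thGam /jA (hnn_lift_in _ thXA (fun _ => y 5)) /thXA /= (hom1 thX_hom) mul1g. Qed.
Lemma thGam_s : thGam (sG psih psi_halts psi_start) = y 5.
Proof. exact: (hnn_lift_let thXA_hom thGam_rel). Qed.
End ThGam.
End ToH.

(** * The tower satisfies the relations *)

Section GamRels.
Variables (A2 : grp) (psi : F3 -> A2).
Hypothesis psih : is_hom psi.
Hypothesis psi_halts : forall i, halts i -> psi (u_elt i) = 1.
Hypothesis psi_start : forall i, start_class i -> npow (psi (u_elt i)) a = 1.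
Let GG := Gam psih psi_halts psi_start.
Let J := jX psih psi_halts psi_start.
Let JA := jA psih psi_halts psi_start.
Definition gam_gen (i : nat) : GG :=
  match i with
  | 0 => J (iF (fx Gb)) | 1 => J (iF (fx Gd)) | 2 => J (iF (fx Gg))
  | 3 => J (iX (hin RK zB)) | 4 => J yX | 5 => sG psih psi_halts psi_start
  | 6 => JA (psi (fx Gb)) | 7 => JA (psi (fx Gd)) | 8 => JA (psi (fx Gg))
  | S (S (S (S (S (S (S (S (S k)))))))) => J (iX (hlet RK k))
  end.
Lemma gam_gen_r k : gam_gen (9 + k) = J (iX (hlet RK k)).
Proof. by []. Qed.
Let Jh : is_hom J := jX_hom psih psi_halts psi_start.
Let JK : K -> GG := fun x => J (iX x).
Let JKh : is_hom JK := hom_comp iX_hom Jh.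
Let JB : B -> GG := fun x => JK (hin RK x).
Let JBh : is_hom JB := hom_comp (@hin_hom _ _ RK) JKh.
Lemma gam_gen_u_elt i : u_in gam_gen i = JK (inK (u_elt i)).
Proof. exact: (eq_sym (hom_u_elt JBh i)). Qed.
Lemma gam_gen_bar i : comu (gam_gen 6) (gam_gen 7) (gam_gen 8) i = JA (psi (u_elt i)).
Proof. by rewrite -(hom_comu _ _ _ _ (jA_hom psih psi_halts psi_start)) -(hom_comu _ _ _ _ psih). Qed.
Lemma gam_gen_conj (x g h : K) : x * g * x^-1 = h -> JK x * JK g * (JK x)^-1 = JK h.
Proof. by move=> <-; rewrite !JKh (homV JKh). Qed.
Lemma gam_gen_zpow m : gpow (gam_gen 3) m = JK (hin RK (gpow zB m)).
Proof. by rewrite (hom_gpow _ _ (@hin_hom _ _ RK)) (hom_gpow _ _ JKh). Qed.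
Lemma gam_gen_Fz f : gam_gen 3 * JK (inK f) * (gam_gen 3)^-1 = JK (inK (shift3 1 f)).
Proof.
apply: gam_gen_conj; rewrite -(homV (@hin_hom _ _ RK)) -!(@hin_hom _ _ RK); congr (hin RK _).
by rewrite -{1 2}(gpow1 zB) zB_conj.
Qed.
Lemma gam_gen_rels : Rels gam_gen.
Proof.
split.
- rewrite -[gam_gen 1%nat]/(JK (inK (fx Gd))) gam_gen_Fz shift3_fx /shift3_gen gpow1.
  by rewrite -[gam_gen 0]/(JK (inK (fx Gb))) !inK_hom !JKh (homV inK_hom) (homV JKh).
- by apply: conj_comm; rewrite -[gam_gen 0]/(JK (inK (fx Gb))) gam_gen_Fz shift3_fx.
- by apply: conj_comm; rewrite -[gam_gen 2]/(JK (inK (fx Gg))) gam_gen_Fz shift3_fx.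
- move=> k hk; case e : (rl k) => [[[m j] m'] j'].
  by rewrite !gam_gen_zpow; apply: gam_gen_conj; exact: (K_zrule e).
- move=> k hk; case e : (rl k) => [[[m j] m'] j'].
  rewrite !gam_gen_u_elt; apply: gam_gen_conj; have := K_rule 0 e; by rewrite !Z.mul_0_r !Z.add_0_l.
- by rewrite !gam_gen_zpow; apply: gam_gen_conj; exact: K_zstart.
- rewrite !gam_gen_u_elt -!(homX JKh) -!(homX inK_hom); apply: gam_gen_conj; have := K_start 0.
  have -> : (Q * 0 + q0 = q0)%Z by lia.
  by have -> : (Q * (0 + 1) + q0 = q0 + Q)%Z by lia.
- move=> t ht; rewrite gam_gen_u_elt; rewrite /comm -!Jh; congr J; apply: X_y.
  by apply: gen_in; left; exists t.
- rewrite gam_gen_u_elt -!(homX JKh) -!(homX inK_hom) /comm -!Jh; congr J; apply: X_y.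
  by apply: gen_in; right; left.
- move=> k hk; rewrite gam_gen_r /comm -!Jh; congr J; apply: X_y; exact: L_let.
- move=> i j hi hj.
  have [x ->] : exists x, gam_gen i = J x.
    by case: i hi => [|[|[|[|[|[|[|[|[|i]]]]]]]]] hi; try (by eexists; reflexivity); lia.
  have [z ->] : exists z, gam_gen j = JA z.
    by case: j hj => [|[|[|[|[|[|[|[|[|j]]]]]]]]] hj; try (by eexists; reflexivity); lia.
  exact: jXA_comm.
- by do 3 (case=> [|]; first by move=> _; exact: sG_F); lia.
- by do 3 (case=> [|]; first by move=> _; rewrite /= -!Jh -(homV Jh) -!Jh; exact: sG_yF); lia.
Qed.
End GamRels.

(** * All start values halt: a torsion-free group that maps to every model *)

Section AllHalt.
Hypothesis all_halt : forall i, start_class i -> halts i.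
Definition F2 := free bool.
Definition dconj (i : Z) : F2 := gpow (fx true) i * fx false * (gpow (fx true) i)^-1.
Definition RS (_ : unit) : piso F2 := piso_conj 1 (gen_sg (fun x => exists i, halts i /\ x = dconj i)).
(** The relation u_i = 1 says that g commutes with b^i d b^-i. Imposing it for all halting i
    therefore gives an HNN extension of the free group on b and d, torsion-free like its base. *)
Definition A2h : grp := hnn RS.
Definition psi_gen (x : three) : A2h :=
  match x with Gb => hin RS (fx true) | Gd => hin RS (fx false) | Gg => hlet RS tt end.
Definition psi2 : F3 -> A2h := free_lift psi_gen.
Lemma psi2_hom : is_hom psi2.
Proof. exact: free_lift_hom. Qed.
Lemma psi2_fx x : psi2 (fx x) = psi_gen x.
Proof. exact: free_lift_fx. Qed.
Lemma psi2_u_elt i : psi2 (u_elt i) = hin RS (dconj i) * hlet RS tt * (hin RS (dconj i))^-1 * (hlet RS tt)^-1.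
Proof.
have h := @hin_hom _ _ RS.
by rewrite (hom_comu _ _ _ _ psi2_hom) !psi2_fx /comu /dconj !h (homV h) (hom_gpow _ _ h).
Qed.
Lemma psi2_halts i : halts i -> psi2 (u_elt i) = 1.
Proof.
move=> h; rewrite psi2_u_elt.
have e : comm (hlet RS tt) (hin RS (dconj i)).
  apply: conj_comm; apply: hnn_rel; split; last by grp.
  by apply: gen_in; exists i.
rewrite -e; by grp.
Qed.
Lemma psi2_start i : start_class i -> npow (psi2 (u_elt i)) a = 1.
Proof. by move=> h; rewrite psi2_halts ?npow1 //; exact: all_halt. Qed.
Lemma psi2_surj z : exists f, z = psi2 f.
Proof.
have sg : subgroup (fun z : A2h => exists f, z = psi2 f).
  split.
  - by exists 1; rewrite (hom1 psi2_hom).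
  - by move=> x y [f ->] [g ->]; exists (f * g); rewrite psi2_hom.
  - by move=> x [f ->]; exists f^-1; rewrite (homV psi2_hom).
move: z; apply: hnn_ind => //.
- apply: free_ind; first exact: (sub_sg_pre (@hin_hom _ _ RS) sg).
  case; [exists (fx Gb)|exists (fx Gd)]; by rewrite psi2_fx.
- by case; exists (fx Gg); rewrite psi2_fx.
Qed.
Theorem universal_torsion_free : exists (G : grp) (x : nat -> G), torsion_free G /\ Rels x /\
  forall (H : grp) (y : nat -> H), Rels y ->
    exists th : G -> H, is_hom th /\ forall i, i < 10 + nr -> th (x i) = y i.
Proof.
exists (Gam psi2_hom psi2_halts psi2_start), (gam_gen psi2_hom psi2_halts psi2_start).
split; first by apply: Gam_torsion_free; apply: hnn_torsion_free; exact: free_torsion_free.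
split; first exact: gam_gen_rels.
move=> H y rels.
pose f2 : F2 -> H := free_lift (fun x : bool => if x then y 6 else y 7).
have f2h : is_hom f2 by exact: free_lift_hom.
have f2d i : f2 (dconj i) = gpow (y 6) i * y 7 * (gpow (y 6) i)^-1.
  by rewrite /dconj !f2h (homV f2h) (hom_gpow _ _ f2h) /f2 !free_lift_fx.
have rel2 : forall (i : unit) g h, RS i g h -> y 8 * f2 g * (y 8)^-1 = f2 h.
  move=> i g h [hg ->]; rewrite mul1g invg1 mulg1; apply: comm_conj.
  move: g hg; apply: gen_min; first exact: (sub_sg_pre f2h (sub_sg_cent _)).
  move=> g [k [hk ->]]; rewrite f2d.
  have := comu_trivial rels hk; rewrite /comu => e.
  have := eqg_div e => {}e; apply: comm_sym.
  by rewrite /comm -{2}e; grp.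
pose t2 : A2h -> H := hnn_lift f2 (fun _ : unit => y 8).
have t2h : is_hom t2 by exact: (hnn_lift_hom f2h rel2).
have t2psi f : t2 (psi2 f) = bar y f.
  move: f; apply: free_hom_eq; [exact: (hom_comp psi2_hom t2h)|exact: bar_hom|].
  case; rewrite psi2_fx bar_fx /=.
  - by rewrite /t2 (hnn_lift_in RS f2 (fun _ => y 8)) /f2 free_lift_fx.
  - by rewrite /t2 (hnn_lift_in RS f2 (fun _ => y 8)) /f2 free_lift_fx.
  - exact: (hnn_lift_let f2h rel2).
exists (@thGam H y A2h psi2 psi2_hom psi2_halts psi2_start t2); split.
  exact: (thGam_hom rels psi2_surj t2h t2psi).
have gX x : @thGam H y A2h psi2 psi2_hom psi2_halts psi2_start t2 (jX psi2_hom psi2_halts psi2_start x) = thX y x by apply: thGam_X.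
have gA z : @thGam H y A2h psi2 psi2_hom psi2_halts psi2_start t2 (jA psi2_hom psi2_halts psi2_start z) = t2 z by apply: thGam_A.
move=> i; case: i => [|[|[|[|[|[|[|[|[|k]]]]]]]]] hk.
- by rewrite gX thX_F th3_fx.
- by rewrite gX thX_F th3_fx.
- by rewrite gX thX_F th3_fx.
- by rewrite gX thX_in thK_in thB_z.
- by rewrite gX (thX_y rels).
- by apply: thGam_s => //; exact: psi2_surj.
- by rewrite gA t2psi bar_fx.
- by rewrite gA t2psi bar_fx.
- by rewrite gA t2psi bar_fx.
- rewrite gX thX_in (thK_let rels) /rH; case: (Nat.leb_spec k nr) => // h; lia.
Qed.
End AllHalt.

(** * A non-halting index: a model in which its commutator survives *)

Section NotHalt.
Hypothesis a2 : 2 <= a.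
Variable i0 : Z.
Hypothesis ni0 : ~ halts i0.

(** The cyclic shift of 0, ..., a - 1, extended by the identity to all natural numbers. Its inverse
    is [rot (a - 1)]. *)
Definition rot (k v : nat) : nat := if v <? a then (v + k) mod a else v.
Lemma rotD k l v : rot k (rot l v) = rot (l + k) v.
Proof.
rewrite /rot; case e : (v <? a); last by rewrite e.
have h' : (v + l) mod a < a by apply: Nat.mod_upper_bound; lia.
rewrite (proj2 (Nat.ltb_lt _ _) h') Nat.Div0.add_mod_idemp_l.
by rewrite Nat.add_assoc.
Qed.
Lemma rot_mul k v : rot (k * a)%nat v = v.
Proof.
rewrite /rot; case: (Nat.ltb_spec v a) => // h.
by rewrite Nat.Div0.mod_add Nat.mod_small.
Qed.
(** A position moved by b, a flag flipped by g, and a number rotated by d. As d acts only at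
    position 0 with flag false, and g only at position i0, the conjugate b^i d b^-i commutes with g
    unless i = i0. *)
Definition points : Type := Z * bool * nat.
Definition qd_fun (k : nat) (i : Z) (x : points) : points :=
  let '(j, t, v) := x in if dec (j = i /\ t = false) then (j, t, rot k v) else x.
Lemma qd_funD k l i x : qd_fun k i (qd_fun l i x) = qd_fun (l + k) i x.
Proof.
case: x => [[j t] v]; rewrite /qd_fun; case: (dec (j = i /\ t = false)) => h; case: (dec _) => // _.
by rewrite rotD.
Qed.
Lemma qd_fun_a k i x : qd_fun (k * a)%nat i x = x.
Proof. by case: x => [[j t] v]; rewrite /qd_fun rot_mul; case: (dec _). Qed.
Lemma qdK i x : qd_fun (a - 1) i (qd_fun 1 i x) = x.
Proof. by rewrite qd_funD -{2}(qd_fun_a 1 i x); congr qd_fun; lia. Qed.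
Lemma qdK' i x : qd_fun 1 i (qd_fun (a - 1) i x) = x.
Proof. by rewrite qd_funD -{2}(qd_fun_a 1 i x); congr qd_fun; lia. Qed.
Definition SW := sym_grp points.
Definition qd (i : Z) : SW := @Perm points (qd_fun 1 i) (qd_fun (a - 1) i) (qdK i) (qdK' i).
Definition qg_fun (x : points) : points := let '(j, t, v) := x in if dec (j = i0) then (j, negb t, v) else x.
Lemma qgK x : qg_fun (qg_fun x) = x.
Proof.
case: x => [[j t] v]; rewrite /qg_fun; case: (dec (j = i0)) => h; case: (dec _) => //.
by rewrite negb_involutive.
Qed.
Definition qg : SW := @Perm points qg_fun qg_fun qgK qgK.
Definition qb_fun (k : Z) (x : points) : points := let '(j, t, v) := x in ((j + k)%Z, t, v).
Lemma qbK x : qb_fun (-1) (qb_fun 1 x) = x.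
Proof. case: x => [[j t] v]; rewrite /qb_fun; congr (_, _, _); lia. Qed.
Lemma qbK' x : qb_fun 1 (qb_fun (-1) x) = x.
Proof. case: x => [[j t] v]; rewrite /qb_fun; congr (_, _, _); lia. Qed.
Definition qb : SW := @Perm points (qb_fun 1) (qb_fun (-1)) qbK qbK'.
Lemma qb_pow k x : pf (gpow qb k) x = qb_fun k x.
Proof.
case: x => [[j t] v]; rewrite /qb_fun.
move: k j; apply: (Z.peano_ind (fun k => forall j, _)) => [|l IH|l IH] j.
- by rewrite Z.add_0_r.
- rewrite -Z.add_1_r gpowS sym_mulE /= IH; congr (_, _, _); lia.
- rewrite -Z.sub_1_r gpowP sym_mulE sym_invE /= IH; congr (_, _, _); lia.
Qed.
Lemma qb_conj i : gpow qb i * qd 0 * (gpow qb i)^-1 = qd i.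
Proof.
apply: perm_eq => -[[j t] v]; rewrite -gpowN !sym_mulE !qb_pow /=.
case: (dec (_ /\ _)) => [[h ->]|h]; case: (dec (_ /\ _)) => [[h' h'']|h'] //=.
- congr (_, _, _); lia.
- case: h'; split=> //; lia.
- case: h; split=> //; lia.
- congr (_, _, _); lia.
Qed.
Definition psi3 : F3 -> SW := free_lift (fun x => match x with Gb => qb | Gd => qd 0 | Gg => qg end).
Lemma psi3_hom : is_hom psi3.
Proof. exact: free_lift_hom. Qed.
Lemma psi3_u_elt i : psi3 (u_elt i) = qd i * qg * (qd i)^-1 * qg^-1.
Proof.
rewrite (hom_comu _ _ _ _ psi3_hom) /psi3 !free_lift_fx /comu qb_conj.
by [].
Qed.
Lemma psi3_neq i : i <> i0 -> psi3 (u_elt i) = 1.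
Proof.
move=> ne; rewrite psi3_u_elt; suff -> : qd i * qg = qg * qd i by grp.
apply: perm_eq => -[[j t] v]; rewrite !sym_mulE /=.
case: (dec (j = i0)) => h; case: (dec (j = i /\ t = false)) => h'; rewrite /=.
- by case: ne; case: h' => <-.
- case: (dec (j = i /\ _)) => h''; first by case: ne; case: h'' => <-.
  by case: (dec (j = i0)).
- case: (dec (j = i /\ _)) => h'' //; by case: (dec (j = i0)).
- case: (dec (j = i /\ _)) => h'' //; by case: (dec (j = i0)).
Qed.
Lemma psi3_false v : pf (psi3 (u_elt i0)) (i0, false, v) = (i0, false, rot 1 v).
Proof.
rewrite psi3_u_elt !sym_mulE !sym_invE /=.
case: (dec (i0 = i0)) => // _ /=; case: (dec (i0 = i0 /\ true = false)) => [[]//|_] /=.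
case: (dec (i0 = i0)) => // _ /=; case: (dec _) => // h; by case: h.
Qed.
Lemma psi3_true v : pf (psi3 (u_elt i0)) (i0, true, v) = (i0, true, rot (a - 1) v).
Proof.
rewrite psi3_u_elt !sym_mulE !sym_invE /=.
case: (dec (i0 = i0)) => // _ /=; case: (dec (i0 = i0 /\ false = false)) => [_|[]//] /=.
case: (dec (i0 = i0)) => // _ /=; case: (dec _) => // h; by case: h.
Qed.
Lemma psi3_else j t v : j <> i0 -> pf (psi3 (u_elt i0)) (j, t, v) = (j, t, v).
Proof.
move=> ne; rewrite psi3_u_elt !sym_mulE !sym_invE /=.
case: (dec (j = i0)) => // _ /=; case: (dec (j = i0 /\ t = false)) => [[]//|_] /=.
case: (dec (j = i0)) => // _ /=; by case: (dec (j = i0 /\ t = false)) => [[]//|_] /=.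
Qed.
(** At position i0 the commutator rotates by 1 where the flag is false and by a - 1, the inverse,
    where it is true; elsewhere it is the identity. *)
Lemma psi3_pow : npow (psi3 (u_elt i0)) a = 1.
Proof.
apply: perm_eq => -[[j t] v].
case: (dec (j = i0)) => [->|ne].
  have p : forall n, pf (npow (psi3 (u_elt i0)) n) (i0, t, v) = (i0, t, rot ((if t then a - 1 else 1) * n)%nat v).
    elim=> [|n IH]; first by rewrite Nat.mul_0_r (rot_mul 0).
    rewrite -[npow _ (S n)]/(psi3 (u_elt i0) * npow (psi3 (u_elt i0)) n) sym_mulE IH.
    case: t {IH}; rewrite ?psi3_true ?psi3_false rotD; congr (_, _, rot _ _); lia.
  by rewrite p rot_mul.
elim: (a) => [|n IH] //.
by rewrite -[npow _ (S n)]/(psi3 (u_elt i0) * npow (psi3 (u_elt i0)) n) sym_mulE IH psi3_else.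
Qed.
Lemma psi3_halts i : halts i -> psi3 (u_elt i) = 1.
Proof. by move=> h; apply: psi3_neq => e; apply: ni0; rewrite -e. Qed.
Lemma psi3_start i : start_class i -> npow (psi3 (u_elt i)) a = 1.
Proof.
case: (dec (i = i0)) => [->|ne] _; first exact: psi3_pow.
by rewrite psi3_neq // npow1.
Qed.
Theorem nontrivial_model : exists (G : grp) (x : nat -> G), Rels x /\ comu (x 6) (x 7) (x 8) i0 <> 1.
Proof.
exists (Gam psi3_hom psi3_halts psi3_start), (gam_gen psi3_hom psi3_halts psi3_start).
split; first exact: gam_gen_rels.
rewrite gam_gen_bar => /jA_inj e.
have := psi3_false 0; rewrite e => -[].
(* The rotation moves 0 to 1 since a >= 2. *)
rewrite /rot; case: (Nat.ltb_spec 0 a) => h; last by lia.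
by rewrite Nat.mod_small; lia.
Qed.
End NotHalt.
End Machine.

(** * The finite presentation *)

Open Scope nat_scope.

(** * The group of a presentation and the evaluation of words *)

Section PresentedGroup.
Variable rels : list (list nat).
(** An element is the equivalence class of a word, kept as a predicate, so that Rocq equality is
    equality in the group; representatives are recovered by choice. *)
Definition pg_car := {P : list nat -> Prop | exists w, P = word_eq rels w}.
Definition cl (w : list nat) : pg_car := exist _ (word_eq rels w) (ex_intro _ w eq_refl).
Definition word_of (x : pg_car) : list nat := epsilon (inhabits []) (fun w => proj1_sig x = word_eq rels w).
Lemma pg_eq (x y : pg_car) : proj1_sig x = proj1_sig y -> x = y.
Proof. by case: x y => x p [y q] /= e; subst y; rewrite (proof_irrelevance _ p q). Qed.
Lemma cl_eq w w' : cl w = cl w' <-> word_eq rels w w'.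
Proof.
split.
- move=> e; have e' : word_eq rels w = word_eq rels w' := f_equal (@proj1_sig _ _) e.
  rewrite e'; exact: we_refl.
- move=> h; apply: pg_eq => /=; apply: functional_extensionality => v; apply: propositional_extensionality.
  by split=> k; [apply: weq_trans k; apply: we_sym|apply: weq_trans h k].
Qed.
Lemma cl_word_of x : cl (word_of x) = x.
Proof.
apply: pg_eq => /=; symmetry.
exact: (epsilon_spec (inhabits []) (fun w => proj1_sig x = word_eq rels w) (proj2_sig x)).
Qed.
Lemma word_of_cl w : word_eq rels (word_of (cl w)) w.
Proof. by apply/cl_eq; rewrite cl_word_of. Qed.
Definition pg_mul x y := cl (word_of x ++ word_of y).
Definition pg_inv x := cl (winv (word_of x)).
Definition pg : grp.
refine (@Grp pg_car pg_mul (cl []) pg_inv _ _ _).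
- move=> x y z; apply/cl_eq; apply: (weq_trans (w2 := word_of x ++ word_of y ++ word_of z)).
    apply: weq_cat (word_of_cl _); exact: we_refl.
  rewrite app_assoc; apply: we_sym; apply: weq_cat (word_of_cl _) _; exact: we_refl.
- move=> x; rewrite -{2}(cl_word_of x); apply/cl_eq.
  by have := weq_cat (word_of_cl []) (we_refl rels (word_of x)).
- move=> x; apply/cl_eq; apply: weq_trans (weq_invl rels (word_of x)).
  apply: weq_cat (word_of_cl _) _; exact: we_refl.
Defined.
Definition pcl (w : list nat) : pg := cl w.
Lemma pcl_cat w w' : pcl (w ++ w') = (pcl w * pcl w')%g.
Proof. by apply/cl_eq; apply: we_sym; apply: weq_cat; exact: word_of_cl. Qed.
Lemma pcl_eq1 w : pcl w = 1%g <-> word_eq rels w [].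
Proof. exact: cl_eq. Qed.
End PresentedGroup.

Section Eval.
Variables (G : grp) (y : nat -> G).
Definition evl1 (a : nat) : G := if Nat.even a then y (a / 2) else (y (a / 2))^-1%g.
Fixpoint ev (w : list nat) : G := match w with [] => 1%g | a :: w' => (evl1 a * ev w')%g end.
Lemma ev_cat w w' : ev (w ++ w') = (ev w * ev w')%g.
Proof. by elim: w => [|a w IH] /=; rewrite ?mul1g // IH mulA. Qed.
Lemma evl1_even i : evl1 (2 * i) = y i.
Proof.
have e : 2 * i / 2 = i by rewrite Nat.mul_comm Nat.div_mul.
by rewrite /evl1 e Nat.even_mul.
Qed.
Lemma evl1_odd i : evl1 (2 * i + 1) = (y i)^-1%g.
Proof.
have e : (2 * i + 1) / 2 = i by symmetry; apply: (Nat.div_unique _ _ _ 1); lia.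
by rewrite /evl1 e Nat.add_1_r Nat.even_succ -Nat.negb_even Nat.even_mul.
Qed.
Lemma letter_cases a : (exists i, a = 2 * i /\ letter_inv a = 2 * i + 1) \/ exists i, a = 2 * i + 1 /\ letter_inv a = 2 * i.
Proof.
rewrite /letter_inv; case e : (Nat.even a).
  have [i ei] := proj1 (Nat.even_spec a) e; left; exists i; lia.
have [i ei] : Nat.Odd a by apply/Nat.odd_spec; rewrite -Nat.negb_even e.
right; exists i; lia.
Qed.
Lemma evl1_inv a : evl1 (letter_inv a) = (evl1 a)^-1%g.
Proof. by case: (letter_cases a) => [] [i [-> ->]]; rewrite evl1_even evl1_odd ?invgK. Qed.
Lemma ev_winv w : ev (winv w) = (ev w)^-1%g.
Proof.
elim: w => [|a w IH] /=; first by rewrite invg1.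
by rewrite /winv /= ev_cat -/(winv w) IH /= mulg1 evl1_inv invMg.
Qed.
Lemma ev_pow w n : ev (word_pow w n) = npow (ev w) n.
Proof. by elim: n => [|n IH] //=; rewrite ev_cat IH. Qed.
Lemma ev_sound rels w w' : (forall r, In r rels -> ev r = 1%g) -> word_eq rels w w' -> ev w = ev w'.
Proof.
move=> h; elim=> {w w'} [//|w w' [u v a|u v r hr]|w w' _ -> //|w1 w2 w3 _ -> _ -> //].
- by rewrite !ev_cat /= evl1_inv mulKVg.
- by rewrite !ev_cat (h r hr) mul1g.
Qed.
Definition wp (i : nat) (k : Z) : list nat :=
  if (0 <=? k)%Z then repeat (2 * i) (Z.to_nat k) else repeat (2 * i + 1) (Z.to_nat (- k)).
Lemma ev_repeat a n : ev (repeat a n) = npow (evl1 a) n.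
Proof. by elim: n => [|n IH] //=; rewrite IH. Qed.
Lemma npow_inv (x : G) n : npow x^-1%g n = (npow x n)^-1%g.
Proof. by elim: n => [|n IH]; [rewrite /= invg1|rewrite npowS /= IH invMg]. Qed.
Lemma ev_wp i k : ev (wp i k) = gpow (y i) k.
Proof.
rewrite /wp /gpow; case: Z.leb; rewrite ev_repeat ?evl1_even ?evl1_odd //.
exact: npow_inv.
Qed.
End Eval.
Arguments ev {G} y w.

Lemma ev_pcl rels (w : list nat) : ev (fun i => pcl rels [2 * i]) w = pcl rels w.
Proof.
elim: w => [|a w IH] //=; rewrite IH -[a :: w]/([a] ++ w) pcl_cat.
suff -> : evl1 (fun i => pcl rels [2 * i]) a = pcl rels [a] by [].
case: (letter_cases a) => [] [i [-> _]]; first by rewrite evl1_even.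
rewrite evl1_odd; symmetry; apply: eq_invg_mul; rewrite -pcl_cat; apply/pcl_eq1.
have := weq_invr rels [2 * i]; rewrite /winv /=.
have -> : letter_inv (i + (i + 0)) = i + (i + 0) + 1; last by [].
by case: (letter_cases (i + (i + 0))) => [] [k [e ->]]; lia.
Qed.
Lemma hom_ev (G H : grp) (f : G -> H) (y : nat -> G) (z : nat -> H) k w : is_hom f ->
  (forall i, i < k -> f (y i) = z i) -> valid_word k w -> f (ev y w) = ev z w.
Proof.
move=> fh e; elim=> [|a l la _ IH] /=; first exact: (hom1 fh).
rewrite fh IH; congr mul.
by case: (letter_cases a) => [] [i [ea _]]; rewrite ea ?evl1_even ?evl1_odd ?(homV fh) e //; lia.
Qed.

(** * The relators as words *)

Section Words.
Variables (rules : list rule) (tg : list Z) (Q : nat) (a : nat).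
Let nr := length rules.
(** The relator of the equation x_i w x_i^-1 = w'. *)
Definition cj (i : nat) (w w' : list nat) := [2 * i] ++ w ++ [2 * i + 1] ++ winv w'.
(** Generator 3 is z, and the letters 2, 4, 3, 5 spell d g d^-1 g^-1. *)
Definition uw (i : Z) := wp 3 i ++ [2; 4; 3; 5] ++ wp 3 (- i).
Definition rz (k : nat) := let '(m, j, m', j') := nth k rules (1, 0, 1, 0)%Z in cj (10 + k) (wp 3 m) (wp 3 m').
Definition ru (k : nat) := let '(m, j, m', j') := nth k rules (1, 0, 1, 0)%Z in cj (10 + k) (uw j) (uw j').
Definition relators : list (list nat) :=
  map rz (seq 0 nr) ++ map ru (seq 0 nr) ++
  [cj 3 [2] [0; 2; 1]; cj 3 [0] [0]; cj 3 [4] [4]; cj 9 (wp 3 (Z.of_nat Q)) (wp 3 (Z.of_nat Q));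
   cj 9 (word_pow (uw 0) a) (word_pow (uw (0 + Z.of_nat Q)) a); cj 4 (word_pow (uw 0) a) (word_pow (uw 0) a)] ++
  map (fun t => cj 4 (uw t) (uw t)) tg ++
  map (fun k => cj 4 [2 * (9 + k)] [2 * (9 + k)]) (seq 0 (S nr)) ++
  flat_map (fun j => map (fun i => cj i [2 * j] [2 * j]) (seq 0 5 ++ seq 9 (S nr))) (seq 6 3) ++
  map (fun i => cj 5 [2 * i] [2 * i; 2 * (6 + i)]) (seq 0 3) ++
  map (fun i => cj 5 [8; 2 * i; 9] [8; 2 * i; 9]) (seq 0 3).

Lemma ev_cj (G : grp) (y : nat -> G) i w w' : ev y (cj i w w') = 1%g <-> (y i * ev y w * (y i)^-1 = ev y w')%g.
Proof.
rewrite /cj !ev_cat ev_winv /= evl1_even evl1_odd !mulg1 !mulA; split.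
- exact: eqg_div.
- by move=> ->; rewrite mulgV.
Qed.
Lemma ev1 (G : grp) (y : nat -> G) i : ev y [2 * i] = y i.
Proof. by rewrite /= mulg1 evl1_even. Qed.
Lemma ev_uw (G : grp) (y : nat -> G) i : ev y (uw i) = u_in y i.
Proof.
rewrite /uw !ev_cat !ev_wp gpowN /u_in /= -!/(2 * _) mulA; congr mul; congr mul.
rewrite (evl1_even y 1) (evl1_even y 2) (evl1_odd y 1) (evl1_odd y 2); by grp.
Qed.
Notation rl := (fun k => nth k rules (1, 0, 1, 0)%Z).
Lemma relators_Rels (G : grp) (y : nat -> G) :
  (forall r, In r relators -> ev y r = 1%g) <-> Rels rl tg 0 (Z.of_nat Q) a nr y.
Proof.
have cjc : forall i w, ev y (cj i w w) = 1%g <-> comm (y i) (ev y w).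
  by move=> i w; rewrite ev_cj; split; [exact: conj_comm|exact: comm_conj].
rewrite -Forall_forall /relators !Forall_app !Forall_map.
split.
- move=> [hrz [hru [h1 [ht [hr [hb [hs hsy]]]]]]].
  rewrite !Forall_forall in hrz hru ht hr hb hs hsy.
  inversion h1 as [|? ? e1 h2]; inversion h2 as [|? ? e2 h3]; inversion h3 as [|? ? e3 h4];
    inversion h4 as [|? ? e4 h5]; inversion h5 as [|? ? e5 h6]; inversion h6 as [|? ? e6 h7].
  split.
  + move/ev_cj: e1; rewrite (ev1 y 1) /= mulg1 => ->.
    by rewrite (evl1_even y 0) (evl1_even y 1) (evl1_odd y 0) mulA.
  + by move/cjc: e2; rewrite (ev1 y 0).
  + by move/cjc: e3; rewrite (ev1 y 2).
  + move=> k hk; have := hrz k; rewrite /rz; case: (rl k) => [[[m j] m'] j'] h.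
    have /h : In k (seq 0 nr) by apply/in_seq; lia.
    by move/ev_cj; rewrite !ev_wp.
  + move=> k hk; have := hru k; rewrite /ru; case: (rl k) => [[[m j] m'] j'] h.
    have /h : In k (seq 0 nr) by apply/in_seq; lia.
    by move/ev_cj; rewrite !ev_uw.
  + by move/ev_cj: e4; rewrite ev_wp.
  + by move/ev_cj: e5; rewrite !ev_pow !ev_uw.
  + by move=> t hin; have /cjc := ht t hin; rewrite ev_uw.
  + by move/cjc: e6; rewrite ev_pow ev_uw.
  + move=> k hk; have /hr : In k (seq 0 (S nr)) by apply/in_seq; lia.
    by move/cjc; rewrite ev1.
  + move=> i j hi hj.
    have hin : In i (seq 0 5 ++ seq 9 (S nr)) by apply/in_app_iff; rewrite !in_seq; lia.
    have : ev y (cj i [2 * j] [2 * j]) = 1%g.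
      case: hb => b6 [b7 [b8 _]]; have [->|[->|->]] : j = 6 \/ j = 7 \/ j = 8 by lia.
      - exact: b6.
      - exact: b7.
      - exact: b8.
    by move/cjc; rewrite ev1.
  + move=> i hi; have /hs : In i (seq 0 3) by apply/in_seq; lia.
    move/ev_cj; rewrite ev1 => ->.
    by rewrite -[[2 * i; _]]/([2 * i] ++ [2 * (6 + i)]) ev_cat !ev1.
  + move=> i hi; have /hsy : In i (seq 0 3) by apply/in_seq; lia.
    move/ev_cj; rewrite -[[8; _; 9]]/([2 * 4] ++ [2 * i] ++ [2 * 4 + 1]) !ev_cat !ev1.
    by rewrite /= (evl1_odd y 4) !mulg1 !mulA.
- move=> rels; rewrite !Forall_forall; split.
    move=> k /in_seq hk; have := R_rz rels (k := k); rewrite /rz; case: (rl k) => [[[m j] m'] j'] h.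
    by apply/ev_cj; rewrite !ev_wp; apply: h; lia.
  split.
    move=> k /in_seq hk; have := R_ru rels (k := k); rewrite /ru; case: (rl k) => [[[m j] m'] j'] h.
    by apply/ev_cj; rewrite !ev_uw; apply: h; lia.
  split.
    move=> x /= [<-|[<-|[<-|[<-|[<-|[<-|[]]]]]]].
    + apply/ev_cj; rewrite (ev1 y 1) (R_zd rels) /= mulg1.
      by rewrite (evl1_even y 0) (evl1_even y 1) (evl1_odd y 0) mulA.
    + by apply/cjc; rewrite (ev1 y 0); exact: R_zb rels.
    + by apply/cjc; rewrite (ev1 y 2); exact: R_zg rels.
    + by apply/ev_cj; rewrite ev_wp; exact: R_0z rels.
    + by apply/ev_cj; rewrite !ev_pow !ev_uw; exact: R_0u rels.
    + by apply/cjc; rewrite ev_pow ev_uw; exact: R_ya rels.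
  split; first by move=> t ht; apply/cjc; rewrite ev_uw; exact: (R_yt rels ht).
  split; first by move=> k /in_seq hk; apply/cjc; rewrite ev1; apply: (R_yr rels); lia.
  split.
    have hb : forall j, 6 <= j < 9 -> forall i, In i (seq 0 5 ++ seq 9 (S nr)) -> ev y (cj i [2 * j] [2 * j]) = 1%g.
      move=> j hj i /in_app_iff; rewrite !in_seq => hi.
      apply/cjc; rewrite ev1; apply: (R_bar rels); lia.
    by do 3 (split; first by apply: hb; lia).
  split.
    move=> i /in_seq hi; apply/ev_cj.
    rewrite -[[2 * i; _]]/([2 * i] ++ [2 * (6 + i)]) ev_cat !ev1; apply: (R_s rels); lia.
  move=> i /in_seq hi; apply/ev_cj.
  rewrite -[[8; _; 9]]/([2 * 4] ++ [2 * i] ++ [2 * 4 + 1]) !ev_cat !ev1.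
  rewrite /= (evl1_odd y 4) !mulg1 !mulA; have := R_sy rels (i := i); rewrite !mulA; apply; lia.
Qed.

Lemma valid_app k w w' : valid_word k w -> valid_word k w' -> valid_word k (w ++ w').
Proof. by move=> h h'; apply/Forall_app. Qed.
Lemma valid_winv k w : valid_word k w -> valid_word k (winv w).
Proof.
rewrite /valid_word !Forall_forall /winv => h x; rewrite -in_rev => /in_map_iff [z [<- hz]].
by apply: letter_inv_lt; exact: h.
Qed.
Lemma valid_wp k i z : i < k -> valid_word k (wp i z).
Proof.
move=> h; rewrite /wp; case: Z.leb; apply/Forall_forall => x hx; have := repeat_spec _ _ _ hx; lia.
Qed.
Lemma valid_pow k w n : valid_word k w -> valid_word k (word_pow w n).
Proof. by move=> h; elim: n => [|n IH]; [constructor|exact: valid_app]. Qed.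
Lemma valid_letters k l : (forall x, In x l -> x < 2 * k) -> valid_word k l.
Proof. by move=> h; apply/Forall_forall. Qed.
Lemma valid_cj k i w w' : i < k -> valid_word k w -> valid_word k w' -> valid_word k (cj i w w').
Proof.
move=> hi h h'; apply: valid_app; first by apply: valid_letters => x [<-|[]]; lia.
apply: valid_app => //; apply: valid_app; first by apply: valid_letters => x [<-|[]]; lia.
exact: valid_winv.
Qed.
Lemma valid_uw k i : 3 < k -> valid_word k (uw i).
Proof.
move=> h; apply: valid_app; first by apply: valid_wp.
apply: valid_app; last by apply: valid_wp.
by apply: valid_letters => x /= [<-|[<-|[<-|[<-|[]]]]]; lia.
Qed.
Lemma relators_valid : Forall (valid_word (10 + nr)) relators.
Proof.
have hl : forall l, (forall x, In x l -> x < 20) -> valid_word (10 + nr) l.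
  by move=> l h; apply: valid_letters => x /h; lia.
rewrite /relators !Forall_app !Forall_map !Forall_forall; split.
  move=> k /in_seq hk; rewrite /rz; case: (rl k) => [[[m j] m'] j'].
  by apply: valid_cj; [lia|apply: valid_wp; lia|apply: valid_wp; lia].
split.
  move=> k /in_seq hk; rewrite /ru; case: (rl k) => [[[m j] m'] j'].
  by apply: valid_cj; [lia|apply: valid_uw; lia|apply: valid_uw; lia].
have hu : forall i, valid_word (10 + nr) (uw i) by move=> i; apply: valid_uw; lia.
split.
  move=> x /= [<-|[<-|[<-|[<-|[<-|[<-|[]]]]]]]; apply: valid_cj; try lia; try exact: valid_pow;
    try (by apply: valid_wp; lia); by apply: hl => z /=; lia.
split; first by move=> t ht; apply: valid_cj => //; lia.
split.
  move=> k /in_seq hk; apply: valid_cj; first by lia.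
  - by apply: valid_letters => x [<-|[]]; lia.
  - by apply: valid_letters => x [<-|[]]; lia.
split.
  have hb : forall j, 6 <= j < 9 -> forall i, In i (seq 0 5 ++ seq 9 (S nr)) -> valid_word (10 + nr) (cj i [2 * j] [2 * j]).
    move=> j hj i /in_app_iff; rewrite !in_seq => hi; apply: valid_cj; first by lia.
    - by apply: valid_letters => x [<-|[]]; lia.
    - by apply: valid_letters => x [<-|[]]; lia.
  by do 3 (split; first by apply: hb; lia).
split.
  move=> i /in_seq hi; apply: valid_cj; first by lia.
  - by apply: hl => x [<-|[]]; lia.
  - by apply: hl => x [<-|[<-|[]]]; lia.
move=> i /in_seq hi; apply: valid_cj; first by lia.
- by apply: hl => x [<-|[<-|[<-|[]]]]; lia.
- by apply: hl => x [<-|[<-|[<-|[]]]]; lia.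
Qed.

Hypothesis rlwf : forall k, wf_rule (rl k).
Hypothesis a2 : 2 <= a.
Let P := pg relators.
Let yP : nat -> P := fun i => pcl relators [2 * i].
Lemma rl_default k : nr <= k -> rl k = (1, 0, 1, 0)%Z.
Proof. by move=> h; apply: nth_overflow. Qed.
Lemma yP_Rels : Rels rl tg 0 (Z.of_nat Q) a nr yP.
Proof.
apply/relators_Rels => r hr; rewrite /yP ev_pcl.
by apply/pcl_eq1; exact: weq_rel.
Qed.
(** The word for u'_i, the candidate torsion element: generator 6 is the copy of b, and the letters
    14, 15, 16, 17 are the copies of d and g with their inverses. *)
Definition cw (i : Z) := wp 6 i ++ [14] ++ wp 6 (- i) ++ [16] ++ wp 6 i ++ [15] ++ wp 6 (- i) ++ [17].
Lemma ev_cw (G : grp) (y : nat -> G) i : ev y (cw i) = comu (y 6) (y 7) (y 8) i.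
Proof.
rewrite /cw !ev_cat !ev_wp !gpowN /comu -[14]/(2 * 7) -[16]/(2 * 8) !ev1 /=.
rewrite (evl1_odd y 7) (evl1_odd y 8); by grp.
Qed.
Lemma presentation_torsion_free (A : nat -> Prop) : (forall n, A n -> 2 <= n) -> A a ->
  (pres_A_torsion_free A (10 + nr) relators <-> forall x, halts_of rl tg (Z.of_nat Q * x + 0)).
Proof.
move=> hA Aa; split.
- move=> tf x; case: (dec (halts_of rl tg (Z.of_nat Q * x + 0))) => // nh.
  have [G [y [rels ne]]] := @nontrivial_model rl tg 0 (Z.of_nat Q) a rlwf nr a2 _ nh.
  case: ne; rewrite -ev_cw.
  have hs := proj2 (relators_Rels y) rels.
  (* The commutator at Q x has trivial a-th power in the presented group, so torsion-freeness would
     make it trivial there, and hence in the model. *)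
  apply: (ev_sound (w' := []) hs); apply: (tf _ a) => //.
    rewrite /cw; repeat (apply: valid_app; [try (by apply: valid_wp; lia); by apply: valid_letters => z [<-|[]]; lia|]).
    by apply: valid_letters => z [<-|[]]; lia.
  apply/pcl_eq1; rewrite -ev_pcl ev_pow ev_cw.
  apply: (comu_torsion rlwf rl_default yP_Rels); exists x; exact: rst_refl.
- move=> h w n hw /hA hn e.
  have ah : forall i, start_class rl 0 (Z.of_nat Q) i -> halts_of rl tg i.
    move=> i [x hx]; have [t [ht et]] := h x; exists t; split=> //; exact: rst_trans hx et.
  have [G [y [tf [rels univ]]]] := @universal_torsion_free rl tg 0 (Z.of_nat Q) a rlwf nr rl_default ah.
  have [th [thh ths]] := univ P yP yP_Rels.
  have hs := proj2 (relators_Rels y) rels.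
  (* G has no torsion of any order, so all exponents of A are handled at once although the relators
     mention only one of them. *)
  have e1 : ev y w = 1%g.
    by apply: (tf _ n); [lia|rewrite -ev_pow; exact: (ev_sound (w' := []) hs e)].
  apply/pcl_eq1; rewrite -ev_pcl -(hom_ev thh ths hw) e1; exact: hom1.
Qed.
End Words.

(** * Computability of the reduction *)

Lemma code_pres_inj k rels k' rels' : code_pres k rels = code_pres k' rels' -> k = k' /\ rels = rels'.
Proof.
move=> /cpair_inj [-> /code_list_inj h]; split=> //.
by elim: rels rels' h => [|r l IH] [|r' l'] //= [/code_list_inj -> /IH ->].
Qed.
Lemma TF_code_pres A k rels : Forall (valid_word k) rels ->
  (TF_presentations A (code_pres k rels) <-> pres_A_torsion_free A k rels).
Proof.
move=> hv; split; last by move=> h; exists k, rels.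
by move=> [k' [rels' [/code_pres_inj [-> ->] [_ h]]]].
Qed.
Lemma computable_code_app p (L : nat -> list nat) : computable (fun n => code_list (L n)) -> computable (fun n => code_list (p ++ L n)).
Proof.
move=> h; elim: p => [|x p IH] //=.
by apply: computable_consc => //; exact: computable_const.
Qed.
Lemma code_repeat x n : code_list (repeat x n) = Nat.iter n (fun z => S (cpair x z)) 0.
Proof. by elim: n => [|n IH] //=; rewrite IH. Qed.
Lemma winv_wp i k : (0 <= k)%Z -> winv (wp i k) = repeat (2 * i + 1) (Z.to_nat k).
Proof.
move=> h; rewrite /wp; case: Z.leb_spec => [_|]; last by lia.
have -> : 2 * i + 1 = letter_inv (2 * i) by case: (letter_cases (2 * i)) => [] [j [e ->]]; lia.
by rewrite /winv map_repeat rev_repeat.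
Qed.

(** The coefficient 3^n Q occurs in a single relator, the one of the first rule for powers of z; the
    relators [ru] see only the offsets j. As this relator heads the list, the code is a computable
    word put before a constant tail. *)
Theorem TF_hard (A : nat -> Prop) : (forall n, A n -> 2 <= n) -> (exists n, A n) -> Pi02_hard (TF_presentations A).
Proof.
move=> hA [a Aa] S [R [[c hc] hS]]; have a2 := hA a Aa.
pose F n x y := epsilon (inhabits 0) (fun z => reval c [n; x; y] z /\ (R n x y <-> z = 0)).
have hF n x y : reval c [n; x; y] (F n x y) /\ (R n x y <-> F n x y = 0).
  by apply: (epsilon_spec (inhabits 0) (fun z => reval c [n; x; y] z /\ (R n x y <-> z = 0))); exact: hc.
have [Q [j [j' [rest [tg]]]]] := search_rules (fun n x y => proj1 (hF n x y)).
set r0 := fun n : nat => (Z.of_nat Q, Z.of_nat j, (pw 3 n * Z.of_nat Q)%Z, Z.of_nat j').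
move=> /= [wf spec].
pose nr := length rest; pose rel n := relators (r0 n :: rest) tg Q a.
exists (fun n => code_pres (10 + Datatypes.S nr) (rel n)); split; last first.
  move=> n; rewrite (TF_code_pres _ (relators_valid (r0 n :: rest) tg Q a)).
  rewrite (@presentation_torsion_free (r0 n :: rest) tg Q a (wf n) a2 A hA Aa) -spec hS.
  by split=> h x; have [y hy] := h x; exists y; apply/(proj2 (hF n x y)).
(* The first rule has the stable letter 10. The inverse of z to the power 3^n Q is written out as
   the letter 7 repeated, the count being obtained by tripling Q n times. *)
pose first n := [2 * 10] ++ wp 3 (Z.of_nat Q) ++ [2 * 10 + 1] ++ repeat (2 * 3 + 1) (Nat.iter n (fun z => 3 * z) Q).
have p3 n : Z.to_nat (pw 3 n * Z.of_nat Q) = Nat.iter n (fun z => 3 * z) Q.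
  elim: n => [|n IH] /=; first by rewrite Z.mul_1_l Nat2Z.id.
  have := @pw_pos 3 n; rewrite /= in IH; nia.
have p0 n : (0 <= pw 3 n * Z.of_nat Q)%Z by have := @pw_pos 3 n; nia.
have hrz n : map (rz (r0 n :: rest)) (seq 0 (Datatypes.S nr)) = first n :: map (rz (r0 0 :: rest)) (seq 1 nr).
  rewrite -[seq 0 _]/(0 :: seq 1 nr) map_cons; congr cons.
    by rewrite /first -p3 -(winv_wp 3 (p0 n)).
  by apply: map_ext_in => -[|k] /in_seq // hk; lia.
have hru n : map (ru (r0 n :: rest)) (seq 0 (Datatypes.S nr)) = map (ru (r0 0 :: rest)) (seq 0 (Datatypes.S nr)).
  by apply: map_ext => -[|k].
have [tl e] : exists tl, forall n, rel n = first n :: tl.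
  eexists => n; rewrite /rel /relators -[length (_ :: _)]/(Datatypes.S nr) hrz hru -app_comm_cons.
  reflexivity.
apply: computable_pair; first exact: computable_const.
apply: (@computable_ext (fun n => consc (code_list (first n)) (code_list (map code_list tl)))) => [n|]; first by rewrite e.
apply: computable_consc; last exact: computable_const.
apply: computable_code_app; apply: computable_code_app; apply: computable_code_app.
apply: (@computable_ext (fun n => Nat.iter (Nat.iter n (fun z => 3 * z) Q) (fun z => consc (2 * 3 + 1) z) 0)) => [n|].
  by rewrite code_repeat.
apply: computable_iter; [by apply: computable_consc; [exact: computable_const|exact: computable_id]| |exact: computable_const].
apply: computable_iter; [|exact: computable_id|exact: computable_const].
by apply: computable_mul; [exact: computable_const|exact: computable_id].
Qed.

Theorem theorem2p13 (A : nat -> Prop)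
  (HA2 : forall n, A n -> 2 <= n) (HAne : exists n, A n) :
  Pi02_hard (TF_presentations A) /\ (RE A -> Pi02_complete (TF_presentations A)).
Proof.
have hard := TF_hard HA2 HAne.
by split=> // re; split=> //; exact: TF_Pi02.
Qed.
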